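(* Let $M$ be a smooth manifold, $r\ge2$ an integer, and $H\in\Omega^{r+1}_{closed}(M)$ a closed $(r+1)$-form. There exists a Lie $r$-algebra structure on the complex $$C^\infty(M)\xrightarrow{d}\cdots\xrightarrow{d}\Omega^{r-2}(M)\xrightarrow{d}\Gamma(E^{r-1})=\chi(M)\oplus\Omega^{r-1}(M),$$ concentrated in degrees $-r+1,\dots,0$, whose only non-vanishing brackets (up to permutations of the entries) are the untwisted brackets (listed in the context) together with the following additional terms, to be added to the untwisted brackets, for $e_i=(X_i,\alpha_i)\in\Gamma(E^{r-1})$: - binary bracket: $[e_1,e_2]=\iota_{X_2}\iota_{X_1}H$; - $n$-ary bracket for $n\ge3$ an odd integer: $[e_1,\dots,e_n]=(-1)^{\frac{n-1}2}\cdot n\cdot B_{n-1}\cdot\iota_{X_n}\cdots\iota_{X_1}H$, where the $B$'s denote the Bernoulli numbers.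
   Context: $\chi(M)$ is the space of vector fields. $E^{r-1}=TM\oplus\wedge^{r-1}T^*M$ carries the pairing $\langle X+\alpha,Y+\beta\rangle=\iota_X\beta+\iota_Y\alpha$ and the Courant bracket $[\![X+\alpha,Y+\beta]\!]_{Cou}=[X,Y]+\mathcal{L}_X\beta-\mathcal{L}_Y\alpha-\frac12d(\iota_X\beta-\iota_Y\alpha)$. The space $\Gamma(E^{r-1})$ has degree $0$, and $\Omega^k(M)$, $0\le k\le r-2$, has degree $k-r+1$; the last differential sends $\xi$ to $(0,d\xi)$. Inside brackets $X$ stands for $(X,0)$ and an $(r-1)$-form $\alpha$ for $(0,\alpha)$; hats denote omission; brackets on permuted entries are determined by graded skew-symmetry. Untwisted brackets (all others zero), with $e_i=(X_i,\alpha_i)\in\Gamma(E^{r-1})$ and $\xi\in\Omega^{\bullet<r-1}(M)$: (1) unary: the de Rham differential in negative degrees. (2) binary: $[e_1,e_2]=[\![e_1,e_2]\!]_{Cou}$; $[e,\xi]=\frac12\mathcal{L}_X\xi$ for $e=(X,\alpha)$. (3) trinary: $[e_0,e_1,e_2]=-\frac16(\langle[\![e_0,e_1]\!]_{Cou},e_2\rangle+\text{cyclic permutations})$; $[\xi,e_1,e_2]=-\frac16\big(\frac12(\iota_{X_1}\mathcal{L}_{X_2}-\iota_{X_2}\mathcal{L}_{X_1})+\iota_{[X_1,X_2]}\big)\xi$. (4) $n$-ary, $n\ge3$ odd: $[e_0,\dots,e_{n-1}]=\sum_i[X_0,\dots,\alpha_i,\dots,X_{n-1}]$ ($\alpha_i$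 in the $i$-th slot in place of $X_i$), where $$[\alpha,X_1,\dots,X_{n-1}]=\frac{(-1)^{\frac{n+1}2}12B_{n-1}}{(n-1)(n-2)}\sum_{1\le i<j\le n-1}(-1)^{i+j+1}\iota_{X_{n-1}}\cdots\widehat{\iota_{X_j}}\cdots\widehat{\iota_{X_i}}\cdots\iota_{X_1}[\alpha,X_i,X_j],$$ and $[\xi,e_1,\dots,e_{n-1}]$ is given by the same right-hand side with $\alpha$ replaced by $\xi$; the trinary brackets $[\alpha,X_i,X_j]$, $[\xi,X_i,X_j]$ on the right are those of (3). An $L_\infty$-algebra is a graded vector space $V=\bigoplus_{i\in\mathbb Z}V_i$ with multilinear maps $l_n$ ($n\ge1$; here written $[\cdot,\dots,\cdot]$) in $n$ arguments, of degree $2-n$, which are graded skew-symmetric, $l_n(\dots,v_k,v_{k+1},\dots)=-(-1)^{|v_k||v_{k+1}|}l_n(\dots,v_{k+1},v_k,\dots)$, and satisfy for each $n\ge1$ $$\sum_{i+j=n+1}\ \sum_{\sigma\in Sh(i,n-i)}\chi(\sigma)(-1)^{i(j-1)}l_j\big(l_i(v_{\sigma(1)},\dots,v_{\sigma(i)}),v_{\sigma(i+1)},\dots,v_{\sigma(n)}\big)=0,$$ where $Sh(i,n-i)$ is the set of permutations preserving the order of the first $i$ and of the last $n-i$ elements, and $\chi(\sigma)$ is the sign of $\sigma$ times the Koszul sign of the permutation of $v_1,\dots,v_n$. A Lie $r$-algebra is an $L_\infty$-algebra concentrated in degrees $-r+1,\dots,0$. *)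

(* Defs.v *)
From HB Require Import structures.
From mathcomp Require Import all_boot all_order all_algebra perm.
From mathcomp Require Import ring.
From mathcomp Require Import all_classical all_reals all_analysis.

Set Implicit Arguments.
Unset Strict Implicit.
Unset Printing Implicit Defensive.

Import Order.TTheory GRing.Theory Num.Theory numFieldNormedType.Exports.
Local Open Scope classical_set_scope.
Local Open Scope ring_scope.

(* Only the values of f on the open set U matter, see eq_Ck. *)
Fixpoint Ck (R : realType) (m k : nat) (U : set 'rV[R]_m) (f : 'rV[R]_m -> R)
    : Prop :=
  (forall x, U x -> {for x, continuous f}) /\
  if k is k'.+1 then
    forall i : 'I_m, (forall x, U x -> derivable f x (delta_mx 0 i)) /\
                     Ck k' U ('D_(delta_mx 0 i) f)
  else True.

Definition smooth_on (R : realType) (m : nat) (U : set 'rV[R]_m)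
    (f : 'rV[R]_m -> R) : Prop := forall k, Ck k U f.

Record chart (R : realType) (m : nat) (M : topologicalType) := Chart {
  chart_dom : set M;
  chart_map : M -> 'rV[R]_m;
  chart_inv : 'rV[R]_m -> M;
  chart_img := chart_map @` chart_dom;
  chart_dom_open : open chart_dom;
  chart_img_open : open chart_img;
  chart_mapK : forall p, chart_dom p -> chart_inv (chart_map p) = p;
  chart_map_continuous : forall p, chart_dom p -> {for p, continuous chart_map};
  chart_inv_continuous : forall x, chart_img x -> {for x, continuous chart_inv} }.

(* The atlas need not be maximal: smoothness of functions depends only on the
   maximal atlas it generates. *)
Record smooth_manifold (R : realType) (m : nat) := SmoothManifold {
  manifold_space :> topologicalType;
  manifold_hausdorff : hausdorff_space manifold_space;
  manifold_second_countable : @second_countable manifold_space;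
  atlas : set (chart R m manifold_space);
  atlas_cover : forall p, exists2 c, atlas c & chart_dom c p;
  atlas_compatible : forall c c', atlas c -> atlas c' -> forall j : 'I_m,
    smooth_on (chart_map c @` (chart_dom c `&` chart_dom c'))
              (fun x => chart_map c' (chart_inv c x) 0 j) }.

Section CkTheory.
Context (R : realType) (m : nat) (U : set 'rV[R]_m).
Hypothesis openU : open U.
Implicit Types f g : 'rV[R]_m -> R.

Lemma eq_Ck k f g : (forall x, U x -> f x = g x) -> Ck k U f -> Ck k U g.
Proof.
have nfg f' g' x : (forall x, U x -> f' x = g' x) -> U x ->
    \near x, f' x = g' x.
  by move=> fg Ux; apply: filterS (open_nbhs_nbhs (conj openU Ux)) => y /fg.
have cfg f' g' x : (forall x, U x -> f' x = g' x) -> U x ->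
    {for x, continuous f'} -> {for x, continuous g'}.
  move=> fg Ux; rewrite /prop_for /continuous_at (fg x Ux).
  by apply: cvg_trans; apply: (@near_eq_cvg _ _ (nbhs x) _ f' g'); exact: nfg.
elim: k f g => [|k IH] f g fg /= [cf df]; split=> //.
1,2: by move=> x Ux; exact: cfg fg Ux (cf x Ux).
move=> i; have [dfi Cdfi] := df i; split.
- by move=> x Ux; apply: near_eq_derivable (dfi x Ux); exact: nfg.
- by apply: IH Cdfi => x Ux; apply: near_eq_derive; exact: nfg.
Qed.

Lemma Ck_cst k (a : R) : Ck k U (cst a).
Proof.
elim: k a => [|k IH] a /=; split=> //; try by move=> x _; exact: cst_continuous.
move=> i; split=> [x _|]; first exact: (derivable_cst a).
by apply: (@eq_Ck k (cst 0) _ _ (IH 0)) => x _; rewrite derive_cst.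
Qed.

Lemma CkW k f : Ck k.+1 U f -> Ck k U f.
Proof.
elim: k f => [|k IH] f [cf df]; split=> // i.
by have [dfi /IH] := df i.
Qed.

Lemma CkD k f g : Ck k U f -> Ck k U g -> Ck k U (f + g).
Proof.
elim: k f g => [|k IH] f g [cf df] [cg dg]; split=> //=.
1,2: by move=> x Ux; apply: continuousD; [exact: cf|exact: cg].
move=> i; have [dfi Cfi] := df i; have [dgi Cgi] := dg i; split=> [x Ux|].
  by apply: derivableD; [exact: dfi|exact: dgi].
apply: eq_Ck (IH _ _ Cfi Cgi) => x Ux.
by rewrite deriveD//; [exact: dfi|exact: dgi].
Qed.

Lemma CkM k f g : Ck k U f -> Ck k U g -> Ck k U (f * g).
Proof.
elim: k f g => [|k IH] f g Cf Cg; move: (Cf) (Cg) => [cf df] [cg dg]; split=> //=.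
1,2: by move=> x Ux; apply: continuousM; [exact: cf|exact: cg].
move=> i; have [dfi Cfi] := df i; have [dgi Cgi] := dg i; split=> [x Ux|].
  by apply: derivableM; [exact: dfi|exact: dgi].
apply: eq_Ck (CkD (IH _ _ (CkW Cf) Cgi) (IH _ _ (CkW Cg) Cfi)) => x Ux.
by rewrite deriveM//; [exact: dfi|exact: dgi].
Qed.

End CkTheory.

Section SmoothFunctions.
Context (R : realType) (m : nat) (M : smooth_manifold R m).

Definition smooth_fun : {pred M -> R} := fun f =>
  `[< forall c, atlas c -> smooth_on (chart_img c) (f \o chart_inv c) >].

Lemma smooth_fun_cst (a : R) : (cst a : M -> R) \in smooth_fun.
Proof. by apply/asboolP => c _ k; apply: Ck_cst; exact: chart_img_open. Qed.

Lemma smooth_funD f g :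
  f \in smooth_fun -> g \in smooth_fun -> f + g \in smooth_fun.
Proof.
move=> /asboolP sf /asboolP sg; apply/asboolP => c Mc k.
by apply: CkD; [exact: chart_img_open|exact: sf|exact: sg].
Qed.

Lemma smooth_funM f g :
  f \in smooth_fun -> g \in smooth_fun -> f * g \in smooth_fun.
Proof.
move=> /asboolP sf /asboolP sg; apply/asboolP => c Mc k.
by apply: CkM; [exact: chart_img_open|exact: sf|exact: sg].
Qed.

Lemma smooth_funZ (a : R) f : f \in smooth_fun -> a *: f \in smooth_fun.
Proof. exact: smooth_funM (smooth_fun_cst a). Qed.

Lemma smooth_fun_subring : subring_closed smooth_fun.
Proof.
split=> [|f g sf sg|f g]; [exact: smooth_fun_cst| |exact: smooth_funM].
by apply: smooth_funD => //; rewrite -scaleN1r; exact: smooth_funZ.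
Qed.
HB.instance Definition _ :=
  GRing.isSubringClosed.Build (M -> R) smooth_fun smooth_fun_subring.

Lemma smooth_fun_submod : subsemimod_closed smooth_fun.
Proof.
split; [split; [exact: rpred0|exact: smooth_funD] | exact: smooth_funZ].
Qed.
HB.instance Definition _ :=
  GRing.isSubSemiModClosed.Build R (M -> R) smooth_fun smooth_fun_submod.

Record Cinf := MkCinf { Cinf_val :> M -> R; Cinf_smooth : Cinf_val \in smooth_fun }.
HB.instance Definition _ := [isSub for Cinf_val].
HB.instance Definition _ := [Choice of Cinf by <:].
HB.instance Definition _ := 
  GRing.SubChoice_isSubComPzRing.Build _ _ Cinf smooth_fun_subring.
HB.instance Definition _ := [SubZmodule_isSubLmodule of Cinf by <:].


Definition derivation : {pred Cinf -> Cinf} := fun X =>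
  `[< (forall (a : R) (f g : Cinf), X (a *: f + g) = a *: X f + X g) /\
      (forall f g : Cinf, X (f * g) = X f * g + f * X g) >].

End SmoothFunctions.

Section VectorFields.
Context (R : realType) (m : nat) (M : smooth_manifold R m).
Notation A := (Cinf M).

Lemma Cinf_scaleAl (a : R) (f g : A) : a *: (f * g) = (a *: f) * g.
Proof. by apply/val_inj/funext => p; exact: (mulrA a). Qed.

Lemma Cinf_scaleAr (a : R) (f g : A) : a *: (f * g) = f * (a *: g).
Proof. by rewrite mulrC Cinf_scaleAl mulrC. Qed.

Lemma derivation_submod : subsemimod_closed (@derivation R m M).
Proof.
split; [split|].
- apply/asboolP; split=> [a f g|f g].
    by change (0 = a *: 0 + 0 :> A); rewrite scaler0 addr0.
  by change (0 = 0 * g + f * 0 :> A); rewrite mul0r mulr0 addr0.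
- move=> X Y /asboolP[Xl XM] /asboolP[Yl YM]; apply/asboolP.
  split=> [a f g|f g].
    change (X (a *: f + g) + Y (a *: f + g) =
            a *: (X f + Y f) + (X g + Y g) :> A).
    by rewrite Xl Yl scalerDr addrACA.
  change (X (f * g) + Y (f * g) = (X f + Y f) * g + f * (X g + Y g) :> A).
  by rewrite XM YM mulrDl mulrDr addrACA.
- move=> a X /asboolP[Xl XM]; apply/asboolP; split=> [b f g|f g].
    change (a *: X (b *: f + g) = b *: (a *: X f) + a *: X g :> A).
    by rewrite Xl scalerDr !scalerA mulrC.
  change (a *: X (f * g) = (a *: X f) * g + f * (a *: X g) :> A).
  by rewrite XM scalerDr Cinf_scaleAl Cinf_scaleAr.
Qed.
HB.instance Definition _ :=
  GRing.isSubmodClosed.Build R (A -> A) (@derivation R m M) derivation_submod.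

(* A smooth section p |-> X_p of TM, with T_pM the derivations of C^oo(M) at p,
   is the derivation f |-> (p |-> X_p f) of the algebra C^oo(M). *)
Record vfield := Vfield { vfield_val :> A -> A; vfieldP : vfield_val \in @derivation R m M }.
HB.instance Definition _ := [isSub for vfield_val].
HB.instance Definition _ := [Choice of vfield by <:].
HB.instance Definition _ :=
  GRing.SubChoice_isSubLmodule.Build _ _ _ vfield derivation_submod.

Implicit Types (X Y Z : vfield) (f g : A).

Lemma vfield_eq X Y : X =1 Y -> X = Y.
Proof. by move=> XY; apply/val_inj/funext. Qed.

Lemma vfield_linear X (a : R) f g : X (a *: f + g) = a *: X f + X g.
Proof. by have /asboolP[->] := vfieldP X. Qed.

Lemma vfieldM X f g : X (f * g) = X f * g + f * X g.
Proof. by have /asboolP[_ ->] := vfieldP X. Qed.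

Lemma vfieldD X f g : X (f + g) = X f + X g.
Proof. by have := vfield_linear X 1 f g; rewrite !scale1r. Qed.

Lemma vfield0 X : X 0 = 0.
Proof. by apply: (addrI (X 0)); rewrite -vfieldD !addr0. Qed.

Lemma vfieldZ X (a : R) f : X (a *: f) = a *: X f.
Proof. by have := vfield_linear X a f 0; rewrite vfield0 !addr0. Qed.

Lemma vfieldN X f : X (- f) = - X f.
Proof. by rewrite -scaleN1r vfieldZ scaleN1r. Qed.

Lemma vfieldB X f g : X (f - g) = X f - X g.
Proof. by rewrite vfieldD vfieldN. Qed.

Lemma vfield_mul_proof f X : (fun g => f * X g) \in @derivation R m M.
Proof.
apply/asboolP; split=> [a g h|g h].
  by rewrite vfield_linear mulrDr Cinf_scaleAr.
by rewrite vfieldM mulrDr mulrA (mulrCA f g).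
Qed.
Definition vfield_mul f X : vfield := Vfield (vfield_mul_proof f X).

Lemma lie_bracket_proof X Y : (fun f => X (Y f) - Y (X f)) \in @derivation R m M.
Proof.
apply/asboolP; split=> [a g h|g h].
  by rewrite !vfield_linear scalerBr opprD addrACA.
rewrite !vfieldM !vfieldD !vfieldM; ring.
Qed.
Definition lie_bracket X Y : vfield := Vfield (lie_bracket_proof X Y).

End VectorFields.

Definition omit (T : Type) (i : nat) (s : seq T) : seq T :=
  take i s ++ drop i.+1 s.

Definition replace (T : Type) (i : nat) (x : T) (s : seq T) : seq T :=
  take i s ++ x :: drop i.+1 s.

Section Forms.
Context (R : realType) (m : nat) (M : smooth_manifold R m).
Notation A := (Cinf M).
Notation V := (vfield M).

Implicit Types (w : seq V -> A) (X Y Z : V) (f g : A) (s t u : seq V).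

(* A k-form is an alternating C^oo(M)-multilinear function of k vector fields.  An
   element of the type dform below may have components of several degrees k, each
   the restriction to the lists of length k; see Omega for the k-forms. *)
Definition alternating_multilinear : {pred (seq V -> A)} := fun w =>
  `[< (forall s t f X Y, w (s ++ (vfield_mul f X + Y) :: t) =
                         f * w (s ++ X :: t) + w (s ++ Y :: t)) /\
      (forall s t u X, w (s ++ X :: t ++ X :: u) = 0) >].

Lemma alternating_multilinear_submod : subsemimod_closed alternating_multilinear.
Proof.
split; [split|].
- apply/asboolP; split=> // s t f X Y.
  by change (0 = f * 0 + 0 :> A); rewrite mulr0 addr0.
- move=> w w' /asboolP[wl wa] /asboolP[wl' wa']; apply/asboolP.
  split=> [s t f X Y|s t u X].
    by rewrite !addrfctE wl wl' mulrDr addrACA.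
  by rewrite !addrfctE wa wa' addr0.
- move=> a w /asboolP[wl wa]; apply/asboolP; split=> [s t f X Y|s t u X].
    by rewrite !scalrfctE wl scalerDr Cinf_scaleAr.
  by rewrite !scalrfctE wa scaler0.
Qed.
HB.instance Definition _ := GRing.isSubmodClosed.Build R (seq V -> A)
  alternating_multilinear alternating_multilinear_submod.

Record dform :=
  Dform { dform_val :> seq V -> A; dformP : dform_val \in alternating_multilinear }.
HB.instance Definition _ := [isSub for dform_val].
HB.instance Definition _ := [Choice of dform by <:].
HB.instance Definition _ := GRing.SubChoice_isSubLmodule.Build _ _ _ dform
  alternating_multilinear_submod.

Implicit Types (a b : dform).

Lemma form_linear a s t f X Y : a (s ++ (vfield_mul f X + Y) :: t) =
  f * a (s ++ X :: t) + a (s ++ Y :: t).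
Proof. by have /asboolP[->] := dformP a. Qed.

Lemma form_alt a s t u X : a (s ++ X :: t ++ X :: u) = 0.
Proof. by have /asboolP[_ ->] := dformP a. Qed.

Lemma vfield_mul1 X : vfield_mul 1 X = X.
Proof. by apply: vfield_eq => f; rewrite /= mul1r. Qed.

Definition slot_additive w :=
  forall s t X Y, w (s ++ (X + Y) :: t) = w (s ++ X :: t) + w (s ++ Y :: t).
Definition slot_scalable w :=
  forall s t f X, w (s ++ vfield_mul f X :: t) = f * w (s ++ X :: t).
Definition adjacent_alternating w := forall s t X, w (s ++ X :: X :: t) = 0.

Lemma form_add a : slot_additive a.
Proof.
by move=> s t X Y; rewrite -{1}[X]vfield_mul1 form_linear mul1r.
Qed.

Lemma slot_additive0 w : slot_additive w -> forall s t, w (s ++ 0 :: t) = 0.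
Proof.
move=> wD s t; apply: (addrI (w (s ++ 0 :: t))).
by rewrite -wD !addr0.
Qed.

Lemma form_scale a : slot_scalable a.
Proof.
move=> s t f X; rewrite -[vfield_mul f X]addr0 form_linear.
by rewrite (slot_additive0 (@form_add a)) addr0.
Qed.

Lemma adjacent_swap w : slot_additive w -> adjacent_alternating w ->
  forall s t X Y, w (s ++ X :: Y :: t) = - w (s ++ Y :: X :: t).
Proof.
move=> wD wa s t X Y; apply/eqP; rewrite -subr_eq0 opprK.
have := wa s t (X + Y); rewrite wD.
have cat1 Z W : s ++ Z :: W :: t = (s ++ [:: Z]) ++ W :: t by rewrite -catA.
by rewrite !cat1 !wD -!cat1 !wa add0r addr0 => ->.
Qed.

Lemma move_front w : slot_additive w -> adjacent_alternating w ->
  forall p s t X, w (p ++ X :: s ++ t) = (-1) ^+ size s * w (p ++ s ++ X :: t).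
Proof.
move=> wD wa p s; elim: s p => [|Y s IH] p t X /=; first by rewrite expr0 mul1r.
rewrite adjacent_swap//; have := IH (p ++ [:: Y]) t X.
by rewrite -!catA /= => ->; rewrite exprS mulN1r mulNr.
Qed.

Lemma alternating_multilinearP w :
  slot_additive w -> slot_scalable w -> adjacent_alternating w ->
  w \in alternating_multilinear.
Proof.
move=> wD wZ wa; apply/asboolP; split=> [s t f X Y|s t u X].
  by rewrite wD wZ.
by rewrite move_front// catA wa mulr0.
Qed.

Lemma form_adj a : adjacent_alternating a.
Proof. by move=> s t X; rewrite (form_alt a s [::] t). Qed.

Lemma form_swap a s t X Y : a (s ++ X :: Y :: t) = - a (s ++ Y :: X :: t).
Proof. exact: adjacent_swap (@form_add a) (@form_adj a) _ _ _ _. Qed.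

Definition contract_fun X w : seq V -> A := fun s => w (X :: s).

Lemma contract_proof X a : contract_fun X a \in alternating_multilinear.
Proof.
apply/asboolP; split=> [s t f Y Z|s t u Y].
  exact: (form_linear a (X :: s)).
exact: (form_alt a (X :: s)).
Qed.
Definition contract X a : dform := Dform (contract_proof X a).

Definition Lie_fun X w : seq V -> A := fun s =>
  X (w s) - \sum_(i < size s) w (replace i (lie_bracket X s`_i) s).

Lemma Lie_fun_cons X w Y s :
  Lie_fun X w (Y :: s) =
  Lie_fun X (contract_fun Y w) s - w (lie_bracket X Y :: s).
Proof.
rewrite /Lie_fun /= big_ord_recl /replace /= drop0 opprD addrA.
rewrite addrAC -!addrA; congr (_ + _); exact: addrC.
Qed.

Definition extd_fun w : seq V -> A := fun s =>
  \sum_(i < size s) (-1) ^+ i * s`_i (w (omit i s)) +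
  \sum_(j < size s) \sum_(i < j)
     (-1) ^+ (i + j) * w (lie_bracket s`_i s`_j :: omit i (omit j s)).

Lemma Lie_fun_lin X f w w1 w2 : (forall s, w s = f * w1 s + w2 s) ->
  forall s, Lie_fun X w s = X f * w1 s + f * Lie_fun X w1 s + Lie_fun X w2 s.
Proof.
move=> ww s; rewrite /Lie_fun ww vfieldD vfieldM.
under eq_bigr => i _ do rewrite ww.
rewrite big_split /= -mulr_sumr; ring.
Qed.

Lemma lie_bracketDr X Y Z :
  lie_bracket X (Y + Z) = lie_bracket X Y + lie_bracket X Z.
Proof.
apply: vfield_eq => f.
change (X (Y f + Z f) - (Y (X f) + Z (X f)) =
        (X (Y f) - Y (X f)) + (X (Z f) - Z (X f)) :> A).
rewrite vfieldD; ring.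
Qed.

Lemma lie_bracketMr X f Y :
  lie_bracket X (vfield_mul f Y) = vfield_mul f (lie_bracket X Y) + vfield_mul (X f) Y.
Proof.
apply: vfield_eq => g.
change (X (f * Y g) - f * Y (X g) =
        f * (X (Y g) - Y (X g)) + X f * Y g :> A).
rewrite vfieldM; ring.
Qed.

Lemma lie_bracketC X Y : lie_bracket X Y = - lie_bracket Y X.
Proof.
apply: vfield_eq => g.
by change (X (Y g) - Y (X g) = - (Y (X g) - X (Y g)) :> A); rewrite opprB.
Qed.

Lemma lie_bracketXX X : lie_bracket X X = 0.
Proof. by apply: vfield_eq => g; exact: subrr. Qed.

Lemma Lie_proof X a : Lie_fun X a \in alternating_multilinear.
Proof.
suff H s : forall a, [/\
    forall t f Y Z, Lie_fun X a (s ++ (vfield_mul f Y + Z) :: t) =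
      f * Lie_fun X a (s ++ Y :: t) + Lie_fun X a (s ++ Z :: t) &
    forall t Y, Lie_fun X a (s ++ Y :: Y :: t) = 0].
  apply: alternating_multilinearP => [s t Y Z|s t f Y|s t Y].
  - have [/(_ t 1 Y Z) + _] := H s a.
    by rewrite vfield_mul1 mul1r.
  - have [l _] := H s a.
    have l0 : Lie_fun X a (s ++ 0 :: t) = 0.
      apply: (addrI (Lie_fun X a (s ++ 0 :: t))).
      have := l t 1 0 0; rewrite vfield_mul1 mul1r addr0 => <-.
      by rewrite addr0.
    by have := l t f Y 0; rewrite l0 !addr0.
  - by have [_ ->] := H s a.
elim: s => [|W s IH] {}a; last first.
  have /= [l al] := IH (contract W a).
  split=> [t f Y Z|t Y]; rewrite /= !Lie_fun_cons.
    have /= -> := form_linear a (lie_bracket X W :: s) t f Y Z.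
    by have /= -> := l t f Y Z; ring.
  have /= -> := form_adj a (lie_bracket X W :: s) t Y.
  by have /= -> := al t Y; rewrite subrr.
split=> [t f Y Z|t Y] /=; rewrite !Lie_fun_cons.
  rewrite (@Lie_fun_lin X f _ (contract_fun Y a) (contract_fun Z a)); last first.
    by move=> u; exact: (form_linear a [::]).
  rewrite lie_bracketDr lie_bracketMr.
  rewrite (form_add a [::]) (form_linear a [::]) (form_scale a [::]) /=.
  rewrite /contract_fun; ring.
have -> : contract_fun Y (contract_fun Y a) = cst 0.
  by apply/funext => u; exact: (form_adj a [::]).
have -> : Lie_fun X (cst 0) t = 0.
  by rewrite /Lie_fun big1 ?subr0 //; exact: vfield0.
by rewrite /contract_fun (form_swap a [::]) /= opprK add0r subrr.
Qed.
Definition Lie X a : dform := Dform (Lie_proof X a).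

Lemma extd_fun0 w : extd_fun w [::] = 0.
Proof. by rewrite /extd_fun !big_ord0 addr0. Qed.

Lemma eq_d_fun w w' : w =1 w' -> extd_fun w =1 extd_fun w'.
Proof. by move=> /funext->. Qed.

Lemma extd_funD w1 w2 s : extd_fun (fun s => w1 s + w2 s) s = extd_fun w1 s + extd_fun w2 s.
Proof.
rewrite /extd_fun addrACA; congr (_ + _); rewrite -big_split /=; apply: eq_bigr => i _.
  by rewrite vfieldD mulrDr.
by rewrite -big_split; apply: eq_bigr => j _ /=; rewrite mulrDr.
Qed.

Lemma extd_fun_cons a X s : extd_fun a (X :: s) = Lie X a s - extd_fun (contract X a) s.
Proof.
rewrite /extd_fun /= /Lie_fun.
rewrite [X in X + _]big_ord_recl [X in _ + X]big_ord_recl /=.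
rewrite big_ord0 add0r expr0 mul1r /omit /= drop0.
rewrite -!addrA; congr (_ + _).
rewrite opprD addrCA; congr (_ + _).
  rewrite -sumrN; apply: eq_bigr => i _ /=.
  by rewrite /bump /= exprS mulN1r mulNr.
rewrite -!sumrN -big_split /=; apply: eq_bigr => j _.
rewrite /bump /= add0n add1n big_ord_recl /= drop0 add0n exprS mulN1r mulNr.
congr (_ + _).
  congr (- _); rewrite /replace.
  have lt_j : (j < size s)%N by [].
  have := move_front (@form_add a) (@form_adj a) [::] (take j s) (drop j.+1 s)
    (lie_bracket X s`_j).
  by rewrite /= size_take lt_j => ->; rewrite mulrA -exprD -signr_odd oddD addbb mul1r.
rewrite -sumrN; apply: eq_bigr => i _.
rewrite /bump /= add1n add0n addSn addnS !exprS !mulN1r opprK -mulrN.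
by rewrite (form_swap a [::]).
Qed.

Lemma LieDl X Y a s : Lie (X + Y) a s = Lie X a s + Lie Y a s.
Proof.
rewrite /= /Lie_fun addrACA -opprD -big_split; congr (_ - _).
apply: eq_bigr => i _; rewrite /replace.
by rewrite lie_bracketC lie_bracketDr opprD -!lie_bracketC form_add.
Qed.

Lemma extd_fun_additive a : slot_additive (extd_fun a).
Proof.
move=> s; elim: s a => [|W s IH] a t X Y /=; rewrite !extd_fun_cons; last first.
  by rewrite IH form_add opprD addrACA.
rewrite LieDl [RHS]addrACA -[X in _ = _ + X]opprD -extd_funD; congr (_ - _).
by apply: eq_d_fun => u; exact: (form_add a [::]).
Qed.

Lemma extd_fun_adj a : adjacent_alternating (extd_fun a).
Proof.
move=> s; elim: s a => [|W s IH] a t X /=; rewrite !extd_fun_cons; last first.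
  by rewrite IH form_adj subrr.
rewrite opprB /= Lie_fun_cons lie_bracketXX (slot_additive0 (@form_add a) [::]).
rewrite subr0 addrC subrK.
have c0 : contract X (contract X a) =1 cst 0.
  by move=> u; exact: (form_adj a [::]).
rewrite (eq_d_fun c0); have := extd_funD (cst 0) (cst 0) t.
have -> : (fun s => cst 0 s + cst 0 s) = cst 0 :> (seq V -> A).
  by apply/funext => u; exact: addr0.
by move=> /(congr1 (fun z => z - extd_fun (cst 0) t)); rewrite subrr addrK => <-.
Qed.

Lemma extd_fun_scalable a : slot_scalable (extd_fun a).
Proof.
move=> s t f X; have [n] := ubnP (size s + size t).
elim: n a s t X => // n IH a [|Y s] t X /= lt_n; last first.
  by rewrite addSn ltnS in lt_n; rewrite !extd_fun_cons form_scale IH// -mulrBr.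
case: t lt_n => [_|Y t lt_n].
  rewrite !extd_fun_cons !extd_fun0 !subr0 /= /Lie_fun !big_ord0 !subr0.
  by [].
have sw := adjacent_swap (@extd_fun_additive a) (@extd_fun_adj a) [::].
rewrite /= in sw; rewrite !(sw t _ Y) mulrN !(extd_fun_cons a Y).
rewrite add0n ltnS in lt_n.
have -> : Lie Y a (vfield_mul f X :: t) = f * Lie Y a (X :: t).
  exact: (form_scale _ [::]).
have -> : extd_fun (contract Y a) (vfield_mul f X :: t) =
          f * extd_fun (contract Y a) (X :: t) by exact: (IH _ [::]).
by rewrite -mulrBr -mulrN.
Qed.

Lemma extd_proof a : extd_fun a \in alternating_multilinear.
Proof.
exact: alternating_multilinearP (@extd_fun_additive a) (@extd_fun_scalable a)
  (@extd_fun_adj a).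
Qed.
Definition extd a : dform := Dform (extd_proof a).

End Forms.

Section Bernoulli.
Context (R : numFieldType).

(* B_0, ..., B_(n-1), from \sum_(i < k.+1) 'C(k.+1, i) B_i = [k = 0] *)
Fixpoint bernoulli_seq (n : nat) : seq R :=
  if n is k.+1 then
    let B := bernoulli_seq k in
    rcons B ((k == 0%N)%:R -
             k.+1%:R^-1 * \sum_(i < k) 'C(k.+1, i)%:R * B`_i)
  else [::].

Definition bernoulli (n : nat) : R := (bernoulli_seq n.+1)`_n.

Lemma size_bernoulli_seq n : size (bernoulli_seq n) = n.
Proof. by elim: n => //= n IH; rewrite size_rcons IH. Qed.

Lemma nth_bernoulli_seq n i : (i < n)%N -> (bernoulli_seq n)`_i = bernoulli i.
Proof.
elim: n => // n IH; rewrite ltnS leq_eqVlt => /orP[/eqP->//|lt_in].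
by rewrite /= nth_rcons size_bernoulli_seq lt_in IH.
Qed.

Lemma bernoulliE k :
  \sum_(i < k.+1) 'C(k.+1, i)%:R * bernoulli i = (k == 0%N)%:R.
Proof.
rewrite big_ord_recr /= /bernoulli /= nth_rcons size_bernoulli_seq ltnn eqxx.
rewrite binSn mulrBr mulVKf ?pnatr_eq0//.
under eq_bigr => i _ do rewrite -/(bernoulli i) -(nth_bernoulli_seq (ltn_ord i)).
by rewrite addrC subrK; case: k => [|k] /=; rewrite ?mul1r ?mulr0.
Qed.

End Bernoulli.

Section Linfty.
Context (R : realType) (W : lmodType R).
Implicit Types (V : int -> set W) (l : seq W -> W) (ds dt : seq int)
  (s t : seq W).

(* V = \bigoplus_i V_i, as a sum of subspaces of an ambient space W *)
Record graded_space V : Prop := GradedSpace {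
  component0 : forall i, V i 0;
  component_lin : forall i (a : R) x y, V i x -> V i y -> V i (a *: x + y);
  component_direct : forall (I : seq int) (x : int -> W), uniq I ->
    (forall i, V i (x i)) -> \sum_(i <- I) x i = 0 ->
    forall i, i \in I -> x i = 0 }.

Definition homogeneous V ds s : Prop :=
  size ds = size s /\ forall i, (i < size s)%N -> V ds`_i s`_i.

(* Sh(i, n - i) *)
Definition shuffle (n i : nat) (sigma : 'S_n) : bool :=
  [forall a : 'I_n, forall b : 'I_n,
    (a < b)%N && ((b < i)%N || (i <= a)%N) ==> (sigma a < sigma b)%N].

Definition koszul_sign (n : nat) (sigma : 'S_n) ds : R :=
  \prod_(ab : 'I_n * 'I_n | (ab.1 < ab.2)%N && (sigma ab.2 < sigma ab.1)%N)
    (-1) ^+ absz (ds`_(sigma ab.1) * ds`_(sigma ab.2)).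

Definition chi (n : nat) (sigma : 'S_n) ds : R :=
  (-1) ^+ sigma * koszul_sign sigma ds.

Definition permute s (sigma : 'S_(size s)) : seq W :=
  [seq s`_(sigma k) | k : 'I_(size s)].

(* l s is the bracket l_n of the n elements of the list s.  A multilinear map on
   V is given by its values on homogeneous elements, so the values of l on other
   lists, and on [::], are irrelevant. *)
Record Linfty_brackets V l : Prop := LinftyBrackets {
  bracket_multilinear : forall ds s dt t e (a : R) x y,
    homogeneous V ds s -> homogeneous V dt t -> V e x -> V e y ->
    l (s ++ (a *: x + y) :: t) = a *: l (s ++ x :: t) + l (s ++ y :: t);
  bracket_degree : forall ds s, homogeneous V ds s -> (0 < size s)%N ->
    V (\sum_(i <- ds) i + 2 - (size s)%:Z) (l s);
  bracket_skew : forall ds s dt t e f x y,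
    homogeneous V ds s -> homogeneous V dt t -> V e x -> V f y ->
    l (s ++ x :: y :: t) = - ((-1) ^+ absz (e * f) *: l (s ++ y :: x :: t));
  bracket_jacobi : forall ds s, homogeneous V ds s -> (0 < size s)%N ->
    \sum_(1 <= i < (size s).+1)
      \sum_(sigma : 'S_(size s) | shuffle i sigma)
        (let j := ((size s).+1 - i)%N in
         (chi sigma ds * (-1) ^+ (i * (j - 1))) *:
           l (l (take i (permute sigma)) :: drop i (permute sigma))) = 0 }.

Record Lie_algebra (r : nat) V l : Prop := LieAlgebra {
  Lie_graded : graded_space V;
  Lie_brackets : Linfty_brackets V l;
  Lie_concentrated : forall i x, V i x -> ~~ (- r%:Z + 1 <= i <= 0) -> x = 0 }.

End Linfty.

Section Brackets.
Context (R : realType) (m : nat) (M : smooth_manifold R m).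
Notation V := (vfield M).
Notation F := (dform M).

Definition Omega (k : nat) : set F :=
  [set a | forall s : seq V, size s != k -> a s = 0].

(* (X, a) with a in Omega^(r-1) is a section of E^(r-1); a form xi of degree
   k <= r - 2 sits in degree k - r + 1 as (0, xi). *)
Definition Ecomplex (r : nat) (i : int) : set (V * F) :=
  if i == 0 then [set e | Omega r.-1 e.2]
  else [set e | e = 0 \/
    exists k, [/\ (k <= r - 2)%N, i = k%:Z - r%:Z + 1, e.1 = 0 & Omega k e.2]].

Implicit Types (e : V * F) (X Y : V) (a xi H : F).

Definition pairing e1 e2 : F := contract e1.1 e2.2 + contract e2.1 e1.2.

Definition courant e1 e2 : V * F :=
  (lie_bracket e1.1 e2.1,
   Lie e1.1 e2.2 - Lie e2.1 e1.2
   - 2^-1 *: extd (contract e1.1 e2.2 - contract e2.1 e1.2)).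

Definition trinary_sections e0 e1 e2 : F :=
  - 6^-1 *: (pairing (courant e0 e1) e2 + pairing (courant e1 e2) e0
             + pairing (courant e2 e0) e1).

Definition trinary_form xi X1 X2 : F :=
  - 6^-1 *: (2^-1 *: (contract X1 (Lie X2 xi) - contract X2 (Lie X1 xi))
             + contract (lie_bracket X1 X2) xi).

(* \iota_(X_k) ... \iota_(X_1) a for Xs = [:: X_1; ...; X_k] *)
Definition contracts (Xs : seq V) a : F :=
  foldl (fun b X => contract X b) a Xs.

(* [b, X_1, ..., X_(n-1)] for Xs = [:: X_1; ...; X_(n-1)], where b is an (r-1)-form
   or an element of negative degree, and T X Y = [b, X, Y].  The indices i and j
   start at 0 here, which does not change the parity of i + j + 1. *)
Definition nary_from_trinary (T : V -> V -> F) (Xs : seq V) : F :=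
  let n := (size Xs).+1 in
  ((-1) ^+ n.+1./2 * 12 * bernoulli R (n - 1) / ((n - 1)%:R * (n - 2)%:R)) *:
  \sum_(j < size Xs) \sum_(i < j)
    (-1) ^+ (i + j + 1) *: contracts (omit i (omit j Xs)) (T Xs`_i Xs`_j).

(* All entries have degree 0, so moving alpha_i from the i-th slot to the front
   gives the sign (-1)^i. *)
Definition nary_sections (es : seq (V * F)) : F :=
  \sum_(i < size es) (-1) ^+ i *:
    nary_from_trinary
      (fun X Y => trinary_sections (0, (es`_i).2) (X, 0) (Y, 0))
      [seq e.1 | e <- omit i es].

Definition nary_form xi (Xs : seq V) : F := nary_from_trinary (trinary_form xi) Xs.

Definition nary_twist H (Xs : seq V) : F :=
  let n := size Xs in
  ((-1) ^+ (n - 1)./2 * n%:R * bernoulli R (n - 1)) *: contracts Xs H.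

End Brackets.

(* Main.v *)
Require Import Defs.
From HB Require Import structures.
From mathcomp Require Import all_boot all_order all_algebra perm.
From mathcomp Require Import all_classical all_reals all_analysis.
From mathcomp Require Import ring lra zify.

Set Implicit Arguments.
Unset Strict Implicit.
Unset Printing Implicit Defensive.

Import Order.TTheory GRing.Theory Num.Theory numFieldNormedType.Exports.
Local Open Scope classical_set_scope.
Local Open Scope ring_scope.

Local Notation contract := Defs.contract.

(** The brackets look complicated only because of the coordinates in which they
are written.  The Lie algebra of vector fields acts by Lie derivatives on the
complex of forms of degree less than [r], truncated by dropping [d] on the
forms of degree [r - 1]; this gives a strict structure, with the brackets [d],
[L_X] and [[X, Y]] only.  A closed form [H] of degree [r + 1] deforms it by the
cocycles [iota_(X_n) ... iota_(X_1) H], [n >= 2].  The structure of the theorem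
is the image of this one under a non-linear change of the form variable, and
the Bernoulli numbers are the coefficients of the inverse of that change.

To make this precise, consider cochains, i.e. functions of lists of elements of
[V * F] with values in forms.  With [c] the tautological odd vector field, the
operators [iota_c], [Lie_c = [d_c, iota_c]] and [iota_cc = [Lie_c, iota_c]] act on
them, [iota_c] is locally nilpotent and commutes with [iota_cc].  Hence every
power series in [iota_c] is defined ([ser]), and moving one of them across [d_c]
or the Chevalley-Eilenberg differential [CE_c] is a Taylor expansion of length
three ([d_c_ser], [CE_c_ser]).  Let [f = (1 - e^-t)/t], whose inverse is
[b = t/(1 - e^-t)], the generating series of the numbers [(-1)^k B_k].

The brackets with one form as an entry define an operator [bracket_diff], and
[intertwining] says that on forms of degree less than [r] the operator [ser f]
conjugates it to the differential [strict_diff] of the strict structure.  As the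
latter squares to zero ([strict_diff_strict_diff]), so does [bracket_diff]
([bracket_diff_bracket_diff]).
In the same way the terms with [H] form the cochain [- ser (t (b - 1)) H], which
[ser f] maps to the part of [- e^(- iota_c) H] of form degree less than [r]; this
is a cocycle because [dH = 0] ([bracket_diff_twist]).

All brackets together are one cochain [form_part], the sum of [bracket_diff]
applied to the form entry and of the terms with [H].  The Jacobi identities say
exactly that [bracket_diff form_part = 0] ([bracket_diff_form_part],
[jacobi_form]): an operator that is linear over the scalar cochains is
determined by its values on constants through a signed sum over shuffles
([cochain_linear]), and the sums over shuffle permutations are of this kind
([sum_shufflesE]).  A Koszul sign is trivial unless two entries have
negative degree, and then all terms of the identity vanish ([bracket_vanish]).  The
remaining work is the evaluation of the power series on constants, which gives
the explicit formulas ([bracket_op_cst_nary], [twist_odd]). *)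

(** * Cochains and the Lie derivative *)

Section PointwiseOperations.
Context (R : numFieldType) (T : Type) (N : lmodType R).
Implicit Types (w : T -> N) (x : T).

Lemma funD w w' x : (w + w') x = w x + w' x. Proof. by []. Qed.
Lemma funN w x : (- w) x = - w x. Proof. by []. Qed.
Lemma funB w w' x : (w - w') x = w x - w' x. Proof. by []. Qed.
Lemma funZ (a : R) w x : (a *: w) x = a *: w x. Proof. by []. Qed.

End PointwiseOperations.

(** Identities of abelian groups between sums of signed terms: every term is
moved next to its opposite and cancelled. *)
Ltac pull z :=
  lazymatch goal with
  | |- z + _ = _ => idtac
  | |- _ => rewrite [in LHS](addrCA _ z _); pull z
  end.
Ltac cancel_terms :=
  lazymatch goal with
  | |- 0 = 0 => reflexivity
  | |- 0 + _ = 0 => rewrite [LHS]add0r; cancel_terms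
  | |- - ?z + ?r = 0 => pull z; rewrite [LHS]addNKr; cancel_terms
  | |- ?z + ?r = 0 => pull (- z); rewrite [LHS]addKr; cancel_terms
  end.
Ltac abel :=
  apply: subr0_eq; rewrite -[LHS]addr0 ?(opprD, opprK, oppr0) -?addrA; cancel_terms.

Section Slots.
Context (R : numFieldType) (T : Type) (N : lmodType R).
Implicit Types (w : seq T -> N) (X : T) (s : seq T).

Definition slot X w : seq T -> N := fun s => w (X :: s).

(** The sign that exchanges the two conventions for an odd operator: acting on
the value only, or as an odd element that passes the arguments. *)
Definition eps w : seq T -> N := fun s => (-1) ^+ size s *: w s.

Definition cst_cochain (x : N) : seq T -> N := fun s => if s is [::] then x else 0.

Lemma eps_is_linear : linear eps.
Proof.
move=> a w w'; apply/funext => s.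
by rewrite funD funZ /eps funD funZ scalerDr !scalerA mulrC.
Qed.
HB.instance Definition _ := GRing.isLinear.Build R _ _ _ eps eps_is_linear.

Lemma cst_cochain_is_linear : linear cst_cochain.
Proof.
move=> a x y; apply/funext => -[|X s] //=.
by rewrite funD funZ /= scaler0 addr0.
Qed.
HB.instance Definition _ :=
  GRing.isLinear.Build R _ _ _ cst_cochain cst_cochain_is_linear.

Lemma epsK w : eps (eps w) = w.
Proof. by apply/funext => s; rewrite /eps scalerA -exprMn mulrNN mulr1 expr1n scale1r. Qed.

Lemma slot_eps X w : slot X (eps w) = - eps (slot X w).
Proof. by apply/funext => s; rewrite funN /slot /eps /= exprS mulN1r scaleNr. Qed.

End Slots.

Section LieCochains.
Context (R : numFieldType) (E N : lmodType R).
Implicit Types (w : seq E -> N) (X Y Z : E) (s t : seq E).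

Definition slot_linear w := forall s t (a : R) X Y,
  w (s ++ (a *: X + Y) :: t) = a *: w (s ++ X :: t) + w (s ++ Y :: t).

Lemma slot_linear_slot X w : slot_linear w -> slot_linear (slot X w).
Proof. by move=> wl s t a Y Z; exact: (wl (X :: s)). Qed.

Lemma slot_linearB w X Y s : slot_linear w ->
  w (X - Y :: s) = w (X :: s) - w (Y :: s).
Proof.
move=> wl; have /= := wl [::] s (-1) Y X.
by rewrite !scaleN1r addrC => ->; rewrite addrC.
Qed.

Variables (br : E -> E -> E) (act : E -> {linear N -> N}).

(** The arguments are replaced one at a time and in place, as for Leibniz
algebras; for alternating cochains the bracket is moved to the front in
[theta_shuffle_sum]. *)
Fixpoint theta X w s : N :=
  if s is Y :: s' then w (br X Y :: s') + theta X (slot Y w) s' else 0.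

(** Locked: otherwise unification unfolds it to a difference of functions. *)
Definition lie_cochain X := locked (fun w s => act X (w s) - theta X w s).

Lemma lie_cochainE X w s : lie_cochain X w s = act X (w s) - theta X w s.
Proof. by rewrite /lie_cochain -lock. Qed.

(** The Chevalley-Eilenberg differential, defined by the Cartan formula for the
contraction with the first argument.  All proofs about it are inductions on the
list of arguments which use this formula, for all cochains simultaneously. *)
Fixpoint ce w s : N :=
  if s is X :: s' then lie_cochain X w s' - ce (slot X w) s' else 0.

Lemma theta_is_linear X : linear (theta X).
Proof.
move=> a w w'; apply/funext => s; elim: s w w' => [|Y s IH] w w'.
  by rewrite funD funZ /= scaler0 addr0.
rewrite funD funZ /= funD funZ scalerDr addrACA; congr (_ + _).
have -> : slot Y (a *: w + w') = a *: slot Y w + slot Y w' by [].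
by rewrite IH.
Qed.
HB.instance Definition _ X := GRing.isLinear.Build R _ _ _ (theta X) (@theta_is_linear X).

Lemma lie_cochain_is_linear X : linear (lie_cochain X).
Proof.
move=> a w w'; apply/funext => s; rewrite funD funZ !lie_cochainE theta_is_linear.
by rewrite !funD !funZ linearP scalerBr opprD addrACA.
Qed.
HB.instance Definition _ X :=
  GRing.isLinear.Build R _ _ _ (lie_cochain X) (@lie_cochain_is_linear X).

Lemma ce_is_linear : linear ce.
Proof.
move=> a w w'; apply/funext => s; elim: s w w' => [|Y s IH] w w'.
  by rewrite funD funZ /= scaler0 addr0.
change (lie_cochain Y (a *: w + w') s - ce (a *: slot Y w + slot Y w') s =
  a *: (lie_cochain Y w s - ce (slot Y w) s) +
  (lie_cochain Y w' s - ce (slot Y w') s)).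
rewrite IH lie_cochain_is_linear.
move: (lie_cochain Y w) (lie_cochain Y w') => f g.
by rewrite !funD !funZ scalerBr addrACA -opprD.
Qed.
HB.instance Definition _ := GRing.isLinear.Build R _ _ _ ce ce_is_linear.

Lemma slot_lie_cochain X Z w :
  slot Z (lie_cochain X w) = lie_cochain X (slot Z w) - slot (br X Z) w.
Proof.
by apply/funext => s; rewrite funB /slot !lie_cochainE /= opprD addrA addrAC.
Qed.

Lemma slot_ce X w : slot X (ce w) = lie_cochain X w - ce (slot X w).
Proof. by []. Qed.

Hypothesis brJ : forall X Y Z, br (br X Y) Z = br X (br Y Z) - br Y (br X Z).
Hypothesis act_br : forall X Y a, act (br X Y) a = act X (act Y a) - act Y (act X a).

(** Slot-linearity is used once, to split the difference given by [brJ] in the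
first slot. *)
Lemma lie_cochain_br X Y w : slot_linear w ->
  lie_cochain (br X Y) w =
  lie_cochain X (lie_cochain Y w) - lie_cochain Y (lie_cochain X w).
Proof.
move=> wl; apply/funext => s; rewrite funB.
elim: s w wl => [|Z s IH] w wl; first by rewrite !lie_cochainE /= !subr0 act_br.
change (slot Z (lie_cochain (br X Y) w) s =
  (slot Z (lie_cochain X (lie_cochain Y w)) -
   slot Z (lie_cochain Y (lie_cochain X w))) s).
rewrite !slot_lie_cochain !linearB /=.
rewrite !(funD, funN) IH; last exact: slot_linear_slot.
rewrite /slot brJ slot_linearB //; abel.
Qed.

Lemma ce_lie_cochain X w : slot_linear w ->
  ce (lie_cochain X w) = lie_cochain X (ce w).
Proof.
move=> wl; apply/funext => s; elim: s w wl => [|Z s IH] w wl.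
  by rewrite lie_cochainE /= linear0 subr0.
change (slot Z (ce (lie_cochain X w)) s = slot Z (lie_cochain X (ce w)) s).
rewrite slot_ce !slot_lie_cochain slot_ce !linearB /=.
rewrite !(funD, funN) IH; last exact: slot_linear_slot.
rewrite /slot /= lie_cochain_br // !(funD, funN) !opprB.
abel.
Qed.

Lemma ce_ce w : slot_linear w -> ce (ce w) = 0.
Proof.
move=> wl; apply/funext => s; elim: s w wl => [|X s IH] w wl //.
change (slot X (ce (ce w)) s = 0).
rewrite slot_ce slot_ce linearB /= ce_lie_cochain //.
rewrite !(funD, funN) opprB addrC subrK IH //.
exact: slot_linear_slot.
Qed.

End LieCochains.

(** * Cartan calculus of differential forms *)

Section CartanCalculus.
Context (R : realType) (m : nat) (M : smooth_manifold R m).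
Notation A := (Cinf M).
Notation V := (vfield M).
Notation F := (dform M).
Implicit Types (X Y Z : V) (a b : F) (s : seq V).

Lemma dform_eq a b : (forall s, a s = b s) -> a = b.
Proof. by move=> ab; apply/val_inj/funext. Qed.

Lemma dformD a b s : (a + b) s = a s + b s. Proof. by []. Qed.
Lemma dformN a s : (- a) s = - a s. Proof. by []. Qed.
Lemma dformZ (k : R) a s : (k *: a) s = k *: a s. Proof. by []. Qed.

HB.instance Definition _ X :=
  GRing.isLinear.Build R A A *:%R (vfield_val X) (vfield_linear X).

Lemma vfield_mulZ (k : R) X : vfield_mul (k *: (1 : A)) X = k *: X.
Proof.
apply: vfield_eq => f; change ((k *: (1 : A)) * X f = k *: X f).
by rewrite -Cinf_scaleAl mul1r.
Qed.

Lemma form_slot_linear a : slot_linear a.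
Proof.
move=> s t k X Y; rewrite -vfield_mulZ form_linear.
by rewrite -Cinf_scaleAl mul1r.
Qed.

Lemma contract_is_linear X : linear (@contract R m M X).
Proof. by move=> k a b; apply: dform_eq. Qed.
HB.instance Definition _ X :=
  GRing.isLinear.Build R F F *:%R (contract X) (@contract_is_linear X).

Let act X : {linear A -> A} := vfield_val X.
Let lie := lie_cochain (@lie_bracket R m M) act.
Let d := ce (@lie_bracket R m M) act.

(** With functions as coefficients the general cochain calculus specializes to
the Lie derivative and the exterior derivative, which yields the commutation
relations below. *)
Lemma Lie_cochainE X a : (Lie X a : seq V -> A) = lie X a.
Proof.
apply/funext => s; elim: s a => [|Y s IH] a.
  by rewrite /lie lie_cochainE /= /Lie_fun big_ord0.
have -> : Lie X a (Y :: s) = Lie X (contract Y a) s - a (lie_bracket X Y :: s).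
  exact: Lie_fun_cons.
rewrite IH; change (lie X (slot Y a) s - slot (lie_bracket X Y) a s =
  slot Y (lie X a) s).
by rewrite /lie slot_lie_cochain.
Qed.

Lemma extd_cochainE a : (extd a : seq V -> A) = d a.
Proof.
apply/funext => s; elim: s a => [|Y s IH] a; first exact: extd_fun0.
have -> : extd a (Y :: s) = Lie Y a s - extd (contract Y a) s.
  exact: extd_fun_cons.
by rewrite IH Lie_cochainE.
Qed.

Lemma Lie_is_linear X : linear (@Lie R m M X).
Proof.
move=> k a b; apply: dform_eq => s; rewrite dformD dformZ !Lie_cochainE.
exact: (congr1 (fun f => f s)
  (@lie_cochain_is_linear _ _ _ (@lie_bracket R m M) act X k a b)).
Qed.
HB.instance Definition _ X :=
  GRing.isLinear.Build R F F *:%R (Lie X) (@Lie_is_linear X).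

Lemma extd_is_linear : linear (@extd R m M).
Proof.
move=> k a b; apply: dform_eq => s; rewrite dformD dformZ !extd_cochainE.
exact: (congr1 (fun f => f s)
  (@ce_is_linear _ _ _ (@lie_bracket R m M) act k a b)).
Qed.
HB.instance Definition _ :=
  GRing.isLinear.Build R F F *:%R (@extd R m M) extd_is_linear.

Lemma lie_bracketJ X Y Z : lie_bracket (lie_bracket X Y) Z =
  lie_bracket X (lie_bracket Y Z) - lie_bracket Y (lie_bracket X Z).
Proof.
apply: vfield_eq => f; change ((X (Y (Z f)) - Y (X (Z f))) -
  Z (X (Y f) - Y (X f)) = (X (Y (Z f) - Z (Y f)) - (Y (Z (X f)) - Z (Y (X f)))) -
  (Y (X (Z f) - Z (X f)) - (X (Z (Y f)) - Z (X (Y f))))).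
rewrite !linearB /=; ring.
Qed.

Lemma extd_extd a : extd (extd a) = 0.
Proof.
apply: dform_eq => s; rewrite extd_cochainE extd_cochainE /d ce_ce //.
- exact: lie_bracketJ.
- exact: form_slot_linear.
Qed.

Lemma extd_Lie X a : extd (Lie X a) = Lie X (extd a).
Proof.
apply: dform_eq => s; rewrite extd_cochainE !Lie_cochainE extd_cochainE /d.
rewrite ce_lie_cochain //; first exact: lie_bracketJ.
exact: form_slot_linear.
Qed.

Lemma Lie_bracket X Y a : Lie (lie_bracket X Y) a = Lie X (Lie Y a) - Lie Y (Lie X a).
Proof.
apply: dform_eq => s; rewrite dformD dformN !Lie_cochainE.
rewrite /lie lie_cochain_br //; first exact: lie_bracketJ.
exact: form_slot_linear.
Qed.

Lemma Lie_contract X Y a :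
  Lie X (contract Y a) = contract Y (Lie X a) + contract (lie_bracket X Y) a.
Proof.
apply: dform_eq => s.
have E : Lie X a (Y :: s) = Lie X (contract Y a) s - a (lie_bracket X Y :: s).
  exact: Lie_fun_cons.
change (Lie X (contract Y a) s = Lie X a (Y :: s) + a (lie_bracket X Y :: s)).
by rewrite E subrK.
Qed.

Lemma Cartan X a : Lie X a = contract X (extd a) + extd (contract X a).
Proof.
by apply: dform_eq => s; rewrite dformD [X in X + _]extd_fun_cons subrK.
Qed.

Lemma contractC X Y a : contract X (contract Y a) = - contract Y (contract X a).
Proof. by apply: dform_eq => s; exact: (form_swap a [::]). Qed.

Lemma contractPl (k : R) X Y a :
  contract (k *: X + Y) a = k *: contract X a + contract Y a.
Proof. by apply: dform_eq => s; exact: (form_slot_linear a [::]). Qed.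

Lemma contract0l a : contract 0 a = 0.
Proof. by have := contractPl (-1) 0 0 a; rewrite scaler0 addr0 scaleN1r addNr. Qed.

(** The projection to the degrees less than [k], used to cut the de Rham complex
at [r - 1]. *)
Definition lower_fun (k : nat) (w : seq V -> A) s : A :=
  if (size s < k)%N then w s else 0.

Lemma lower_proof k a : lower_fun k a \in @alternating_multilinear R m M.
Proof.
apply/asboolP; split=> [s t f X Y|s t u X]; rewrite /lower_fun.
  rewrite !size_cat /=; case: ifP => _; first exact: form_linear.
  by rewrite mulr0 addr0.
by rewrite form_alt if_same.
Qed.
Definition lower k a : F := Dform (lower_proof k a).

Lemma lowerE k a s : lower k a s = if (size s < k)%N then a s else 0.
Proof. by []. Qed.

Lemma lower_is_linear k : linear (lower k).
Proof.
move=> c a b; apply: dform_eq => s; rewrite dformD dformZ !lowerE.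
by case: ifP; rewrite // scaler0 addr0.
Qed.
HB.instance Definition _ k :=
  GRing.isLinear.Build R F F *:%R (lower k) (@lower_is_linear k).

Lemma lower_contract k X a : lower k (contract X a) = contract X (lower k.+1 a).
Proof. by apply: dform_eq. Qed.

Lemma lower_Lie k X a : lower k (Lie X a) = Lie X (lower k a).
Proof.
apply: dform_eq => s; rewrite lowerE; elim: s a k => [|Y s IH] a k.
  have E b : Lie X b [::] = X (b [::]).
    by rewrite Lie_cochainE /lie lie_cochainE /= subr0.
  by rewrite !E lowerE; case: ifP; rewrite // linear0.
have E b : Lie X b (Y :: s) = Lie X (contract Y b) s - b (lie_bracket X Y :: s).
  exact: Lie_fun_cons.
rewrite !E lowerE ![size (_ :: _)]/=; case: k => [|k]; rewrite ?ltn0 ?ltnS.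
  rewrite subr0; have -> : contract Y (lower 0 a) = 0 by apply: dform_eq.
  by rewrite linear0.
by rewrite -lower_contract -IH; case: ifP; rewrite ?subrr.
Qed.

Lemma lower_extd k a : lower k.+1 (extd a) = extd (lower k a).
Proof.
apply: dform_eq => s; rewrite lowerE; elim: s a k => [|Y s IH] a k.
  by rewrite !extd_cochainE.
have E b : extd b (Y :: s) = Lie Y b s - extd (contract Y b) s.
  exact: extd_fun_cons.
rewrite !E -lower_Lie lowerE ![size (_ :: _)]/= ltnS; case: k => [|k].
  rewrite ltn0; have -> : contract Y (lower 0 a) = 0 by apply: dform_eq.
  by rewrite linear0 subr0.
by rewrite -lower_contract -IH; case: ifP; rewrite ?subrr.
Qed.

Lemma lower_lower k l a : lower k (lower l a) = lower (minn k l) a.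
Proof.
by apply: dform_eq => s; rewrite !lowerE ltn_min; case: ifP.
Qed.

Lemma lower_Omega k l a : Omega k a -> lower l a = if (k < l)%N then a else 0.
Proof.
move=> ak; apply: dform_eq => s; rewrite lowerE.
have [/eqP <-|sk] := boolP (size s == k); first by case: ifP.
by rewrite ak // if_same; case: ifP; rewrite ?ak.
Qed.

End CartanCalculus.

(** * Products of cochains with the contraction cochain *)

Section Pointwise.
Context (R : numFieldType) (T : Type) (N : lmodType R).
Implicit Types (w : seq T -> N) (X : T) (s : seq T) (g : {linear N -> N}).

Definition pw g w : seq T -> N := fun s => g (w s).

Lemma pw_is_linear g : linear (pw g).
Proof. by move=> a w w'; apply/funext => s; rewrite funD funZ /pw funD funZ linearP. Qed.
HB.instance Definition _ g := GRing.isLinear.Build R _ _ _ (pw g) (pw_is_linear g).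

Lemma pw_eps g w : pw g (eps w) = eps (pw g w).
Proof. by apply/funext => s; rewrite /pw /eps linearZ. Qed.

End Pointwise.

Section Insertions.
Context (R : numFieldType) (T : Type) (N : lmodType R).
Implicit Types (w : seq T -> N) (X : T) (s : seq T) (g : {linear N -> N})
  (op : T -> {linear N -> N}).

(** The product of [w] with the 1-cochain [op].  For [op] the contraction this is
the operator [iota_c] of contraction with the tautological vector field. *)
Fixpoint ins op w s : N :=
  if s is X :: s' then op X (w s') - ins op (slot X w) s' else 0.

Lemma slot_ins op X w : slot X (ins op w) = pw (op X) w - ins op (slot X w).
Proof. by []. Qed.

Lemma ins_is_linear op : linear (ins op).
Proof.
move=> a w w'; apply/funext => s; rewrite funD funZ.
elim: s w w' => [|X s IH] w w'; first by rewrite /= scaler0 addr0.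
change (op X (a *: w s + w' s) - ins op (a *: slot X w + slot X w') s =
  a *: (op X (w s) - ins op (slot X w) s) + (op X (w' s) - ins op (slot X w') s)).
by rewrite IH linearP scalerBr addrACA opprD.
Qed.
HB.instance Definition _ op :=
  GRing.isLinear.Build R _ _ _ (ins op) (@ins_is_linear op).

Lemma ins_eps op w : ins op (eps w) = - eps (ins op w).
Proof.
apply/funext => s; rewrite funN; elim: s w => [|X s IH] w.
  by rewrite /eps /= scaler0 oppr0.
change (pw (op X) (eps w) s - ins op (slot X (eps w)) s =
  - slot X (eps (ins op w)) s).
rewrite !slot_eps slot_ins linearN [eps (_ - _)]linearB /= !(funN, funB) IH.
rewrite -pw_eps; abel.
Qed.

(** An odd operation on the values passes the inserted argument with a sign, so
that the anticommutator with [op] is inserted instead. *)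
Lemma ins_anticomm g op op' w :
  (forall X x, g (op X x) + op X (g x) = op' X x) ->
  pw g (ins op w) + ins op (pw g w) = ins op' w.
Proof.
move=> E; apply/funext => s; rewrite funD.
elim: s w => [|X s IH] w; first by rewrite /pw /= linear0 addr0.
rewrite /= -E -(IH (slot X w)) /pw /= linearB; abel.
Qed.

Lemma ins_comm g op op' w :
  (forall X x, g (op X x) - op X (g x) = op' X x) ->
  pw g (ins op w) - ins op (pw g w) = ins op' w.
Proof.
move=> E; apply/funext => s; rewrite funB.
elim: s w => [|X s IH] w; first by rewrite /pw /= linear0 subr0.
rewrite /= -E -(IH (slot X w)) /pw /= linearB; abel.
Qed.

Lemma ins0 op w : (forall X x, op X x = 0) -> ins op w = 0.
Proof.
move=> E; apply/funext => s; elim: s w => [|X s IH] w //=.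
by rewrite E IH subrr.
Qed.

Lemma ins_insC op op' w :
  (forall X Y x, op X (op' Y x) = - op' Y (op X x)) ->
  ins op (ins op' w) = ins op' (ins op w).
Proof.
move=> E; apply/funext => s; elim: s w => [|X s IH] w //.
change ((pw (op X) (ins op' w) - ins op (pw (op' X) w - ins op' (slot X w))) s =
  (pw (op' X) (ins op w) - ins op' (pw (op X) w - ins op (slot X w))) s).
pose z (_ : T) : {linear N -> N} := \0.
have z0 w' : ins z w' = 0 by exact: ins0.
have Ew := @ins_anticomm (op X) op' z w; have Ew' := @ins_anticomm (op' X) op z w.
rewrite z0 in Ew; rewrite z0 in Ew'.
rewrite !linearB /= -(addr0_eq (Ew _)) => [|Y x]; last by rewrite E addNr.
rewrite -(addr0_eq (Ew' _)) => [|Y x]; last by rewrite E subrr.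
rewrite !(funD, funN) IH; abel.
Qed.

End Insertions.

Section BracketInsertions.
Context (R : numFieldType) (E N : lmodType R).
Variables (br : E -> E -> E).
Implicit Types (w : seq E -> N) (X Y Z : E) (s : seq E) (g : {linear N -> N})
  (op : E -> {linear N -> N}).

(** The product of [w] with the 2-cochain [fun X Y => op (br X Y)]. *)
Fixpoint bins op w s : N :=
  if s is X :: s' then ins (fun Y => op (br X Y)) w s' + bins op (slot X w) s' else 0.

Lemma bins_is_linear op : linear (bins op).
Proof.
move=> a w w'; apply/funext => s; rewrite funD funZ.
elim: s w w' => [|X s IH] w w'; first by rewrite /= scaler0 addr0.
change (ins (fun Y => op (br X Y)) (a *: w + w') s + bins op (a *: slot X w + slot X w') s =
  a *: (ins (fun Y => op (br X Y)) w s + bins op (slot X w) s) +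
  (ins (fun Y => op (br X Y)) w' s + bins op (slot X w') s)).
by rewrite IH ins_is_linear !(funD, funZ) scalerDr addrACA.
Qed.
HB.instance Definition _ op :=
  GRing.isLinear.Build R _ _ _ (bins op) (@bins_is_linear op).

Lemma bins_anticomm g op w : (forall X x, g (op X x) = - op X (g x)) ->
  pw g (bins op w) = - bins op (pw g w).
Proof.
move=> Eg; apply/funext => s; rewrite funN.
elim: s w => [|X s IH] w; first by rewrite /pw /= linear0 oppr0.
change (g (ins (fun Y => op (br X Y)) w s + bins op (slot X w) s) =
  - (ins (fun Y => op (br X Y)) (pw g w) s + bins op (pw g (slot X w)) s)).
rewrite linearD opprD -IH; congr (_ + _).
pose z (_ : E) : {linear N -> N} := \0.
have := @ins_anticomm _ _ _ g (fun Y => op (br X Y)) z w.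
rewrite [ins z w]ins0 // => /(_ _)/addr0_eq Ew.
by rewrite -Ew ?funN ?opprK // => Y x; rewrite Eg addNr.
Qed.

Lemma bins_ins op w : (forall X Y x, op X (op Y x) = - op Y (op X x)) ->
  bins op (ins op w) = - ins op (bins op w).
Proof.
move=> opC; apply/funext => s; rewrite funN.
elim: s w => [|X s IH] w; first by rewrite /= oppr0.
change (ins (fun Y => op (br X Y)) (ins op w) s +
   bins op (pw (op X) w - ins op (slot X w)) s =
  - (pw (op X) (bins op w) s -
   ins op (ins (fun Y => op (br X Y)) w + bins op (slot X w)) s)).
rewrite ins_insC // linearB [ins op (_ + _)]linearD /= !(funD, funN) bins_anticomm // funN IH.
abel.
Qed.

Lemma theta_pw g X w : theta br X (pw g w) = pw g (theta br X w).
Proof.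
apply/funext => s; elim: s w => [|Z s IH] w; first by rewrite /pw /= linear0.
change (pw g (slot (br X Z) w) s + theta br X (pw g (slot Z w)) s =
  g (slot (br X Z) w s + theta br X (slot Z w) s)).
by rewrite IH linearD.
Qed.

(** The insertion is natural except for the inserted argument itself, which is
the only place where [br X] acts on [op]. *)
Lemma theta_ins op X w : theta br X (ins op w) =
  ins op (theta br X w) + ins (fun Y => op (br X Y)) w.
Proof.
apply/funext => s; elim: s w => [|Y s IH] w; first by rewrite funD /= addr0.
change (op (br X Y) (w s) - ins op (slot (br X Y) w) s +
   theta br X (pw (op Y) w - ins op (slot Y w)) s =
  op Y (theta br X w s) - ins op (slot (br X Y) w + theta br X (slot Y w)) s +
   (op (br X Y) (w s) - ins (fun Y => op (br X Y)) (slot Y w) s)).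
rewrite linearB linearD /= !(funD, funN) IH theta_pw funD /pw; abel.
Qed.

(** The part of [ce] without the action on the values, isolated because its
commutator with [ins op] does not involve this action. *)
Fixpoint delta w s : N :=
  if s is X :: s' then - theta br X w s' - delta (slot X w) s' else 0.

Lemma delta_is_linear : linear delta.
Proof.
move=> a w w'; apply/funext => s; rewrite funD funZ.
elim: s w w' => [|X s IH] w w'; first by rewrite /= scaler0 addr0.
change (- theta br X (a *: w + w') s - delta (a *: slot X w + slot X w') s =
  a *: (- theta br X w s - delta (slot X w) s) +
  (- theta br X w' s - delta (slot X w') s)).
rewrite IH theta_is_linear !(funD, funZ) scalerBr scalerN; abel.
Qed.
HB.instance Definition _ := GRing.isLinear.Build R _ _ _ delta delta_is_linear.

Lemma delta_pw g w : delta (pw g w) = pw g (delta w).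
Proof.
apply/funext => s; elim: s w => [|Z s IH] w; first by rewrite /pw /= linear0.
change (- theta br Z (pw g w) s - delta (pw g (slot Z w)) s =
  g (- theta br Z w s - delta (slot Z w) s)).
by rewrite IH theta_pw linearB linearN.
Qed.

Lemma delta_ins op w : delta (ins op w) = - ins op (delta w) - bins op w.
Proof.
apply/funext => s; elim: s w => [|X s IH] w; first by rewrite funB funN /= oppr0 addr0.
change ((- theta br X (ins op w) - delta (pw (op X) w - ins op (slot X w))) s =
  (- (pw (op X) (delta w) - ins op (- theta br X w - delta (slot X w))) -
   (ins (fun Y => op (br X Y)) w + bins op (slot X w))) s).
rewrite [delta (_ - _)]linearB [ins op (_ - _)]linearB /= [ins op (- _)]linearN /=.
rewrite delta_pw theta_ins !(funD, funN) IH !(funD, funN).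
abel.
Qed.

Lemma ce_ins_delta (act : E -> {linear N -> N}) w :
  ce br act w = ins act w + delta w.
Proof.
apply/funext => s; elim: s w => [|X s IH] w; first by rewrite funD /= addr0.
change (lie_cochain br act X w s - ce br act (slot X w) s =
  (act X (w s) - ins act (slot X w) s) + (- theta br X w s - delta (slot X w) s)).
rewrite lie_cochainE IH funD; abel.
Qed.

Lemma ce_pw (act : E -> {linear N -> N}) g w :
  (forall X x, act X (g x) = g (act X x)) ->
  ce br act (pw g w) = pw g (ce br act w).
Proof.
move=> gact; rewrite !ce_ins_delta linearD /= delta_pw; congr (_ + _).
apply/esym/eqP; rewrite -subr_eq0; apply/eqP.
pose z (_ : E) : {linear N -> N} := \0.
by rewrite (@ins_comm _ _ _ g act z) ?ins0 // => X x; rewrite gact subrr.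
Qed.

End BracketInsertions.

(** * Signed sums over shuffles *)

Section Shuffles.
Context (R : numFieldType) (T : Type).
Implicit Types (N : lmodType R) (X : T) (s a b c : seq T).

(** The sum over all ways to split the list into two sublists, with the sign of
the shuffle.  The recursion puts the first entry either in the first sublist,
or in the second one, where it has to pass the whole first sublist. *)
Fixpoint shuffle_sum N (Psi : seq T -> seq T -> N) s : N :=
  if s is X :: s' then
    shuffle_sum (fun a b => Psi (X :: a) b) s' +
    shuffle_sum (fun a b => (-1) ^+ size a *: Psi a (X :: b)) s'
  else Psi [::] [::].

Lemma eq_shuffle_sum N (Psi Psi' : seq T -> seq T -> N) s :
  (forall a b, (size a + size b)%N = size s -> Psi a b = Psi' a b) ->
  shuffle_sum Psi s = shuffle_sum Psi' s.
Proof.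
elim: s Psi Psi' => [|X s IH] Psi Psi' E /=; first exact: E.
congr (_ + _); apply: IH => a b ab; first by apply: E; rewrite /= addSn ab.
by rewrite E //= addnS ab.
Qed.

Lemma shuffle_sum_linear N N' (g : {linear N -> N'}) Psi s :
  shuffle_sum (fun a b => g (Psi a b)) s = g (shuffle_sum Psi s).
Proof.
elim: s Psi => [|X s IH] Psi //=.
rewrite linearD -!IH; congr (_ + _); apply: eq_shuffle_sum => a b _.
by rewrite linearZ.
Qed.

Lemma shuffle_sumZ N (k : R) (Psi : seq T -> seq T -> N) s :
  shuffle_sum (fun a b => k *: Psi a b) s = k *: shuffle_sum Psi s.
Proof. exact: (shuffle_sum_linear ( *:%R k)). Qed.

Lemma shuffle_sumD N (Psi Psi' : seq T -> seq T -> N) s :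
  shuffle_sum (fun a b => Psi a b + Psi' a b) s = shuffle_sum Psi s + shuffle_sum Psi' s.
Proof.
elim: s Psi Psi' => [|X s IH] Psi Psi' //=.
rewrite IH addrACA; congr (_ + _); rewrite -IH; apply: eq_shuffle_sum => a b _.
by rewrite scalerDr.
Qed.

Lemma shuffle_sum0 N s : shuffle_sum (fun _ _ => 0 : N) s = 0.
Proof.
rewrite -[RHS](scale0r (shuffle_sum (fun _ _ => 0 : N) s)) -shuffle_sumZ.
by apply: eq_shuffle_sum => a b _; rewrite scale0r.
Qed.

Lemma shuffle_sumN N (Psi : seq T -> seq T -> N) s :
  shuffle_sum (fun a b => - Psi a b) s = - shuffle_sum Psi s.
Proof. exact: (shuffle_sum_linear (-%R)). Qed.

Lemma shuffle_sum_sum N n (Psi : nat -> seq T -> seq T -> N) s :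
  shuffle_sum (fun a b => \sum_(k < n) Psi k a b) s = \sum_(k < n) shuffle_sum (Psi k) s.
Proof.
elim: n => [|n IH].
  by rewrite big_ord0 -[RHS](shuffle_sum0 N s); apply: eq_shuffle_sum => a b _; rewrite big_ord0.
rewrite big_ord_recr /= -IH -shuffle_sumD; apply: eq_shuffle_sum => a b _.
by rewrite big_ord_recr.
Qed.

Lemma shuffle_sum_nil_l N (g : seq T -> N) s :
  shuffle_sum (fun a b => if a is [::] then g b else 0) s = g s.
Proof.
elim: s g => [|X s IH] g //=; rewrite shuffle_sum0 add0r.
rewrite -(IH (fun b => g (X :: b))); apply: eq_shuffle_sum => -[|Y a] b _.
  by rewrite expr0 scale1r.
by rewrite scaler0.
Qed.

(** Both sides sum over the splittings into three sublists; the first entry has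
three places to go and gets the same sign on both sides. *)
Lemma shuffle_sumA N (Psi : seq T -> seq T -> seq T -> N) s :
  shuffle_sum (fun a c => shuffle_sum (fun a1 a2 => Psi a1 a2 c) a) s =
  shuffle_sum (fun a1 b => shuffle_sum (fun a2 c => Psi a1 a2 c) b) s.
Proof.
elim: s Psi => [|X s IH] Psi //=.
rewrite shuffle_sumD -addrA; congr (_ + _).
  exact: (IH (fun a1 a2 c => Psi (X :: a1) a2 c)).
rewrite (IH (fun a1 a2 c => (-1) ^+ size a1 *: Psi a1 (X :: a2) c)).
rewrite (@eq_shuffle_sum _ (fun a c => (-1) ^+ size a *: _)
  (fun a c => shuffle_sum (fun a1 a2 => (-1) ^+ (size a1 + size a2) *: Psi a1 a2 (X :: c)) a));
  last first.
  move=> a c _; rewrite -shuffle_sumZ; apply: eq_shuffle_sum => a1 a2 <-.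
  by [].
rewrite (IH (fun a1 a2 c => (-1) ^+ (size a1 + size a2) *: Psi a1 a2 (X :: c))).
rewrite -shuffle_sumD; apply: eq_shuffle_sum => a b _.
rewrite scalerDr -!shuffle_sumZ; congr (_ + _).
by apply: eq_shuffle_sum => a2 c _; rewrite exprD scalerA.
Qed.

Lemma shuffle_sumC N (Psi : seq T -> seq T -> N) s :
  shuffle_sum (fun a b => (-1) ^+ (size a * size b) *: Psi b a) s = shuffle_sum Psi s.
Proof.
elim: s Psi => [|X s IH] Psi /=; first by rewrite expr0 scale1r.
rewrite addrC; congr (_ + _).
  rewrite -[RHS]IH; apply: eq_shuffle_sum => a b _.
  rewrite scalerA mulnS exprD mulrA -exprMn mulrNN mulr1 expr1n mul1r.
  by rewrite mulnC.
rewrite -[RHS]IH; apply: eq_shuffle_sum => a b _.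
by rewrite scalerA -exprD mulSn addnC.
Qed.

End Shuffles.

Section CochainLinear.
Context (R : numFieldType) (T : Type) (N : lmodType R).
Implicit Types (w : seq T -> N) (X : T) (s a b : seq T).
Local Notation cst := (@cst_cochain R T N).
Local Notation operator := {linear (seq T -> N) -> (seq T -> N)}.
Implicit Types (D : operator) (q : nat).

(** Linearity over scalar cochains, up to the parity [q]: the operator is
determined by its values on constant cochains.  This turns the composition of
two brackets, a sum over shuffles, into a composition of operators. *)
Definition cochain_linear q (D : (seq T -> N) -> (seq T -> N)) :=
  forall w s, D w s = shuffle_sum (fun b a => (-1) ^+ (q * size a) *: D (cst (w a)) b) s.

(** An evaluation as a linear map, for moving it across [shuffle_sum]. *)
Definition at_cst D b (x : N) : N := D (cst x) b.

Lemma at_cst_is_linear D b : linear (at_cst D b).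
Proof. by move=> k x y; rewrite /at_cst !linearP. Qed.
HB.instance Definition _ D b :=
  GRing.isLinear.Build R N N *:%R (at_cst D b) (@at_cst_is_linear D b).

(** Coassociativity of the splittings. *)
Lemma cochain_linear_comp q q' D (D' : (seq T -> N) -> (seq T -> N)) :
  cochain_linear q D -> cochain_linear q' D' ->
  cochain_linear (q + q') (fun w => D (D' w)).
Proof.
move=> Dl D'l w s; rewrite Dl.
rewrite (@eq_shuffle_sum _ _ _ _ (fun b a => shuffle_sum (fun b' a' =>
    (-1) ^+ ((q + q') * size a' + q * size b') *:
    D (cst (D' (cst (w a')) b')) b) a)); last first.
  move=> b a _; rewrite D'l -/(at_cst D b _) -shuffle_sum_linear -shuffle_sumZ.
  apply: eq_shuffle_sum => b' a' ab; rewrite linearZ scalerA -exprD -ab mulnDr mulnDl.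
  by rewrite -addnA addnC.
rewrite -shuffle_sumA; apply: eq_shuffle_sum => b a _.
rewrite Dl -shuffle_sumZ; apply: eq_shuffle_sum => b1 b2 _.
by rewrite scalerA -exprD.
Qed.

Lemma cochain_linearD q (D D' : (seq T -> N) -> (seq T -> N)) :
  cochain_linear q D -> cochain_linear q D' ->
  cochain_linear q (fun w => D w + D' w).
Proof.
move=> Dl D'l w s; rewrite funD Dl D'l -shuffle_sumD; apply: eq_shuffle_sum => b a _.
by rewrite -scalerDr.
Qed.

Lemma cochain_linearZ q (k : R) (D : (seq T -> N) -> (seq T -> N)) : cochain_linear q D ->
  cochain_linear q (fun w => k *: D w).
Proof.
move=> Dl w s; rewrite funZ Dl -shuffle_sumZ; apply: eq_shuffle_sum => b a _.
by rewrite !scalerA mulrC.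
Qed.

Lemma cochain_linear_pw (g : {linear N -> N}) : cochain_linear 0 (pw g).
Proof.
move=> w s; rewrite /pw -(shuffle_sum_nil_l (fun a => g (w a))); apply: eq_shuffle_sum => b a _.
by rewrite mul0n scale1r; case: b => //= X b; rewrite linear0.
Qed.

Lemma cochain_linear_eps q (D : (seq T -> N) -> (seq T -> N)) : cochain_linear q D ->
  cochain_linear q.+1 (fun w => eps (D w)).
Proof.
move=> Dl w s; rewrite /eps Dl -shuffle_sumZ; apply: eq_shuffle_sum => b a <-.
rewrite !scalerA -!exprD; congr ((-1) ^+ _ *: _).
by rewrite mulSn [RHS]addnC addnA.
Qed.

Lemma ins_cst (op : T -> {linear N -> N}) x b :
  ins op (cst x) b = if b is [:: Y] then op Y x else 0.
Proof.
case: b => [|Y b] //=.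
have -> : slot Y (cst x) = 0 by [].
rewrite linear0 subr0; case: b => //= *; exact: linear0.
Qed.

Lemma cochain_linear_ins (op : T -> {linear N -> N}) : cochain_linear 0 (ins op).
Proof.
move=> w s; elim: s w => [|X s IH] w; first by rewrite /= scaler0.
change (op X (w s) - ins op (slot X w) s =
  shuffle_sum (fun b a => (-1) ^+ (0 * size a) *: ins op (cst (w a)) (X :: b)) s +
  shuffle_sum (fun b a => (-1) ^+ size b *: ((-1) ^+ (0 * size (X :: a)) *:
    ins op (cst (w (X :: a))) b)) s).
rewrite IH -shuffle_sumN -(shuffle_sum_nil_l (fun a => op X (w a))).
congr (_ + _); apply: eq_shuffle_sum => b a _; rewrite !mul0n !scale1r !ins_cst.
  by case: b.
by case: b => [|Y [|Z b]]; rewrite ?scaler0 ?oppr0 //= scaleN1r.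
Qed.

End CochainLinear.

Section BracketShuffles.
Context (R : numFieldType) (E N : lmodType R) (br : E -> E -> E).
Implicit Types (w : seq E -> N) (X : E) (s a b : seq E).
Local Notation cst := (@cst_cochain R E N).

Lemma bins_cst (op : E -> {linear N -> N}) x b :
  bins br op (cst x) b = if b is [:: Y; Z] then op (br Y Z) x else 0.
Proof.
case: b => [|Y b] //=.
have -> : slot Y (cst x) = 0 by [].
by rewrite linear0 addr0 ins_cst; case: b => [|Z [|? ?]].
Qed.

Lemma cochain_linear_bins (op : E -> {linear N -> N}) :
  cochain_linear 0 (bins br op).
Proof.
move=> w s; elim: s w => [|X s IH] w; first by rewrite /= scaler0.
change (ins (fun Y => op (br X Y)) w s + bins br op (slot X w) s =
  shuffle_sum (fun b a => (-1) ^+ (0 * size a) *: bins br op (cst (w a)) (X :: b)) s +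
  shuffle_sum (fun b a => (-1) ^+ size b *: ((-1) ^+ (0 * size (X :: a)) *:
    bins br op (cst (w (X :: a))) b)) s).
rewrite IH cochain_linear_ins; congr (_ + _); apply: eq_shuffle_sum => b a _.
  by rewrite ins_cst bins_cst; case: b => [|? []].
rewrite !mul0n !scale1r !bins_cst; case: b => [|Y [|Z [|? b]]]; rewrite ?scaler0 //=.
by rewrite expr2 mulrNN mulr1 scale1r.
Qed.

Definition swaps w := forall s t X Y, w (s ++ X :: Y :: t) = - w (s ++ Y :: X :: t).

(** Alternation moves the bracket from its place to the front. *)
Lemma theta_shuffle_sum w X s : swaps w ->
  theta br X w s =
  shuffle_sum (fun a b => if a is [:: Y] then w (br X Y :: b) else 0) s.
Proof.
elim: s w => [|Y s IH] w wa //=.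
rewrite IH; last by move=> s' t' Z Z'; exact: (wa (Y :: s')).
congr (_ + _).
  rewrite -(shuffle_sum_nil_l (fun b => w (br X Y :: b))); apply: eq_shuffle_sum => a b _.
  by case: a.
apply: eq_shuffle_sum => a b _; case: a => [|Z [|? ?]]; rewrite ?scaler0 //=.
by rewrite scaleN1r; exact: (wa [::]).
Qed.

(** The terms of the Jacobi identity in which the inner bracket is the Lie
bracket of two entries. *)
Lemma delta_shuffle_sum w s : swaps w ->
  eps (delta br w) s =
  shuffle_sum (fun a b => if a is [:: Y; Z] then (-1) ^+ (size b).+1 *: w (br Y Z :: b) else 0) s.
Proof.
elim: s w => [|X s IH] w wa; first by rewrite /eps /= scaler0.
have wXa : swaps (slot X w) by move=> s' t' Z Z'; exact: (wa (X :: s')).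
change (slot X (eps (delta br w)) s = slot X (shuffle_sum (fun a b => if a is [:: Y; Z]
   then (-1) ^+ (size b).+1 *: w (br Y Z :: b) else 0)) s).
rewrite slot_eps funN; change (- ((-1) ^+ size s *: (- theta br X w s -
  delta br (slot X w) s)) = slot X (shuffle_sum (fun a b => if a is [:: Y; Z]
   then (-1) ^+ (size b).+1 *: w (br Y Z :: b) else 0)) s).
rewrite scalerBr opprD opprK -/(eps (delta br (slot X w)) s) IH // /slot /=.
rewrite scalerN opprK theta_shuffle_sum // -shuffle_sumZ; congr (_ + _).
  apply: eq_shuffle_sum => a b ab; case: a ab => [|Y [|? ?]] ab; rewrite ?scaler0 //=.
  by rewrite -ab.
apply: eq_shuffle_sum => a b _; case: a => [|Y [|Z [|? ?]]]; rewrite ?scaler0 //=.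
rewrite expr2 mulrNN mulr1 scale1r (wa [::]) /= scalerN [in RHS]exprS mulN1r.
by rewrite scaleNr.
Qed.

End BracketShuffles.

(** * Bernoulli numbers as coefficients of a power series *)

Section Convolution.
Context (R : numFieldType).
Implicit Types (a b c : nat -> R) (n k : nat).

Definition conv a b n : R := \sum_(k < n.+1) a k * b (n - k)%N.

Definition one_series n : R := (n == 0%N)%:R.
Definition shift a n : R := a n.+1.
Definition derivs a n : R := n.+1%:R * a n.+1.

(** Convolution is the product of truncated polynomials, from which it inherits
associativity and commutativity. *)
Lemma conv_poly N a b n : (n <= N)%N ->
  conv a b n = ((\poly_(i < N.+1) a i) * (\poly_(i < N.+1) b i))`_n.
Proof.
move=> nN; rewrite coefM; apply: eq_bigr => k _.
rewrite !coef_poly !ltnS (leq_trans (leq_subr k n) nN).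
by rewrite (leq_trans _ nN) // -ltnS.
Qed.

Lemma convA a b c : conv (conv a b) c = conv a (conv b c).
Proof.
apply/funext => n; pose P u := \poly_(i < n.+1) (u i : R).
transitivity ((P a * P b * P c)`_n).
  rewrite coefM; apply: eq_bigr => k _; rewrite (@conv_poly n); last by rewrite -ltnS.
  by rewrite /P coef_poly ltnS leq_subr.
rewrite -mulrA coefM; apply: eq_bigr => k _.
by rewrite (@conv_poly n (b)) ?leq_subr // /P coef_poly ltn_ord.
Qed.

Lemma convC a b : conv a b = conv b a.
Proof. by apply/funext => n; rewrite !(@conv_poly n) // mulrC. Qed.

Lemma convDr a b c n : conv a (fun n => b n + c n) n = conv a b n + conv a c n.
Proof. by rewrite /conv -big_split /=; apply: eq_bigr => k _; rewrite mulrDr. Qed.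

Lemma conv1 a : conv one_series a = a.
Proof.
apply/funext => n; rewrite /conv big_ord_recl /one_series eqxx mul1r subn0.
by rewrite big1 ?addr0 // => k _; rewrite mul0r.
Qed.

Lemma conv_shift a b n : conv a (shift b) n = conv a b n.+1 - a n.+1 * b 0%N.
Proof.
rewrite /conv [X in _ = X - _]big_ord_recr /= subnn addrK.
by apply: eq_bigr => k _; rewrite /shift subSn // -ltnS.
Qed.

(** [(1 - e^-t) / t] *)
Definition fser k : R := (-1) ^+ k / (k.+1)`!%:R.

(** The generating series [t / (1 - e^-t)], the inverse of [fser]; the sign
[(-1) ^+ k] only matters for [k = 1]. *)
Definition bser k : R := (-1) ^+ k * bernoulli R k / k`!%:R.

Definition expNser k : R := (-1) ^+ k / k`!%:R.

Lemma factS_neq0 n : (n`!%:R : R) != 0.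
Proof. by rewrite pnatr_eq0 -lt0n fact_gt0. Qed.

(** The recurrence of the Bernoulli numbers, divided by a factorial. *)
Lemma bernoulli_inverse n :
  conv (fun k => (k.+1)`!%:R^-1) (fun k => bernoulli R k / k`!%:R) n = one_series n.
Proof.
rewrite convC /conv; apply: (mulfI (factS_neq0 n.+1)).
rewrite mulr_sumr; transitivity ((n == 0%N)%:R : R); last first.
  by rewrite /one_series; case: n => [|n]; rewrite ?mulr1 ?mulr0.
rewrite -bernoulliE; apply: eq_bigr => k _.
have kn : (k <= n)%N by rewrite -ltnS.
have : 'C(n.+1, k)%:R * (k`!%:R * (n.+1 - k)`!%:R) = n.+1`!%:R :> R.
  by rewrite -!natrM bin_fact // leqW.
rewrite subSn // => <-.
move: (factS_neq0 k) (factS_neq0 (n - k).+1).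
move: (k`!%:R) ((n - k).+1`!%:R) => x y x0 y0.
by field; rewrite ?x0 ?y0.
Qed.

Lemma conv_fser_bser : conv fser bser = one_series.
Proof.
apply/funext => n.
have -> : conv fser bser n = (-1) ^+ n *
    conv (fun k => (k.+1)`!%:R^-1) (fun k => bernoulli R k / k`!%:R) n.
  rewrite /conv mulr_sumr; apply: eq_bigr => k _; rewrite /fser /bser.
  have -> : (-1) ^+ n = (-1) ^+ k * (-1) ^+ (n - k) :> R.
    by rewrite -exprD subnKC // -ltnS.
  move: (factS_neq0 (n - k)) (factS_neq0 k.+1).
  move: ((n - k)`!%:R) (k.+1`!%:R) => x y x0 y0.
  by field; rewrite ?x0 ?y0.
rewrite bernoulli_inverse /one_series.
by case: n => [|n]; rewrite ?mulr1 ?mulr0 ?expr0.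
Qed.

Lemma fserS n : n.+2%:R * fser n.+1 = - fser n.
Proof.
rewrite /fser exprS [n.+2`!]factS [X in _ / X]natrM.
have : n.+2%:R != 0 :> R by rewrite pnatr_eq0.
move: (factS_neq0 n.+1); move: (n.+1`!%:R) (n.+2%:R) => x y x0 y0.
by field; rewrite ?x0 ?y0.
Qed.

(** [e^-t (e^t - 1)/t = (1 - e^-t)/t] *)
Lemma conv_expNser :
  conv expNser (fun k => (k.+1)`!%:R^-1) = fser.
Proof.
apply/funext => n; rewrite /conv /fser /expNser.
apply: (mulfI (factS_neq0 n.+1)).
rewrite mulr_sumr mulrCA mulfV ?factS_neq0 // mulr1.
have : \sum_(k < n.+2) 'C(n.+1, k)%:R * (-1) ^+ k = 0 :> R.
  transitivity ((1 - 1 : R) ^+ n.+1); last by rewrite subrr expr0n.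
  rewrite exprBn; apply: eq_bigr => k _.
  by rewrite !expr1n !mulr1 mulr_natl.
rewrite big_ord_recr /= binn mul1r => /eqP.
rewrite addr_eq0 exprS mulN1r opprK => /eqP <-.
apply: eq_bigr => k _; have kn : (k <= n)%N by rewrite -ltnS.
have : 'C(n.+1, k)%:R * (k`!%:R * (n.+1 - k)`!%:R) = n.+1`!%:R :> R.
  by rewrite -!natrM bin_fact // leqW.
rewrite subSn // => <-.
move: (factS_neq0 k) (factS_neq0 (n - k).+1).
move: (k`!%:R) ((n - k).+1`!%:R) => x y x0 y0.
by field; rewrite ?x0 ?y0.
Qed.

(** The series [t/(e^t - 1) + t] and [t/(1 - e^-t)] are both inverse to [fser], so
they coincide; comparing coefficients gives [B_n = (-1)^n B_n] for [n > 1]. *)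
Lemma bernoulli_odd n : odd n -> (1 < n)%N -> bernoulli R n = 0.
Proof.
pose bb k := bernoulli R k / k`!%:R + (k == 1%N)%:R.
have fbb : conv fser bb = one_series.
  apply/funext => n'; rewrite /bb convDr.
  have -> : conv fser (fun k => (k == 1%N)%:R) n' = if n' is k.+1 then fser k else 0.
    case: n' => [|n']; first by rewrite /conv big_ord_recl big_ord0 mulr0 addr0.
    rewrite convC /conv big_ord_recl mul0r add0r big_ord_recl /= mul1r.
    by rewrite subSS subn0 big1 ?addr0 // => k _; rewrite mul0r.
  rewrite -conv_expNser convA.
  have -> : conv (fun k => (k.+1)`!%:R^-1) (fun k => bernoulli R k / k`!%:R)
     = one_series by apply/funext => k; exact: bernoulli_inverse.
  rewrite convC conv1 conv_expNser /one_series.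
  case: n' => [|n']; first by rewrite /expNser fact0 expr0 divr1 addr0.
  by rewrite /expNser /fser exprS mulN1r mulNr addNr.
have bbE : bb = bser.
  by rewrite -(conv1 bb) -conv_fser_bser (convC fser) convA fbb convC conv1.
move=> odd_n n_gt1; have := congr1 (@^~ n) bbE.
rewrite /bb /bser gtn_eqF // addr0 -signr_odd odd_n expr1 mulN1r mulNr => /eqP.
rewrite -subr_eq0 opprK -mulr2n mulrn_eq0 /= mulf_eq0 invr_eq0.
by rewrite (negbTE (factS_neq0 n)) orbF => /eqP.
Qed.

End Convolution.

(** * Power series in a locally nilpotent operator *)

Section Locality.
Context (R : numFieldType) (E N : lmodType R) (br : E -> E -> E).
Implicit Types (w : seq E -> N) (s u : seq E) (D : (seq E -> N) -> seq E -> N).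

(** The value at a list depends only on the values at lists which are not longer.
This is what makes a power series in an operator that lengthens lists behave
like a polynomial at each list. *)
Definition local D := forall w w' s,
  (forall u, (size u <= size s)%N -> w u = w' u) -> D w s = D w' s.

Lemma local_comp D D' : local D -> local D' -> local (fun w => D (D' w)).
Proof.
move=> DL D'L w w' s E1; apply: DL => u us; apply: D'L => v vu.
by apply: E1; exact: leq_trans us.
Qed.

Lemma local_pw g : local (@pw R E N g).
Proof. by move=> w w' s E1; rewrite /pw E1. Qed.

Lemma local_eps : local (@eps R E N).
Proof. by move=> w w' s E1; rewrite /eps E1. Qed.

Lemma ins_eq_shorter op w w' s :
  (forall u, (size u < size s)%N -> w u = w' u) ->
  @ins R E N op w s = ins op w' s.
Proof.
elim: s w w' => //= X s IH w w' E1; rewrite E1 // (IH _ (slot X w')) // => u us.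
exact: E1.
Qed.

Lemma local_ins op : local (@ins R E N op).
Proof. by move=> w w' s E1; apply: ins_eq_shorter => u /ltnW; exact: E1. Qed.

Lemma local_delta : local (@delta R E N br).
Proof.
have lth X : local (@theta R E N br X).
  move=> w w' s; elim: s w w' => //= Y s IH w w' E1.
  by rewrite E1 // (IH _ (slot Y w')) // => u us; exact: E1.
move=> w w' s; elim: s w w' => //= X s IH w w' E1.
rewrite (@lth X w w') => [|u us]; last by rewrite E1 // leqW.
by rewrite (IH _ (slot X w')) // => u us; exact: E1.
Qed.

End Locality.

Section Series.
Context (R : numFieldType) (E N : lmodType R).
Variable op : E -> {linear N -> N}.
Implicit Types (w : seq E -> N) (s u : seq E) (a b : nat -> R) (n k : nat)
  (D K : {linear (seq E -> N) -> (seq E -> N)}).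
Local Notation i := (@ins R E N op).

(** Each insertion consumes one argument, which makes [ins op] locally nilpotent. *)
Lemma iter_ins_short k w s : (size s < k)%N -> iter k i w s = 0.
Proof.
elim: k s => // k IH s sk; rewrite iterS (@ins_eq_shorter _ _ _ _ _ 0).
  by rewrite linear0.
by move=> u us; rewrite IH // (leq_trans us).
Qed.

(** [sum_k a_k (ins op)^k], a finite sum at each list by [iter_ins_short]. *)
Definition ser a w s : N := \sum_(k < (size s).+1) a k *: iter k i w s.

Lemma serE n a w s : (size s < n)%N -> ser a w s = \sum_(k < n) a k *: iter k i w s.
Proof.
move=> sn; rewrite /ser -(subnKC sn) big_split_ord -[LHS]addr0; congr (_ + _).
by apply/esym/big1 => k _; rewrite iter_ins_short ?scaler0 // leq_addr.
Qed.

Lemma fun_sum n (F : nat -> seq E -> N) s :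
  (\sum_(k < n) F k) s = \sum_(k < n) F k s.
Proof. by elim: n => [|n IH]; rewrite ?big_ord0 // !big_ord_recr /= funD IH. Qed.

Lemma iter_ins_is_linear k : linear (iter k i).
Proof.
move=> c w w'; elim: k => // k IH; by rewrite !iterS IH linearP.

Qed.
HB.instance Definition _ k := GRing.isLinear.Build R _ _ _ (iter k i) (@iter_ins_is_linear k).

Lemma ser_is_linear a : linear (ser a).
Proof.
move=> c w w'; apply/funext => s; rewrite funD funZ /ser scaler_sumr -big_split /=.
apply: eq_bigr => k _; rewrite iter_ins_is_linear funD funZ scalerDr.
by rewrite !scalerA mulrC.
Qed.
HB.instance Definition _ a := GRing.isLinear.Build R _ _ _ (ser a) (@ser_is_linear a).

Lemma local_ser_sum D a w s n : local D -> (size s < n)%N ->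
  D (ser a w) s = \sum_(k < n) a k *: D (iter k i w) s.
Proof.
move=> DL sn.
rewrite (DL _ (\sum_(k < n) a k *: iter k i w)) => [|u us].
  rewrite linear_sum (fun_sum _ (fun k => D (a k *: iter k i w))).
  by apply: eq_bigr => k _; rewrite linearZ.
rewrite (fun_sum _ (fun k => a k *: iter k i w)) (@serE n) //.
exact: leq_ltn_trans sn.
Qed.

Lemma serD a b w : ser (fun k => a k + b k) w = ser a w + ser b w.
Proof.
apply/funext => s; rewrite funD /ser -big_split /=.
by apply: eq_bigr => k _; rewrite scalerDl.
Qed.

Lemma serZ (c : R) a w : ser (fun k => c * a k) w = c *: ser a w.
Proof.
apply/funext => s; rewrite funZ /ser scaler_sumr.
by apply: eq_bigr => k _; rewrite scalerA.
Qed.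

Lemma ser_one w : ser (one_series R) w = w.
Proof.
apply/funext => s; rewrite /ser big_ord_recl /= scale1r big1 ?addr0 // => k _.
by rewrite scale0r.
Qed.

Lemma local_iter k : local (iter k i).
Proof.
elim: k => [|k IH] w w' s E1; first exact: E1.
rewrite !iterS; apply: (@local_ins R E N op) => u us; apply: IH => v vu.
by apply: E1; exact: leq_trans us.
Qed.

Lemma shifted_sum (G : nat -> N) b k n : (k <= n)%N ->
  (forall j, (n <= j)%N -> G j = 0) ->
  \sum_(l < n) b l *: G (k + l)%N = \sum_(j < n | (k <= j)%N) b (j - k)%N *: G j.
Proof.
move=> /subnKC; move: (n - k)%N => q <- G0.
rewrite [RHS]big_mkcond [RHS]big_split_ord [X in _ = _ X _]big1 /= => [|j _]; last first.
  by rewrite leqNgt ltn_ord.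
rewrite add0r; transitivity (\sum_(l < q) b l *: G (k + l)%N).
  rewrite (@big_ord_widen _ _ _ q (k + q) (fun l => b l *: G (k + l)%N)) ?leq_addl //.
  rewrite [RHS]big_mkcond /=; apply: eq_bigr => l _; case: ltnP => // ql.
  by rewrite G0 ?scaler0 // leq_add2l.
by apply: eq_bigr => l _; rewrite leq_addr addKn.
Qed.

Lemma ser_ser a b w : ser a (ser b w) = ser (conv a b) w.
Proof.
apply/funext => s; rewrite {1}/ser [RHS]/ser.
pose n := (size s).+1; rewrite -/n.
transitivity (\sum_(k < n) \sum_(m < n | (k <= m)%N)
    (a k * b (m - k)%N) *: iter m i w s).
  apply: eq_bigr => k _.
  rewrite (@local_ser_sum (iter k i) b w s n (@local_iter k)) //.
  under eq_bigr => l _ do rewrite /= -iterD.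
  rewrite (@shifted_sum (fun j => iter j i w s)) ?(ltnW (ltn_ord k)) //.
    by rewrite scaler_sumr; apply: eq_bigr => j _; rewrite scalerA.
  by move=> j nj; exact: iter_ins_short.
rewrite (exchange_big_dep xpredT) //=; apply: eq_bigr => m _.
rewrite /conv scaler_suml.
rewrite (big_ord_widen_cond n xpredT (fun k => (a k * b (m - k)%N) *: iter m i w s)) //.
Qed.

(** Leibniz rule for an operator whose third iterated commutator vanishes. *)
Lemma iter_comm2 D K K2 k w :
  (forall w, D (i w) = i (D w) + K w) ->
  (forall w, K (i w) = i (K w) + K2 w) -> (forall w, K2 (i w) = i (K2 w)) ->
  D (iter k i w) = iter k i (D w) + k%:R *: iter k.-1 i (K w) +
    'C(k, 2)%:R *: iter k.-2 i (K2 w).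
Proof.
move=> Di Ki K2i.
have K2k l : K2 (iter l i w) = iter l i (K2 w).
  by elim: l => // l IH; rewrite iterS K2i IH.
have Kk l : K (iter l i w) = iter l i (K w) + l%:R *: iter l.-1 i (K2 w).
  elim: l => [|l IH]; first by rewrite scale0r addr0.
  rewrite iterS Ki IH K2k linearD linearZ /= -addrA; congr (_ + _).
  case: l {IH} => [|l]; first by rewrite scale0r add0r scale1r.
  by rewrite [l.+2%:R]mulrSr scalerDl scale1r.
elim: k => [|k IH]; first by rewrite !scale0r !addr0.
rewrite iterS Di IH Kk !linearD !linearZ /=.
have -> : k.+1%:R *: iter k i (K w) = k%:R *: i (iter k.-1 i (K w)) + iter k i (K w).
  case: k {IH} => [|k]; first by rewrite scale0r add0r scale1r.
  by rewrite [k.+2%:R]mulrSr scalerDl scale1r.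
rewrite binS bin1 natrD scalerDl.
have -> : 'C(k, 2)%:R *: iter k.-1 i (K2 w) = 'C(k, 2)%:R *: i (iter k.-2 i (K2 w)).
  by case: k {IH} => [|[|k]]; rewrite // !scale0r.
abel.
Qed.

(** The Taylor expansion [D a(i) = a(i) D + a'(i) [D, i] + a''(i) [[D, i], i] / 2]. *)
Lemma ser_comm2 D K K2 a w : local D ->
  (forall w, D (i w) = i (D w) + K w) ->
  (forall w, K (i w) = i (K w) + K2 w) -> (forall w, K2 (i w) = i (K2 w)) ->
  D (ser a w) = ser a (D w) + ser (derivs a) (K w) +
    2^-1 *: ser (derivs (derivs a)) (K2 w).
Proof.
move=> DL Di Ki K2i; apply/funext => s; rewrite !funD funZ.
rewrite (@local_ser_sum _ _ _ _ (size s).+3) // 1?ltnW //.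
under eq_bigr => k _ do rewrite (iter_comm2 _ _ Di Ki K2i) !funD !funZ !scalerDr.
rewrite !big_split /=; congr (_ + _ + _).
- by rewrite (@serE (size s).+3) // ltnW.
(* the terms with k = 0, and k = 1 in the last sum, have coefficient zero; the
   bound leaves room for removing them *)
- rewrite big_ord_recl !scale0r scaler0 add0r (@serE (size s).+2) 1?ltnW //.
  by apply: eq_bigr => k _; rewrite /derivs scalerA mulrC.
- rewrite big_ord_recl bin0n !scale0r scaler0 add0r.
  rewrite big_ord_recl bin_small // !scale0r scaler0 add0r.
  rewrite (@serE (size s).+1) // scaler_sumr.
  apply: eq_bigr => k _; rewrite /derivs !scalerA /= /bump !add1n; congr (_ *: _).
  have : (2 * 'C(k.+2, 2))%N = (k.+2 * k.+1)%N.
    by rewrite -(mul_bin_diag k.+2 1) bin1.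
  move=> /(congr1 (fun n => n%:R : R)); rewrite !natrM => C2.
  have two0 : 2 != 0 :> R by rewrite pnatr_eq0.
  have -> : 'C(k.+2, 2)%:R = 2^-1 * (k.+2%:R * k.+1%:R) :> R.
    by rewrite -C2 mulrA mulVf ?mul1r.
  by ring.
Qed.

End Series.

(** * The strict representation and its conjugate *)

Section EpsAnticommute.
Context (R : numFieldType) (E N : lmodType R) (br : E -> E -> E).
Implicit Types (w : seq E -> N) (X : E) (s : seq E) (act op : E -> {linear N -> N}).

Lemma theta_eps X w : theta br X (eps w) = eps (theta br X w).
Proof.
apply/funext => s; elim: s w => [|Y s IH] w; first by rewrite /eps /= scaler0.
change (slot (br X Y) (eps w) s + theta br X (slot Y (eps w)) s =
  slot Y (eps (theta br X w)) s).
rewrite !slot_eps linearN /= !funN IH -opprD; congr (- _).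
by rewrite /eps -scalerDr.
Qed.

Lemma delta_eps w : delta br (eps w) = - eps (delta br w).
Proof.
apply/funext => s; elim: s w => [|X s IH] w; first by rewrite funN /eps /= scaler0 oppr0.
change (- theta br X (eps w) s - delta br (slot X (eps w)) s =
  - slot X (eps (delta br w)) s).
rewrite theta_eps !slot_eps linearN /= !funN IH opprK funN opprK -scalerN -scalerBr.
by congr (_ *: _).
Qed.

Lemma ce_eps act w : ce br act (eps w) = - eps (ce br act w).
Proof. by rewrite !ce_ins_delta ins_eps delta_eps linearD opprD. Qed.

(** The bracket of [L_c] with [iota_c] is the contraction with the bracket of [c]
with itself.  This is twice [bins], since each pair of arguments occurs in both
orders. *)
Lemma ins_act_ins act op w :
  (forall X Y x, act X (op Y x) = op Y (act X x) + op (br X Y) x) ->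
  (forall X Y x, op (br X Y) x = - op (br Y X) x) ->
  ins act (ins op w) + ins op (ins act w) = bins br op w + bins br op w.
Proof.
move=> actop brC; apply/funext => s; rewrite !funD.
elim: s w => [|X s IH] w; first by [].
change (act X (ins op w s) - ins act (pw (op X) w - ins op (slot X w)) s +
  (op X (ins act w s) - ins op (pw (act X) w - ins act (slot X w)) s) =
  (ins (fun Y => op (br X Y)) w s + bins br op (slot X w) s) +
  (ins (fun Y => op (br X Y)) w s + bins br op (slot X w) s)).
rewrite [ins act (_ - _)]linearB [ins op (_ - _)]linearB /= !funB.
pose z := ins (fun Y => op (br X Y)) w s.
have E1 : act X (ins op w s) - ins op (pw (act X) w) s = z.
  rewrite /z -(@ins_comm _ _ _ (act X) op (fun Y => op (br X Y))) // => Y x.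
  by rewrite actop addrC addKr.
have E2 : op X (ins act w s) - ins act (pw (op X) w) s = z.
  rewrite /z -(@ins_comm _ _ _ (op X) act (fun Y => op (br X Y))) // => Y x.
  by rewrite actop opprD addNKr brC opprK.
have := IH (slot X w); rewrite -/z.
set a := ins act _ s; set b := ins op _ s; set c := bins _ _ _ s => E3.
transitivity ((z + z) + (a + b)); last by rewrite E3; abel.
rewrite -{1}E1 -E2; abel.
Qed.

End EpsAnticommute.

Section TwistedRepresentation.
Context (R : realType) (m : nat) (M : smooth_manifold R m).
Notation V := (vfield M).
Notation F := (dform M).
Local Notation W := (V * F)%type.
Local Notation C := (seq W -> F).
Implicit Types (e : W) (w : C) (s t u : seq W) (x y : F).

(** The form component does not take part in the Lie bracket, but cochains on
[V * F] include the one that reads off the form entry. *)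
Definition ebr e1 e2 : W := (lie_bracket e1.1 e2.1, 0).
Definition iota e : {linear F -> F} := contract e.1.
Definition lieE e : {linear F -> F} := Lie e.1.

(** In the notation of the tautological odd vector field [c]: contraction, de Rham
differential, Lie derivative, contraction with the bracket of [c] with itself, and
the Chevalley-Eilenberg differential [CE_c = Lie_c + delta_c].  The sign [eps] makes
[iota_c] even and the others odd, so that power series in [iota_c] are moved
across them by plain commutators. *)
Definition iota_c w : C := ins iota w.
Definition d_c w : C := eps (pw (@extd R m M) w).
Definition Lie_c w : C := eps (ins lieE w).
Definition iota_cc w : C := 2 *: eps (bins ebr iota w).
Definition delta_c w : C := eps (delta ebr w).
Definition CE_c w : C := eps (ce ebr lieE w).
Definition low k w : C := pw (lower k) w.

Lemma iota_c_is_linear : linear iota_c.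
Proof. exact: (linearP (ins iota : {linear C -> C})). Qed.
HB.instance Definition _ := GRing.isLinear.Build R C C *:%R iota_c iota_c_is_linear.

Lemma d_c_is_linear : linear d_c.
Proof. exact: (linearP (@eps R W F \o pw (@extd R m M) : {linear C -> C})). Qed.
HB.instance Definition _ := GRing.isLinear.Build R C C *:%R d_c d_c_is_linear.

Lemma Lie_c_is_linear : linear Lie_c.
Proof. exact: (linearP (@eps R W F \o ins lieE : {linear C -> C})). Qed.
HB.instance Definition _ := GRing.isLinear.Build R C C *:%R Lie_c Lie_c_is_linear.

Lemma iota_cc_is_linear : linear iota_cc.
Proof. exact: (linearP (2 \*: (@eps R W F \o bins ebr iota) : {linear C -> C})). Qed.
HB.instance Definition _ := GRing.isLinear.Build R C C *:%R iota_cc iota_cc_is_linear.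

Lemma delta_c_is_linear : linear delta_c.
Proof. exact: (linearP (@eps R W F \o delta ebr : {linear C -> C})). Qed.
HB.instance Definition _ := GRing.isLinear.Build R C C *:%R delta_c delta_c_is_linear.

Lemma CE_c_is_linear : linear CE_c.
Proof. exact: (linearP (@eps R W F \o ce ebr lieE : {linear C -> C})). Qed.
HB.instance Definition _ := GRing.isLinear.Build R C C *:%R CE_c CE_c_is_linear.

Lemma low_is_linear k : linear (low k).
Proof. exact: (linearP (pw (lower k) : {linear C -> C})). Qed.
HB.instance Definition _ k := GRing.isLinear.Build R C C *:%R (low k) (low_is_linear k).

Lemma iotaC e1 e2 x : iota e1 (iota e2 x) = - iota e2 (iota e1 x).
Proof. exact: contractC. Qed.

Lemma iota_ebrC e1 e2 x : iota (ebr e1 e2) x = - iota (ebr e2 e1) x.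
Proof.
rewrite /iota /ebr /= lie_bracketC.
have := contractPl (-1) (lie_bracket e2.1 e1.1) 0 x.
by rewrite addr0 contract0l addr0 !scaleN1r.
Qed.

Lemma lieE_iota e1 e2 x :
  lieE e1 (iota e2 x) = iota e2 (lieE e1 x) + iota (ebr e1 e2) x.
Proof. exact: Lie_contract. Qed.

Lemma d_c_iota_c w : d_c (iota_c w) = iota_c (d_c w) + Lie_c w.
Proof.
rewrite /d_c /Lie_c /iota_c /= ins_eps -(@ins_anticomm _ _ _ (@extd R m M) iota lieE).
  by rewrite linearD /= addrC addrK.
by move=> e x; rewrite addrC; apply/esym; exact: Cartan.
Qed.

Lemma Lie_c_iota_c w : Lie_c (iota_c w) = iota_c (Lie_c w) + iota_cc w.
Proof.
rewrite /Lie_c /iota_cc /iota_c /= ins_eps scaler_nat mulr2n -linearD /=.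
rewrite -(@ins_act_ins _ _ _ ebr lieE iota).
- by rewrite linearD /= addrC addrK.
- exact: lieE_iota.
- exact: iota_ebrC.
Qed.

Lemma iota_cc_iota_c w : iota_cc (iota_c w) = iota_c (iota_cc w).
Proof.
rewrite /iota_cc /iota_c /= linearZ /= ins_eps bins_ins; last exact: iotaC.
by rewrite linearN.
Qed.

(** Half of the commutator of [Lie_c] with the opposite sign, so that [CE_c] and
[iota_c] have the commutator [iota_cc / 2]. *)
Lemma delta_c_iota_c w : delta_c (iota_c w) = iota_c (delta_c w) - 2^-1 *: iota_cc w.
Proof.
rewrite /delta_c /iota_cc /iota_c /= scalerA mulVf ?pnatr_eq0 // scale1r.
by rewrite delta_ins ins_eps linearB linearN.
Qed.

Lemma CE_cE w : CE_c w = Lie_c w + delta_c w.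
Proof. by rewrite /CE_c /Lie_c /delta_c /= -linearD /= ce_ins_delta. Qed.

Lemma halfB : 1 - 2^-1 = 2^-1 :> R.
Proof. by rewrite {1}(splitr (1 : R)) mul1r addrK. Qed.

Lemma CE_c_iota_c w : CE_c (iota_c w) = iota_c (CE_c w) + 2^-1 *: iota_cc w.
Proof.
rewrite !CE_cE Lie_c_iota_c delta_c_iota_c linearD /= addrACA; congr (_ + _).
by rewrite -{1}[iota_cc w]scale1r -scalerBl halfB.
Qed.

(** The projections commute with all operators up to a shift of the bound; this
and the next two lemmas are all that is used about truncation. *)
Lemma low_d_c k w : low k.+1 (d_c w) = d_c (low k w).
Proof.
apply/funext => s; rewrite /low /d_c /pw /eps /= linearZ /=; congr (_ *: _).
exact: lower_extd.
Qed.

Lemma low_iota_c k w : low k (iota_c w) = iota_c (low k.+1 w).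
Proof.
apply/funext => s; elim: s w => [|e s IH] w; first by rewrite /low /pw /= linear0.
change (lower k (iota e (w s) - iota_c (slot e w) s) =
  iota e (low k.+1 w s) - iota_c (low k.+1 (slot e w)) s).
by rewrite linearB /= -IH; congr (_ - _); exact: lower_contract.
Qed.

Lemma low_CE_c k w : low k (CE_c w) = CE_c (low k w).
Proof.
rewrite /low /CE_c /= pw_eps ce_pw // => e x.
by apply/esym; exact: lower_Lie.
Qed.

Lemma low_low k l w : low k (low l w) = low (minn k l) w.
Proof. by apply/funext => s; exact: lower_lower. Qed.

Lemma lowW k l w : (k <= l)%N -> low k w = w -> low l w = w.
Proof. by move=> kl <-; rewrite low_low (minn_idPr kl). Qed.

Lemma d_c_d_c w : d_c (d_c w) = 0.
Proof.
apply/funext => s; rewrite /d_c /pw /eps /= linearZ /= extd_extd.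
by rewrite !scaler0.
Qed.

Lemma d_c_CE_c w : d_c (CE_c w) = - CE_c (d_c w).
Proof.
rewrite /d_c /CE_c /= ce_eps linearN opprK /= pw_eps epsK ce_pw ?epsK //.
by move=> e x; apply/esym; exact: extd_Lie.
Qed.

Lemma CE_c_CE_c w : slot_linear w -> CE_c (CE_c w) = 0.
Proof.
move=> wl; rewrite /CE_c /= ce_eps ce_ce //.
- by rewrite !linear0.
- by move=> X Y Z; rewrite /ebr /= lie_bracketJ; congr (_, _); rewrite subr0.
- by move=> X Y x; exact: Lie_bracket.
Qed.

Lemma local_d_c : local d_c.
Proof. exact: (local_comp (@local_eps _ _ _) (@local_pw _ _ _ _)). Qed.

Lemma local_CE_c : local CE_c.
Proof.
apply: (local_comp (@local_eps _ _ _)) => w w' s E1.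
rewrite !ce_ins_delta !funD (@local_ins _ _ _ _ w w') //.
by rewrite (@local_delta _ _ _ _ w w').
Qed.

Local Notation ser := (@ser R W F iota).

Lemma d_c_ser a w : d_c (ser a w) = ser a (d_c w) + ser (derivs a) (Lie_c w) +
  2^-1 *: ser (derivs (derivs a)) (iota_cc w).
Proof.
apply: (@ser_comm2 _ _ _ _ d_c Lie_c iota_cc).
- exact: local_d_c.
- exact: d_c_iota_c.
- exact: Lie_c_iota_c.
- exact: iota_cc_iota_c.
Qed.

Lemma CE_c_ser a w : CE_c (ser a w) = ser a (CE_c w) + 2^-1 *: ser (derivs a) (iota_cc w).
Proof.
rewrite (@ser_comm2 _ _ _ _ CE_c (2^-1 \*: iota_cc) \0) /=.
- by rewrite !linear0 addr0 linearZ.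
- exact: local_CE_c.
- exact: CE_c_iota_c.
- by move=> w'; rewrite iota_cc_iota_c [in RHS]linearZ addr0.
- by move=> w'; rewrite linear0.
Qed.

Lemma low_iter k n w :
  low k (iter n (ins iota) w) = iter n (ins iota) (low (n + k) w).
Proof. by elim: n k => // n IH k; rewrite iterS [LHS]low_iota_c IH addnS addSn. Qed.

(** The de Rham differential, truncated to the degrees less than [r], and the Lie
derivative: the strict structure. *)
Definition strict_diff r w : C := low r (d_c w) + CE_c w.

Lemma strict_diff_strict_diff q w : slot_linear w -> strict_diff q.+1 (strict_diff q.+1 w) = 0.
Proof.
move=> wl; rewrite /strict_diff !linearD /= CE_c_CE_c // addr0 -low_CE_c d_c_CE_c linearN /= subrK.
by rewrite -[d_c (low _ _)]low_d_c d_c_d_c !linear0.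
Qed.

Local Notation f := (fser R).
Local Notation b := (bser R).

(** The sum of all brackets in which one entry is a form, as an operator on that
form; [w - low q w] is the component of degree [q = r - 1], the only one on which
the brackets involve [d] in another way. *)
Definition bracket_op q w : C := d_c w - ser b (d_c (w - low q w)) + ser (shift b) (Lie_c w)
  - ser (shift (shift b)) (iota_cc w).

(** The second term contains the brackets with two vector fields merged into
their Lie bracket. *)
Definition bracket_diff q w : C := bracket_op q w + delta_c w.

(** Contractions lower the degree, so that only the constant term of the series
can reach the degree [q]. *)
Lemma low_ser q a w : low q.+1 w = w -> low q (ser a w) = ser a w - a 0%N *: (w - low q w).
Proof.
move=> lw; apply/funext => s.
rewrite (@local_ser_sum _ _ _ _ (low q) _ _ _ (size s).+1) //; last exact: local_pw.
rewrite funB funZ funB (@serE _ _ _ _ (size s).+1) // !big_ord_recl /= scalerBr.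
have E1 (k : 'I_(size s)) :
    low q (ins iota (iter k (ins iota) w)) s = ins iota (iter k (ins iota) w) s.
  rewrite -iterS low_iter (@lowW q.+1) //.
  by rewrite addSn ltnS leq_addl.
under eq_bigr => k _ do rewrite E1.
abel.
Qed.

Lemma fser0 : f 0%N = 1. Proof. by rewrite /fser expr0 (_ : 1`! = 1%N) // divr1. Qed.

Lemma bser0 : b 0%N = 1.
Proof.
have := congr1 (@^~ 0%N) (conv_fser_bser R).
by rewrite /conv big_ord_recl big_ord0 addr0 fser0 mul1r.
Qed.

Lemma fser1 : f 1%N = - 2^-1.
Proof. by rewrite /fser expr1 mulN1r (_ : 2`! = 2%N). Qed.

Lemma bser1 : b 1%N = 2^-1.
Proof.
have := congr1 (@^~ 1%N) (conv_fser_bser R).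
rewrite /conv big_ord_recr big_ord_recl big_ord0 /= !subnn subn0 addr0.
by rewrite fser0 bser0 mul1r mulr1 fser1 => /eqP; rewrite subr_eq0 => /eqP.
Qed.

Lemma conv_fser_shift : conv f (shift b) = fun n => - f n.+1.
Proof.
apply/funext => n; rewrite conv_shift conv_fser_bser bser0 mulr1.
by rewrite /one_series sub0r.
Qed.

Lemma conv_fser_shift2 : conv f (shift (shift b)) = fun n => - f n.+2 - 2^-1 * f n.+1.
Proof.
apply/funext => n; rewrite conv_shift conv_fser_shift.
by rewrite /shift bser1 [2^-1 * _]mulrC.
Qed.

Lemma ser_eq a a' w : (forall n, a n = a' n) -> ser a w = ser a' w.
Proof. by move=> /funext ->. Qed.

Lemma ser_bser_fser w : ser b (ser f w) = w.
Proof. by rewrite ser_ser convC conv_fser_bser ser_one. Qed.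

(** With [f' = - f - (f - 1)/t] both sides have the same coefficients in front of
[Lie_c] and [iota_cc].  The component of degree [q] needs the correction by [d_c]
without contractions, which on the left comes from [f b = 1]. *)
Lemma intertwining q w : low q.+1 w = w -> ser f (bracket_diff q w) = strict_diff q.+1 (ser f w).
Proof.
move=> lw; rewrite /bracket_diff /bracket_op /strict_diff low_d_c low_ser // fser0 scale1r.
move: (w - low q w) => v.
do 4! rewrite [ser f (_ + _)]linearD /=.
do 2! rewrite [ser f (- _)]linearN /=.
rewrite [d_c (_ - v)]linearB /= d_c_ser CE_c_ser CE_cE [ser f (_ + delta_c w)]linearD /=.
rewrite !ser_ser conv_fser_bser ser_one conv_fser_shift conv_fser_shift2.
(* the coefficient identity f' = - shift f - f is [fserS] *)
have -> : ser (derivs f) (Lie_c w) = ser (fun n => - f n.+1) (Lie_c w) - ser f (Lie_c w).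
  rewrite -scaleN1r -serZ -serD; apply: ser_eq => n.
  rewrite mulN1r /derivs -(fserS R n) [n.+2%:R]mulrSr mulrDl mul1r; ring.
have -> : ser (fun n => - f n.+2 - 2^-1 * f n.+1) (iota_cc w) =
  - (2^-1 *: ser (derivs (derivs f)) (iota_cc w) + 2^-1 *: ser (derivs f) (iota_cc w)).
  rewrite -!serZ -serD -scaleN1r -serZ; apply: ser_eq => n.
  have E1 := fserS R n; have E2 := fserS R n.+1.
  rewrite /derivs.
  have -> : f n.+1 = - n.+3%:R * f n.+2 by rewrite mulNr E2 opprK.
  rewrite -[n.+3]addn1 -[n.+2]addn1 !natrD; by field.
abel.
Qed.

End TwistedRepresentation.

(** * Multilinearity and alternation *)

Section Stability.
Context (R : numFieldType) (E N : lmodType R).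
Variable op : E -> {linear N -> N}.
Implicit Types (w : seq E -> N) (s t u : seq E) (a : nat -> R) (P : (seq E -> N) -> Prop).

(** The closure properties shared by the predicates below, which therefore hold
for everything that is built from the operators of the brackets. *)
Record stable P : Prop := Stable {
  stable_lin : forall (k : R) w w', P w -> P w' -> P (k *: w + w');
  stable_pw : forall g w, P w -> P (pw g w);
  stable_eps : forall w, P w -> P (eps w);
  stable_ins : forall w, P w -> P (ins op w);
  stable_ser : forall a w, P w -> P (ser op a w) }.

(** Each of the predicates involves lists of one length at a time, where the
series is a finite sum. *)
Lemma ser_bounded_lengths P a w :
  (forall (k : R) w w', P w -> P w' -> P (k *: w + w')) ->
  (forall w, P w -> P (ins op w)) -> P w ->
  forall n, exists2 w', P w' & forall s, (size s <= n)%N -> ser op a w s = w' s.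
Proof.
move=> Pl Pi Pw n.
have P0 : P 0 by have := Pl (-1) w w Pw Pw; rewrite scaleN1r addNr.
exists (\sum_(k < n.+1) a k *: iter k (ins op) w) => [|s sn].
  elim: (n.+1) => [|k IH]; first by rewrite big_ord0.
  rewrite big_ord_recr /= addrC; apply: Pl => //.
  by elim: k {IH} => // k; exact: Pi.
by rewrite (fun_sum _ (fun k => a k *: iter k (ins op) w)) (@serE _ _ _ _ n.+1).
Qed.

Definition alternate w := forall s t X, w (s ++ X :: X :: t) = 0.

Lemma alternate_slot X w : alternate w -> alternate (slot X w).
Proof. by move=> wa s t Y; exact: (wa (X :: s)). Qed.

Lemma alternate_swaps w : slot_linear w -> alternate w -> swaps w.
Proof.
move=> wl wa s t X Y.
have wD u v Z Z' : w (u ++ (Z + Z') :: v) = w (u ++ Z :: v) + w (u ++ Z' :: v).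
  by rewrite -[Z]scale1r wl !scale1r.
have := wa s t (X + Y); rewrite wD.
have cat1 Z Z' : s ++ Z :: Z' :: t = (s ++ [:: Z]) ++ Z' :: t by rewrite -catA.
rewrite !cat1 !wD -!cat1 !wa add0r addr0 => /eqP.
by rewrite addr_eq0 => /eqP.
Qed.

Lemma stable_alternate : stable alternate.
Proof.
have lin (k : R) w w' : alternate w -> alternate w' -> alternate (k *: w + w').
  by move=> wa wa' s t X; rewrite funD funZ wa wa' scaler0 addr0.
have in_ w : alternate w -> alternate (ins op w).
  move=> wa s t X; elim: s w wa => [|Y s IH] w wa /=.
    rewrite [X in _ - (_ - X)](_ : _ = 0) ?subr0 ?subrr //.
    have -> : slot X (slot X w) = 0 by apply/funext => u; exact: (wa [::]).
    by rewrite linear0.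
  by rewrite wa linear0 IH ?subrr //; exact: alternate_slot.
split=> //.
- by move=> g w wa s t X; rewrite /pw wa linear0.
- by move=> w wa s t X; rewrite /eps wa scaler0.
- move=> a w wa s t X.
  have [w' wa' ->] := ser_bounded_lengths a lin in_ wa (size (s ++ X :: X :: t)).
    exact: wa'.
  by [].
Qed.

Hypothesis op_lin : forall (k : R) X Y x, op (k *: X + Y) x = k *: op X x + op Y x.

Lemma stable_slot_linear : stable (@slot_linear R E N).
Proof.
have lin (k : R) w w' : slot_linear w -> slot_linear w' -> slot_linear (k *: w + w').
  move=> wl wl' s t c X Y; rewrite !funD !funZ wl wl' !scalerDr !scalerA mulrC.
  by rewrite addrACA.
have in_ w : slot_linear w -> slot_linear (ins op w).
  move=> wl s t k X Y; elim: s w wl => [|Z s IH] w wl /=.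
    rewrite op_lin; have -> : slot (k *: X + Y) w = k *: slot X w + slot Y w.
      by apply/funext => u; exact: (wl [::]).
    by rewrite ins_is_linear funD funZ scalerBr addrACA opprD.
  rewrite wl linearP IH; last exact: slot_linear_slot.
  by rewrite scalerBr addrACA opprD.
split=> //.
- by move=> g w wl s t k X Y; rewrite /pw wl linearP.
- move=> w wl s t k X Y; rewrite /eps wl !size_cat /= scalerDr.
  by rewrite !scalerA mulrC.
- move=> a w wl s t k X Y.
  have [w' wl' E1] := ser_bounded_lengths a lin in_ wl (size (s ++ X :: t)).
  by rewrite !E1 ?wl' // !size_cat.
Qed.

End Stability.

Section CochainLinearSeries.
Context (R : numFieldType) (E N : lmodType R).
Variable op : E -> {linear N -> N}.

Lemma cochain_linear_id : cochain_linear 0 (fun w : seq E -> N => w).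
Proof. exact: (@cochain_linear_pw R E N idfun). Qed.

Lemma cochain_linear_ser (a : nat -> R) : cochain_linear 0 (ser op a).
Proof.
have it k : cochain_linear 0 (iter k (ins op)).
  elim: k => [|k IH]; first exact: cochain_linear_id.
  exact: (cochain_linear_comp (cochain_linear_ins op) IH).
move=> w s; rewrite /ser.
under eq_bigr => k _ do rewrite it -shuffle_sumZ.
rewrite -(shuffle_sum_sum _ (fun k b' a' => a k *: ((-1) ^+ (0 * size a') *:
   iter k (ins op) (@cst_cochain R E N (w a')) b'))).
apply: eq_shuffle_sum => b' a' ba.
rewrite -/(ser op a _ _) (@serE _ _ _ _ (size s).+1); last first.
  by rewrite ltnS -ba leq_addr.
by rewrite scaler_sumr; apply: eq_bigr => k _; rewrite !scalerA mulrC.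
Qed.

End CochainLinearSeries.

(** * Flatness of the conjugate differential and of the twist *)

Section TwistedBrackets.
Context (R : realType) (m : nat) (M : smooth_manifold R m).
Notation V := (vfield M).
Notation F := (dform M).
Local Notation W := (V * F)%type.
Local Notation C := (seq W -> F).
Implicit Types (e : W) (w : C) (s t u : seq W) (x y : F).
Local Notation cst := (@cst_cochain R W F).
Local Notation iota := (@iota R m M).
Local Notation ser := (@ser R W F iota).
Local Notation stableW := (@stable R W F iota).

Lemma shuffle_sum_nil_r (T : Type) (N : lmodType R) (g : seq T -> N) (l : seq T) :
  shuffle_sum (fun a b => if b is [::] then g a else 0) l = g l.
Proof.
elim: l g => [|X l IH] g //=; rewrite (IH (fun a => g (X :: a))) -[RHS]addr0.
congr (_ + _); rewrite -[RHS](@shuffle_sum0 R T N l); apply: eq_shuffle_sum => a b _.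
by rewrite scaler0.
Qed.

(** [Lie_c] and [iota_cc] are commutators of [d_c] and [iota_c], so that closure
under the latter two suffices. *)
Section StableOperators.
Variables (P : C -> Prop) (Pst : stableW P).

Lemma stableD w w' : P w -> P w' -> P (w + w').
Proof. by move=> Pw Pw'; rewrite -[w]scale1r; apply: (stable_lin Pst). Qed.

Lemma stable0 w : P w -> P 0.
Proof.
by move=> Pw; have := stable_lin Pst (-1) Pw Pw; rewrite scaleN1r addNr.
Qed.

Lemma stableN w : P w -> P (- w).
Proof.
move=> Pw; rewrite -scaleN1r -[X in P X]addr0; apply: (stable_lin Pst) => //.
exact: stable0 Pw.
Qed.

Lemma stable_d_c w : P w -> P (d_c w).
Proof. by move=> Pw; apply/(stable_eps Pst)/(stable_pw Pst). Qed.

Lemma stable_Lie_c w : P w -> P (Lie_c w).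
Proof.
move=> Pw; have -> : Lie_c w = d_c (iota_c w) - iota_c (d_c w) by rewrite d_c_iota_c addrC addKr.
apply: stableD; first by apply/stable_d_c/(stable_ins Pst).
by apply/stableN/(stable_ins Pst)/stable_d_c.
Qed.

Lemma stable_iota_cc w : P w -> P (iota_cc w).
Proof.
move=> Pw; have -> : iota_cc w = Lie_c (iota_c w) - iota_c (Lie_c w)
  by rewrite Lie_c_iota_c addrC addKr.
apply: stableD; first by apply/stable_Lie_c/(stable_ins Pst).
by apply/stableN/(stable_ins Pst)/stable_Lie_c.
Qed.

Lemma stable_bracket_op q w : P w -> P (bracket_op q w).
Proof.
move=> Pw; rewrite /bracket_op; apply: stableD; last first.
  by apply/stableN/(stable_ser Pst)/stable_iota_cc.
apply: stableD; last by apply/(stable_ser Pst)/stable_Lie_c.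
apply: stableD; first exact: stable_d_c.
apply/stableN/(stable_ser Pst)/stable_d_c/stableD => //.
exact/stableN/(stable_pw Pst).
Qed.

End StableOperators.

(** True of constants and preserved by the operators: the brackets see an entry
other than the form entry through its vector field component. *)
Definition horizontal w := forall s t e, e.1 = 0 -> w (s ++ e :: t) = 0.

Lemma stable_horizontal : stableW horizontal.
Proof.
have lin (k : R) w w' : horizontal w -> horizontal w' -> horizontal (k *: w + w').
  by move=> wh wh' s t e e0; rewrite funD funZ wh // wh' // scaler0 addr0.
have in_ w : horizontal w -> horizontal (ins iota w).
  move=> wh s t e e0; elim: s w wh => [|Y s IH] w wh /=.
    have -> : slot e w = 0 by apply/funext => u; exact: (wh [::]).
    by rewrite linear0 subr0 e0; exact: contract0l.
  rewrite wh // linear0 IH ?subrr // => s' t' e' e'0; exact: (wh (Y :: s')).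
split=> //.
- by move=> g w wh s t e e0; rewrite /pw wh // linear0.
- by move=> w wh s t e e0; rewrite /eps wh // scaler0.
- move=> a w wh s t e e0.
  have [w' wh' ->] := ser_bounded_lengths a lin in_ wh (size (s ++ e :: t)).
    exact: wh'.
  by [].
Qed.

Lemma iota_linear (k : R) e1 e2 x : iota (k *: e1 + e2) x = k *: iota e1 x + iota e2 x.
Proof. exact: contractPl. Qed.

Lemma stable_slot_linearW : stableW (@slot_linear R W F).
Proof. exact: stable_slot_linear iota_linear. Qed.

Lemma horizontal_cst x : horizontal (cst x).
Proof. by move=> [|? s] t e. Qed.

Lemma slot_linear_cst x : slot_linear (cst x).
Proof. by move=> [|? s] t k e1 e2; rewrite /= scaler0 addr0. Qed.

Lemma alternate_cst x : alternate (cst x).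
Proof. by move=> [|? s] t e. Qed.

Lemma cochain_linear_bracket_op q : cochain_linear 1 (bracket_op q : C -> C).
Proof.
have ddl : cochain_linear 1 (@d_c R m M).
  exact/cochain_linear_eps/cochain_linear_pw.
have LLl : cochain_linear 1 (@Lie_c R m M).
  exact/cochain_linear_eps/cochain_linear_ins.
have JJl : cochain_linear 1 (@iota_cc R m M).
  exact/cochain_linearZ/cochain_linear_eps/cochain_linear_bins.
have serl D a : cochain_linear 1 D -> cochain_linear 1 (fun w => ser a (D w)).
  exact: (cochain_linear_comp (cochain_linear_ser iota a)).
have Nl D : cochain_linear 1 D -> cochain_linear 1 (fun w : C => - D w : C).
  move=> Dl; have := cochain_linearZ (-1) Dl.
  by congr cochain_linear; apply/funext => w; rewrite scaleN1r.
have rhol : cochain_linear 0 (fun w : C => w - low q w).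
  move=> w s; rewrite funB -(shuffle_sum_nil_l (fun a => w a - low q w a)).
  apply: eq_shuffle_sum => b a _; rewrite mul0n scale1r.
  by case: b => //= X b; rewrite funB /low /pw /= linear0 subr0.
apply: cochain_linearD; last exact/Nl/serl.
apply: cochain_linearD; last exact/serl.
apply: cochain_linearD => //; apply/Nl/(serl (fun w => d_c (w - low q w))).
exact: (cochain_linear_comp ddl rhol).
Qed.

Variable q : nat.
Local Notation f := (fser R).
Local Notation b := (bser R).
Local Notation r := q.+1.

Lemma low_ser_id k a w : low k w = w -> low k (ser a w) = ser a w.
Proof.
move=> kw; apply/funext => s.
rewrite (@local_ser_sum _ _ _ _ (low k) _ _ _ (size s).+1) //; last exact: local_pw.
rewrite /ser; apply: eq_bigr => j _; rewrite /= low_iter (@lowW _ _ _ k) //.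
by rewrite leq_addl.
Qed.

Lemma low_strict_diff w : low r w = w -> low r (strict_diff r w) = strict_diff r w.
Proof. by move=> rw; rewrite /strict_diff linearD /= low_low minnn low_CE_c rw. Qed.

Lemma low_bracket_diff w : low r w = w -> low r (bracket_diff q w) = bracket_diff q w.
Proof.
move=> rw; rewrite -(ser_bser_fser (bracket_diff q w)) intertwining //.
by apply/low_ser_id/low_strict_diff/low_ser_id.
Qed.

(** [ser f] is invertible and conjugates [bracket_diff] to [strict_diff]. *)
Lemma bracket_diff_bracket_diff w : low r w = w -> slot_linear w ->
  bracket_diff q (bracket_diff q w) = 0.
Proof.
move=> rw wl; rewrite -(ser_bser_fser (bracket_diff q (bracket_diff q w))).
rewrite intertwining ?low_bracket_diff // intertwining // strict_diff_strict_diff ?linear0 //.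
exact: (stable_ser stable_slot_linearW).
Qed.

Lemma bracket_diffD w w' : bracket_diff q (w + w') = bracket_diff q w + bracket_diff q w'.
Proof.
have lowD v v' : low q (v + v') = low q v + low q v' by exact: linearD.
have d_cD v v' : d_c (v + v') = d_c v + d_c v' by exact: linearD.
have Lie_cD : Lie_c (w + w') = Lie_c w + Lie_c w' by exact: linearD.
have iota_ccD : iota_cc (w + w') = iota_cc w + iota_cc w' by exact: linearD.
have delta_cD : delta_c (w + w') = delta_c w + delta_c w' by exact: linearD.
have serD' a v v' : ser a (v + v') = ser a v + ser a v' by exact: linearD.
have E1 : w + w' - low q (w + w') = (w - low q w) + (w' - low q w').
  by rewrite lowD; abel.
rewrite /bracket_diff /bracket_op E1 !d_cD Lie_cD iota_ccD delta_cD !serD'.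
move: (d_c w) (d_c w') (delta_c w) (delta_c w')
  (ser _ _) (ser _ _) (ser _ _) (ser _ _) (ser _ _) (ser _ _).
move=> *; abel.
Qed.

(** The tautological 1-cochain: [bracket_op] applied to it is the sum over the
entries which provide the form. *)
Definition form_entry s : F := if s is [:: e] then lower r e.2 else 0.

Lemma slot_linear_form_entry : slot_linear form_entry.
Proof.
move=> [|X [|Y s]] [|Z t] k e1 e2; rewrite /= ?scaler0 ?addr0 //.
exact: linearP.
Qed.

Lemma alternate_form_entry : alternate form_entry.
Proof. by move=> [|X [|Y s]]. Qed.

Lemma low_form_entry : low r form_entry = form_entry.
Proof.
apply/funext => -[|X [|Y s]]; rewrite /low /pw /= ?linear0 //.
by rewrite lower_lower minnn.
Qed.

(** A Lie bracket of entries has form component zero. *)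
Lemma delta_c_form_entry : delta_c form_entry = 0.
Proof.
apply/funext => s; rewrite /delta_c /eps.
suff -> : delta (@ebr R m M) form_entry s = 0 by rewrite scaler0.
have slot0 X : delta (@ebr R m M) (slot X form_entry) = 0.
  apply/funext => u; case: u => [|Y u] //.
  change (- theta (@ebr R m M) Y (slot X form_entry) u -
    delta (@ebr R m M) (slot Y (slot X form_entry)) u = 0).
  have -> : slot Y (slot X form_entry) = 0 by [].
  rewrite linear0 subr0.
  have -> : theta (@ebr R m M) Y (slot X form_entry) u = 0.
    case: u => [|Z u] //=; rewrite add0r.
    have -> : slot Z (slot X form_entry) = 0 by [].
    by rewrite linear0.
  by rewrite oppr0.
case: s => [|X s] //=; rewrite slot0 subr0.
case: s => [|Y s] /=; first by rewrite oppr0.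
have -> : slot Y form_entry = cst (lower r Y.2) by apply/funext => -[|? ?].
have -> : theta (@ebr R m M) X (cst (lower r Y.2)) s = 0.
  case: s => [|Z s] //=; rewrite add0r.
  have -> : slot Z (cst (lower r Y.2)) = 0 by [].
  by rewrite linear0.
by case: s => [|? ?]; rewrite /= ?linear0 !addr0 oppr0.
Qed.

Variables (H : F) (H_deg : Omega r.+1 H) (H_closed : extd H = 0).

(** The coefficients of [t (b - 1)]. *)
Definition twist_ser n : R := if n is k.+2 then b k.+1 else 0.
(** The coefficients of [e^-t] without the first two, which multiply the
components of degree at least [r]. *)
Definition expNser2 n : R := if (n < 2)%N then 0 else expNser R n.

Definition twist : C := - ser twist_ser (cst H).

(** [f t (b - 1) = t - t f = e^-t - 1 + t]. *)
Lemma conv_fser_twist_ser : conv f twist_ser = expNser2.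
Proof.
apply/funext => -[|n]; first by rewrite /conv big_ord_recl big_ord0 /= mulr0 addr0.
have -> : conv f twist_ser n.+1 = conv f (shift twist_ser) n.
  by rewrite conv_shift /= mulr0 subr0.
have -> : shift twist_ser = fun k => b k + (-1) * one_series R k.
  apply/funext => -[|k]; rewrite /shift /one_series /= ?mulr0 ?addr0 //.
  by rewrite bser0 mulr1 subrr.
rewrite convDr conv_fser_bser.
have -> : conv f (fun k => -1 * one_series R k) n = - f n.
  rewrite -[X in _ = - X](congr1 (@^~ n) (conv1 f)) convC /conv -sumrN.
  by apply: eq_bigr => k _; rewrite mulN1r mulNr.
rewrite /one_series /expNser2; case: n => [|n] /=; first by rewrite fser0 subrr.
by rewrite add0r /fser /expNser [in RHS]exprS mulN1r mulNr.
Qed.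

Lemma low_small_ser k a w : low k.+2 w = w -> a 0%N = 0 -> a 1%N = 0 ->
  low k (ser a w) = ser a w.
Proof.
move=> kw a0 a1; apply/funext => s.
rewrite (@local_ser_sum _ _ _ _ (low k) _ _ _ (size s).+1) //; last exact: local_pw.
rewrite /ser; apply: eq_bigr => -[[|[|j]] jn] _; rewrite /= ?a0 ?a1 ?scale0r //.
by rewrite -!iterS low_iter (@lowW _ _ _ k.+2) // !addSn !ltnS leq_addl.
Qed.

Lemma low_cst k x : low k (cst x) = cst (lower k x).
Proof. by apply/funext => -[|e s]; rewrite /low /pw //= linear0. Qed.

Lemma d_c_cst x : d_c (cst x) = cst (extd x).
Proof.
by apply/funext => -[|e s]; rewrite /d_c /pw /eps /= ?scale1r // linear0 scaler0.
Qed.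

Lemma delta_c_cst x : delta_c (cst x) = 0.
Proof.
apply/funext => -[|e s]; rewrite /delta_c /eps /= ?scaler0 //.
have -> : slot e (cst x) = 0 by [].
rewrite linear0 subr0.
suff -> : theta (@ebr R m M) e (cst x) s = 0 by rewrite oppr0 scaler0.
case: s => [|e' s] //=; have -> : slot e' (cst x) = 0 by [].
by rewrite linear0 addr0.
Qed.

(** For [a = e^-t] the Taylor expansion reduces to [dH = 0], because
[a' + a = a'' + a' = 0].  The omitted terms [H] and [iota_c H] have degree at least [r]
and stay there under the differential. *)
Lemma strict_diff_ser_twist : strict_diff r (ser expNser2 (cst H)) = 0.
Proof.
pose h := cst H; pose u := ser (expNser R) h.
have hk k : (k <= r.+1)%N -> low k h = 0.
  by move=> kr; rewrite low_cst (lower_Omega _ H_deg) ltnNge kr linear0.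
have e2E : ser expNser2 h = u - h + iota_c h.
  apply/funext => s; rewrite !(funD, funN) /u.
  rewrite !(@serE _ _ _ _ (size s).+2) //.
  rewrite !big_ord_recl /= !scale0r !add0r /expNser expr0 expr1 fact0.
  rewrite (_ : 1`! = 1%N) // !divr1 scale1r scaleN1r -/iota_c; abel.
have Du : d_c u + CE_c u = 0.
  have h0 : d_c h = 0 by rewrite d_c_cst H_closed linear0.
  have CE_h : CE_c h = Lie_c h by rewrite CE_cE delta_c_cst addr0.
  rewrite /u d_c_ser CE_c_ser h0 CE_h [ser (expNser R) 0]linear0 add0r.
  have dE n : derivs (expNser R) n = -1 * expNser R n.
    rewrite /derivs /expNser exprS [n.+1`!]factS [X in _ / X]natrM.
    have : n.+1%:R != 0 :> R by rewrite pnatr_eq0.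
    move: (factS_neq0 R n); move: (n`!%:R) (n.+1%:R) => y z y0 z0.
    by field; rewrite y0 z0.
  have -> : derivs (expNser R) = fun n => -1 * expNser R n by exact/funext.
  have -> : derivs (fun n => -1 * expNser R n) = expNser R.
    apply/funext => n; rewrite {1}/derivs mulrCA -/(derivs _ n) dE.
    by rewrite mulrA mulrNN !mul1r.
  rewrite !serZ !scaleN1r scalerN; abel.
have low2 : low r (ser expNser2 h) = ser expNser2 h.
  apply: low_small_ser => //; rewrite low_cst (lower_Omega _ H_deg) ltnSn.
  by [].
rewrite -/h /strict_diff -{2}low2 -low_CE_c -linearD /= e2E.
have d_cD v v' : d_c (v + v') = d_c v + d_c v' by exact: linearD.
have CE_cD v v' : CE_c (v + v') = CE_c v + CE_c v' by exact: linearD.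
have d_cN v : d_c (- v) = - d_c v by exact: linearN.
have CE_cN v : CE_c (- v) = - CE_c v by exact: linearN.
have lowD v v' : low r (v + v') = low r v + low r v' by exact: linearD.
have lowN v : low r (- v) = - low r v by exact: linearN.
have d_c0 : d_c (0 : C) = 0 by exact: linear0.
have CE_c0 : CE_c (0 : C) = 0 by exact: linear0.
have iota_c0 : iota_c (0 : C) = 0 by exact: linear0.
have -> : d_c (u - h + iota_c h) + CE_c (u - h + iota_c h) =
    (d_c u + CE_c u) - (d_c h + CE_c h) + (d_c (iota_c h) + CE_c (iota_c h)).
  rewrite !d_cD !CE_cD d_cN CE_cN.
  move: (d_c u) (CE_c u) (d_c h) (CE_c h) (d_c _) (CE_c _) => *; abel.
rewrite Du sub0r !(lowD, lowN) !low_d_c !low_CE_c !low_iota_c !hk // 1?leqW //.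
by rewrite !(iota_c0, d_c0, CE_c0) !addr0 oppr0.
Qed.

Lemma low_twist : low r twist = twist.
Proof.
rewrite /twist linearN /= low_small_ser //.
by rewrite low_cst (lower_Omega _ H_deg) ltnSn.
Qed.

Lemma bracket_diff_twist : bracket_diff q twist = 0.
Proof.
rewrite -(ser_bser_fser (bracket_diff q twist)) intertwining.
  have strict_diffN (v : C) : strict_diff r (- v) = - strict_diff r v.
    have d_cN : d_c (- v) = - d_c v by exact: linearN.
    have CE_cN : CE_c (- v) = - CE_c v by exact: linearN.
    have lowN v2 : low r (- v2) = - low r v2 by exact: linearN.
    by rewrite /strict_diff d_cN CE_cN lowN opprD.
  have serN a v : ser a (- v) = - ser a v by exact: linearN.
  by rewrite /twist serN ser_ser conv_fser_twist_ser strict_diffN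
    strict_diff_ser_twist oppr0 linear0.
exact: low_twist.
Qed.

End TwistedBrackets.

(** * The Jacobi identities as the flatness of a cochain *)

Section BracketJacobi.
Context (R : realType) (m : nat) (M : smooth_manifold R m).
Notation V := (vfield M).
Notation F := (dform M).
Local Notation W := (V * F)%type.
Local Notation C := (seq W -> F).
Implicit Types (e : W) (w : C) (s t u : seq W) (x y : F).
Local Notation cst := (@cst_cochain R W F).
Local Notation iota := (@iota R m M).
Local Notation ebr := (@ebr R m M).

Variables (q : nat) (H : F) (H_deg : Omega q.+2 H) (H_closed : extd H = 0).
Local Notation twist := (@twist R m M H).
Local Notation form_entry := (@form_entry R m M q).

Lemma ser_scale a (k : R) w : ser iota a (k *: w) = k *: ser iota a w.
Proof. exact: linearZ. Qed.

(** All brackets at once, as a cochain with values in the forms. *)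
Definition form_part : C := bracket_op q form_entry + twist.

(** Only the binary bracket has a vector field component. *)
Definition vpart s : V := if s is [:: e1; e2] then lie_bracket e1.1 e2.1 else 0.

(** With the sign [(-1)^n] the Jacobi identities become
[bracket_diff form_part = 0]. *)
Definition bracket s : W := (vpart s, (-1) ^+ size s *: form_part s).

Lemma bracket_opZ (k : R) w : bracket_op q (k *: w) = k *: bracket_op q w.
Proof.
have d_cZ v : d_c (k *: v) = k *: d_c v by exact: linearZ.
have Lie_cZ v : Lie_c (k *: v) = k *: Lie_c v by exact: linearZ.
have iota_ccZ v : iota_cc (k *: v) = k *: iota_cc v by exact: linearZ.
have lowZ v : low q (k *: v) = k *: low q v by exact: linearZ.
rewrite /bracket_op lowZ -scalerBr !d_cZ Lie_cZ iota_ccZ !ser_scale.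
by rewrite -!(scalerBr, scalerDr).
Qed.

Lemma bracket_op0 : bracket_op q (cst 0) = 0.
Proof. by have := bracket_opZ 0 0; rewrite !scale0r linear0. Qed.

Lemma slot_linear_twist : slot_linear twist.
Proof.
apply/(stableN (@stable_slot_linearW R m M))/(stable_ser (@stable_slot_linearW R m M)).
exact: slot_linear_cst.
Qed.

Lemma alternate_twist : alternate twist.
Proof.
apply/(stableN (@stable_alternate R W F iota))/(stable_ser (@stable_alternate R W F iota)).
exact: alternate_cst.
Qed.

Lemma horizontal_twist : horizontal twist.
Proof.
apply/(stableN (@stable_horizontal R m M))/(stable_ser (@stable_horizontal R m M)).
exact: horizontal_cst.
Qed.

Lemma slot_linear_form_part : slot_linear form_part.
Proof.
apply/(stableD (@stable_slot_linearW R m M))/slot_linear_twist.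
apply/(stable_bracket_op (@stable_slot_linearW R m M))/slot_linear_form_entry.
Qed.

Lemma alternate_form_part : alternate form_part.
Proof.
apply/(stableD (@stable_alternate R W F iota))/alternate_twist.
apply/(stable_bracket_op (@stable_alternate R W F iota))/alternate_form_entry.
Qed.

Lemma horizontal_bracket_op_cst x : horizontal (bracket_op q (cst x)).
Proof. exact/(stable_bracket_op (@stable_horizontal R m M))/horizontal_cst. Qed.

Lemma form_partE s : form_part s =
  shuffle_sum (fun b a => (-1) ^+ size a *: bracket_op q (cst (form_entry a)) b) s + twist s.
Proof.
rewrite /form_part funD cochain_linear_bracket_op; congr (_ + _).
by apply: eq_shuffle_sum => b a _; rewrite mul1n.
Qed.

(** If the first entry is a pure form, it has to be the form entry. *)
Lemma form_part_form x b : form_part ((0, x) :: b) =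
  (-1) ^+ (size b).+1 *: bracket_op q (cst (lower q.+1 x)) b.
Proof.
rewrite form_partE (horizontal_twist [::]) // addr0 /=.
rewrite [X in X + _](_ : _ = 0) ?add0r; last first.
  rewrite -[RHS](@shuffle_sum0 R W F b); apply: eq_shuffle_sum => b' a' _.
  by rewrite (horizontal_bracket_op_cst _ [::]) // scaler0.
rewrite -(shuffle_sum_nil_r (fun b => (-1) ^+ (size b).+1 *: bracket_op q (cst (lower q.+1 x)) b)).
apply: eq_shuffle_sum => b' [|e' a'] _ /=.
  by rewrite expr1 scaleN1r scalerN exprS mulN1r scaleNr.
by rewrite bracket_op0 !scaler0.
Qed.

Lemma low_form_part : low q.+1 form_part = form_part.
Proof.
rewrite /form_part linearD /= low_twist //; congr (_ + _).
have -> : bracket_op q form_entry = bracket_diff q form_entry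
  by rewrite /bracket_diff delta_c_form_entry addr0.
exact/low_bracket_diff/low_form_entry.
Qed.

Lemma bracket_diff_form_part : bracket_diff q form_part = 0.
Proof.
rewrite /form_part bracket_diffD bracket_diff_twist // addr0.
have -> : bracket_op q form_entry = bracket_diff q form_entry
  by rewrite /bracket_diff delta_c_form_entry addr0.
apply: bracket_diff_bracket_diff; [exact: low_form_entry|exact: slot_linear_form_entry].
Qed.

Lemma bracket_split v x b : form_part ((v, x) :: b) =
  form_part ((v, 0) :: b) + (-1) ^+ (size b).+1 *: bracket_op q (cst (lower q.+1 x)) b.
Proof.
have E1 : (v, x) = 1 *: ((v, 0) : W) + (0, x).
  by rewrite scale1r; change ((v, x) = (v + 0, 0 + x)); rewrite addr0 add0r.
by rewrite -form_part_form E1 (slot_linear_form_part [::]) scale1r.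
Qed.

Lemma form_part0 b : form_part (0 :: b) = 0.
Proof.
have := slot_linear_form_part [::] b (-1) 0 0.
by rewrite /= scaler0 addr0 scaleN1r addNr.
Qed.

(** The outer bracket is additive in the inner one.  The form component of the
inner bracket contributes the terms of [bracket_op form_part], its vector field
component those of [delta_c form_part]. *)
Lemma jacobi_form s :
  shuffle_sum (fun a b => (-1) ^+ (size a * size b) *: (bracket (bracket a :: b)).2) s = 0.
Proof.
transitivity (bracket_diff q form_part s); last by rewrite bracket_diff_form_part.
rewrite /bracket_diff funD cochain_linear_bracket_op.
rewrite -(@shuffle_sumC _ _ _
  (fun b a => (-1) ^+ (1 * size a) *: bracket_op q (cst (form_part a)) b)).
rewrite /delta_c delta_shuffle_sum;
  last exact: alternate_swaps slot_linear_form_part alternate_form_part.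
rewrite -shuffle_sumD; apply: eq_shuffle_sum => a b _.
rewrite /bracket /= bracket_split addrC.
have -> : lower q.+1 ((-1) ^+ size a *: form_part a) = (-1) ^+ size a *: form_part a.
  by rewrite linearZ /=; congr (_ *: _); exact: (congr1 (@^~ a) low_form_part).
have scaleD (k l : R) x y : k *: (l *: (x + y)) = k *: (l *: x) + k *: (l *: y).
  by rewrite !scalerDr.
rewrite scaleD; congr (_ + _).
  have -> : bracket_op q (cst ((-1) ^+ size a *: form_part a)) b =
      (-1) ^+ size a *: bracket_op q (cst (form_part a)) b.
    by rewrite [cst (_ *: _)]linearZ bracket_opZ.
  rewrite !scalerA mul1n; congr (_ *: _).
  rewrite -!exprD -[LHS]signr_odd -[RHS]signr_odd; congr (_ ^+ nat_of_bool _).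
  rewrite !oddD; move: (odd (size a * size b)) (odd (size b).+1) (odd (size a)).
  by do 3![case].
case: a => [|e1 [|e2 [|e3 a]]] /=; rewrite /vpart ?form_part0 ?scaler0 //.
by rewrite exprM expr2 mulrNN mulr1 expr1n scale1r.
Qed.

Lemma lie_bracket0l X : lie_bracket 0 X = 0 :> V.
Proof.
apply: vfield_eq => f; change ((0 : V) (X f) - X ((0 : V) f) = 0).
by change (0 - X 0 = 0 :> Cinf M); rewrite vfield0 subr0.
Qed.

Lemma lie_bracket0r X : lie_bracket X 0 = 0 :> V.
Proof. by rewrite lie_bracketC lie_bracket0l oppr0. Qed.

Lemma jacobi_vfield s :
  shuffle_sum (fun a b => (-1) ^+ (size a * size b) *: (bracket (bracket a :: b)).1) s = 0.
Proof.
rewrite /bracket /=.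
rewrite (@eq_shuffle_sum _ _ _ _ (fun a b => if a is [:: e1; e2] then if b is [:: e3] then
   lie_bracket (lie_bracket e1.1 e2.1) e3.1 else 0 else 0)).
  have [s3|s3] := eqVneq (size s) 3%N.
    case: s s3 => [|e1 [|e2 [|e3 [|? ?]]]] //= _.
    rewrite !scaler0 !(add0r, addr0) expr0 expr1 expr2 mulrNN mulr1 !scale1r scaleN1r.
    rewrite (lie_bracketJ e1.1) (lie_bracketC (lie_bracket e1.1 e3.1)).
    rewrite (lie_bracketC (lie_bracket e2.1 e3.1)); abel.
  rewrite -[RHS](@shuffle_sum0 R W V s); apply: eq_shuffle_sum => a b ab; move: s3; rewrite -ab.
  by case: a {ab} => [|? [|? [|? ?]]] //; case: b => [|? [|? ?]].
move=> a b _; case: a => [|e1 [|e2 [|e3 a]]]; case: b => [|e4 [|e5 b]]; 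
  rewrite /= ?lie_bracket0l ?scaler0 //.
by rewrite expr2 mulrNN mulr1 scale1r.
Qed.

End BracketJacobi.

(** * Evaluation of the power series on constants *)

Section ExplicitBrackets.
Context (R : realType) (m : nat) (M : smooth_manifold R m).
Notation V := (vfield M).
Notation F := (dform M).
Local Notation W := (V * F)%type.
Local Notation C := (seq W -> F).
Implicit Types (e : W) (w : C) (s t u : seq W) (x y : F) (X Y : V).
Local Notation cst := (@cst_cochain R W F).
Local Notation iota := (@iota R m M).
Local Notation ebr := (@ebr R m M).
Local Notation i := (@ins R W F iota).
Local Notation fsts s := [seq e.1 | e <- s].

Definition supported (n : nat) w := forall s, size s != n -> w s = 0.

Lemma supported_ins n w : supported n w -> supported n.+1 (i w).
Proof.
move=> wn s; elim: s n w wn => //= e s IH n w wn; rewrite eqSS => sn.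
rewrite wn // linear0 sub0r; case: n sn wn => [|l] sn wn.
  have -> : slot e w = 0 by apply/funext => u; exact: wn.
  by rewrite linear0 oppr0.
by rewrite (IH l) ?oppr0 // => u ul; apply: wn.
Qed.

Lemma supported_iter n k w : supported n w -> supported (k + n) (iter k i w).
Proof. by elim: k => // k IH wn; apply/supported_ins/IH. Qed.

Lemma ser_supported n a w s : supported n w -> size s != n ->
  (size s < n)%N -> ser iota a w s = 0.
Proof.
move=> wn sn sltn; rewrite /ser big1 // => k _.
by rewrite (supported_iter wn) ?scaler0 // ltn_eqF // (leq_trans sltn) // leq_addl.
Qed.

Lemma ser_supportedD n k a w s : supported n w -> size s = (k + n)%N ->
  ser iota a w s = a k *: iter k i w s.
Proof.
move=> wn sn; have kn : (k < (size s).+1)%N by rewrite ltnS sn leq_addr.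
rewrite /ser (bigD1 (Ordinal kn)) //= big1 ?addr0 // => j jk.
rewrite (supported_iter wn) ?scaler0 //.
apply: contraNneq jk => sj; apply/eqP/val_inj/(@addIn n).
exact: etrans (esym sj) sn.
Qed.

Definition one_cochain (K : V -> F) : C := fun s => if s is [:: e] then K e.1 else 0.
Definition two_cochain (T : V -> V -> F) : C :=
  fun s => if s is [:: e1; e2] then T e1.1 e2.1 else 0.

Lemma supported_cst x : supported 0 (cst x). Proof. by case. Qed.
Lemma supported_one K : supported 1 (one_cochain K).
Proof. by move=> [|? []]. Qed.
Lemma supported_two T : supported 2 (two_cochain T).
Proof. by move=> [|? [|? []]]. Qed.

(** The contraction with one more vector field acts as a derivation on powers of
[iota_c], up to the sign with which it passes the other arguments. *)
Lemma slot_iter e n w : slot e (iter n i w) =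
  (-1) ^+ n *: (iter n i (slot e w) - n%:R *: iter n.-1 i (pw (iota e) w)).
Proof.
have pwi w' : pw (iota e) (i w') = - i (pw (iota e) w').
  pose z (_ : W) : {linear F -> F} := \0.
  have := @ins_anticomm _ _ _ (iota e) iota z w'; rewrite [ins z w']ins0 //.
  move=> E1; apply/eqP; rewrite -addr_eq0; apply/eqP/E1 => X y.
  by rewrite [iota e _]iotaC addNr.
have pwit k w' : pw (iota e) (iter k i w') = (-1) ^+ k *: iter k i (pw (iota e) w').
  elim: k => [|k IH]; first by rewrite scale1r.
  by rewrite !iterS pwi IH linearZ /= exprS mulN1r scaleNr.
elim: n => [|n IH]; first by rewrite scale0r subr0 scale1r.
have E1 : n.+1%:R *: iter n i (pw (iota e) w) =
    iter n i (pw (iota e) w) + n%:R *: i (iter n.-1 i (pw (iota e) w)).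
  case: n {IH} => [|n]; first by rewrite scale0r scale1r addr0.
  by rewrite [n.+2%:R]mulrSr scalerDl scale1r addrC.
rewrite iterS slot_ins IH pwit [i (_ *: _)]linearZ /= [i (_ - _)]linearB /=.
rewrite [i (n%:R *: _)]linearZ /= E1 exprS mulN1r scaleNr.
rewrite !(scalerBr, scalerDr); abel.
Qed.

Definition single_sum (K : V -> F) (Xs : seq V) : F :=
  \sum_(j < size Xs) (-1) ^+ j *: contracts (omit j Xs) (K Xs`_j).

Definition pair_sum (T : V -> V -> F) (Xs : seq V) : F :=
  \sum_(j < size Xs) \sum_(k < j)
    (-1) ^+ (k + j + 1) *: contracts (omit k (omit j Xs)) (T Xs`_k Xs`_j).

Lemma single_sum_cons K X Xs : single_sum K (X :: Xs) =
  contracts Xs (K X) - single_sum (fun Y => contract X (K Y)) Xs.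
Proof.
rewrite /single_sum big_ord_recl /= scale1r {1}/omit /= drop0 -sumrN.
congr (_ + _); apply: eq_bigr => j _ /=.
by rewrite /bump /= add1n exprS mulN1r scaleNr.
Qed.

Lemma pair_sum_cons T X Xs : pair_sum T (X :: Xs) =
  single_sum (T X) Xs + pair_sum (fun Y Z => contract X (T Y Z)) Xs.
Proof.
rewrite /pair_sum big_ord_recl big_ord0 add0r /single_sum -big_split /=.
apply: eq_bigr => j _; rewrite /bump /= add1n big_ord_recl /=; congr (_ + _).
  by rewrite {1}/omit /= drop0 add0n addn1 !exprS !mulN1r opprK.
apply: eq_bigr => k _; rewrite /bump /= add1n.
have -> : (k.+1 + j.+1 + 1 = (k + j + 1).+2)%N by rewrite !addn1 addSn addnS.
by rewrite exprS mulN1r exprS mulN1r opprK.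
Qed.

Lemma binS2 n : 'C(n.+1, 2) = ('C(n, 2) + n)%N.
Proof. by rewrite binS bin1. Qed.

Lemma fact_step n (c : R) : n.+1%:R * (c * n`!%:R) = c * n.+1`!%:R.
Proof. by rewrite factS natrM mulrCA. Qed.

Lemma sign_step n k (c : R) :
  (-1) ^+ n * ((-1) ^+ k * c) = (-1) ^+ (k + n) * c.
Proof. by rewrite mulrA -exprD addnC. Qed.

(** The signs here and below come from reordering [n] odd contractions. *)
Lemma iter_cst n x s : size s = n -> iter n i (cst x) s =
  ((-1) ^+ 'C(n, 2) * n`!%:R) *: contracts (fsts s) x.
Proof.
elim: n s x => [|n IH] [|e s] x //= => [_|[sn]]; first by rewrite mul1r scale1r.
change (slot e (iter n.+1 i (cst x)) s =
  ((-1) ^+ 'C(n.+1, 2) * n.+1`!%:R) *: contracts (fsts s) (contract e.1 x)).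
rewrite slot_iter funZ funB funZ /=.
have -> : slot e (cst x) = 0 by [].
have -> : pw (iota e) (cst x) = cst (contract e.1 x).
  by apply/funext => -[|? ?]; rewrite /pw /= ?linear0.
rewrite -iterS linear0 sub0r IH //; move: (contracts _ _) => A.
rewrite scalerN !scalerA -scaleNr -mulrA fact_step sign_step.
by rewrite addnS -binS2 exprS mulN1r mulNr opprK.
Qed.

Lemma iter_one n K s : size s = n.+1 -> iter n i (one_cochain K) s =
  ((-1) ^+ 'C(n.+1, 2) * n`!%:R) *: single_sum K (fsts s).
Proof.
elim: n s K => [|n IH] [|e s] K //= => [[]|[sn]].
  case: s => // _; rewrite mul1r scale1r /single_sum big_ord_recl big_ord0 addr0.
  by rewrite scale1r.
change (slot e (iter n.+1 i (one_cochain K)) s =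
  ((-1) ^+ 'C(n.+2, 2) * n.+1`!%:R) *: single_sum K (e.1 :: fsts s)).
rewrite slot_iter funZ funB funZ.
have -> : slot e (one_cochain K) = cst (K e.1) by apply/funext => -[|? ?].
have -> : pw (iota e) (one_cochain K) = one_cochain (fun Y => contract e.1 (K Y)).
  by apply/funext => -[|? [|? ?]]; rewrite /pw /= ?linear0.
rewrite iter_cst // IH // single_sum_cons.
move: (contracts _ _) (single_sum _ _) => A B.
rewrite scalerBr !scalerA -mulrA fact_step !sign_step -binS2.
by rewrite -scalerBr.
Qed.

Lemma iter_two n T s : size s = n.+2 -> iter n i (two_cochain T) s =
  ((-1) ^+ 'C(n, 2) * n`!%:R) *: pair_sum T (fsts s).
Proof.
elim: n s T => [|n IH] [|e s] T //= => [[]|[sn]].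
  case: s => [|e2 [|? ?]] // _; rewrite mul1r scale1r /pair_sum.
  rewrite !big_ord_recl !big_ord0 /= !(add0r, addr0) /bump /= /omit /=.
  by rewrite add0n addn0 addn1 expr2 mulrNN mulr1 scale1r.
change (slot e (iter n.+1 i (two_cochain T)) s =
  ((-1) ^+ 'C(n.+1, 2) * n.+1`!%:R) *: pair_sum T (e.1 :: fsts s)).
rewrite slot_iter funZ funB funZ.
have -> : slot e (two_cochain T) = one_cochain (T e.1).
  by apply/funext => -[|? [|? ?]].
have -> : pw (iota e) (two_cochain T) = two_cochain (fun Y Z => contract e.1 (T Y Z)).
  by apply/funext => -[|? [|? [|? ?]]]; rewrite /pw /= ?linear0.
rewrite iter_one // IH // pair_sum_cons.
move: (single_sum _ _) (pair_sum _ _) => A B.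
have Ea : (-1) ^+ ('C(n.+2, 2) + n.+1) = (-1) ^+ 'C(n.+1, 2) :> R.
  by rewrite [in LHS]binS2 -addnA addnn exprD -[X in _ * X]signr_odd odd_double mulr1.
have Eb : (-1) ^+ ('C(n, 2) + n.+1) = - (-1) ^+ 'C(n.+1, 2) :> R.
  by rewrite addnS -binS2 exprS mulN1r.
rewrite scalerBr !scalerA -mulrA fact_step !sign_step Ea Eb mulNr scaleNr opprK.
by rewrite -scalerDr.
Qed.

End ExplicitBrackets.

Section Values.
Context (R : realType) (m : nat) (M : smooth_manifold R m).
Implicit Types (f g : Cinf M) (x y : dform M).

Lemma CinfD f g p : Cinf_val (f + g) p = Cinf_val f p + Cinf_val g p.
Proof. by []. Qed.
Lemma CinfN f p : Cinf_val (- f) p = - Cinf_val f p.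
Proof. by []. Qed.
Lemma CinfZ (k : R) f p : Cinf_val (k *: f) p = k * Cinf_val f p.
Proof. by []. Qed.

Lemma dform_values x y : (forall s p, Cinf_val (x s) p = Cinf_val (y s) p) -> x = y.
Proof. by move=> xy; apply: dform_eq => s; apply/val_inj/funext => p; exact: xy. Qed.

End Values.

(** Linear identities between forms with rational coefficients are checked on
values, in the field of real numbers. *)
Ltac lmodule_field :=
  apply: dform_values => s p;
  rewrite !(dformD, dformN, dformZ) !(CinfD, CinfN, CinfZ); field.

Section BracketFormulas.
Context (R : realType) (m : nat) (M : smooth_manifold R m).
Notation V := (vfield M).
Notation F := (dform M).
Local Notation W := (V * F)%type.
Local Notation C := (seq W -> F).
Implicit Types (e : W) (w : C) (s t u : seq W) (x y : F) (X Y : V).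
Local Notation cst := (@cst_cochain R W F).
Local Notation iota := (@iota R m M).
Local Notation ebr := (@ebr R m M).
Local Notation i := (@ins R W F iota).
Local Notation fsts s := [seq e.1 | e <- s].
Local Notation b := (bser R).
Variable q : nat.

Definition top_part x := x - lower q x.

(** The bracket of a form with two vector fields, for forms of all degrees: the
last term is present only in degree [r - 1]. *)
Definition trinary x X Y : F :=
  trinary_form x X Y + 6^-1 *: contract Y (contract X (extd (top_part x))).

Lemma Lie_c_cst x : Lie_c (cst x) = one_cochain (fun X => - Lie X x).
Proof.
apply/funext => s; rewrite /Lie_c /eps ins_cst; case: s => [|e [|? ?]] /=; rewrite ?scaler0 //.
by rewrite scaleN1r.
Qed.

Lemma iota_cc_cst x : iota_cc (cst x) = two_cochain (fun X Y => 2 *: contract (lie_bracket X Y) x).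
Proof.
apply/funext => s; rewrite /iota_cc funZ /eps bins_cst.
case: s => [|e [|e' [|? ?]]] /=; rewrite ?scaler0 //.
by rewrite expr2 mulrNN mulr1 scale1r.
Qed.

Lemma bracket_op_cst x s : bracket_op q (cst x) s = cst (extd x) s -
  ser iota b (cst (extd (top_part x))) s +
  ser iota (shift b) (one_cochain (fun X => - Lie X x)) s -
  ser iota (shift (shift b)) (two_cochain (fun X Y => 2 *: contract (lie_bracket X Y) x)) s.
Proof.
by rewrite /bracket_op low_cst -linearB /= !d_c_cst Lie_c_cst iota_cc_cst /top_part.
Qed.

Lemma bracket_op_cst0 x : bracket_op q (cst x) [::] = extd (lower q x).
Proof.
rewrite bracket_op_cst (ser_supportedD (k := 0) _ (@supported_cst R m M _)) //.
rewrite (ser_supported _ (@supported_one R m M _)) //.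
rewrite (ser_supported _ (@supported_two R m M _)) //.
by rewrite addr0 subr0 /= bser0 scale1r -linearB /= /top_part opprB addrCA subrr addr0.
Qed.

Lemma bracket_op_cst1 x e : bracket_op q (cst x) [:: e] =
  - (2^-1 *: (Lie e.1 x + contract e.1 (extd (top_part x)))).
Proof.
rewrite bracket_op_cst (ser_supportedD (k := 1) _ (@supported_cst R m M _)) //.
rewrite (ser_supportedD (k := 0) _ (@supported_one R m M _)) //.
rewrite (ser_supported _ (@supported_two R m M _)) //.
rewrite subr0 add0r /shift bser1 /= subr0 scalerN -opprD -scalerDr.
by rewrite [in RHS]addrC.
Qed.

Lemma trinaryE x X Y : 12 *: trinary x X Y =
  - (contract X (Lie Y x) - contract Y (Lie X x)) - 2 *: contract (lie_bracket X Y) x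
  + 2 *: contract Y (contract X (extd (top_part x))).
Proof.
rewrite /trinary /trinary_form scalerDr !scalerA.
have -> : 12 * 6^-1 = 2 :> R by field.
have -> : 12 * - 6^-1 = - 2 :> R by field.
congr (_ + _); rewrite scalerDr scalerA.
have -> : - 2 / 2 = -1 :> R by field.
by rewrite scaleN1r scaleNr.
Qed.

(** The shifts of [b] give the three series the same coefficient, so that they
combine to a power of [iota_c] applied to one 2-cochain, which is twelve times
the trinary bracket. *)
Lemma bracket_op_cstSS x s n : size s = n.+2 -> bracket_op q (cst x) s =
  (12 * b n.+2 * (-1) ^+ 'C(n, 2) * n`!%:R) *: pair_sum (trinary x) (fsts s).
Proof.
move=> sn; rewrite bracket_op_cst.
have -> : cst (extd x) s = 0 by case: s sn.
rewrite (ser_supportedD (k := n.+2) _ (@supported_cst R m M _)) ?addn0 //.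
rewrite (ser_supportedD (k := n.+1) _ (@supported_one R m M _)) ?addn1 //.
rewrite (ser_supportedD (k := n) _ (@supported_two R m M _)) ?addn2 //.
(* the terms of the trinary bracket, as cochains with two arguments *)
have E2 : - i (i (cst (extd (top_part x)))) + i (one_cochain (fun X => - Lie X x)) -
    two_cochain (fun X Y => 2 *: contract (lie_bracket X Y) x) =
  12 *: two_cochain (trinary x).
  apply/funext => u; rewrite funB funD funN funZ.
  have [u2|u2] := eqVneq (size u) 2%N; last first.
    rewrite (supported_ins (supported_ins (@supported_cst R m M _))) // oppr0 add0r.
    rewrite (supported_ins (@supported_one R m M _)) // add0r.
    by rewrite !supported_two // oppr0 scaler0.
  rewrite -[i (i _)]/(iter 2 i _) -[i (one_cochain _)]/(iter 1 i _).
  rewrite (@iter_cst R m M 2) // (@iter_one R m M 1) //.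
  case: u u2 => [|e1 [|e2 [|? ?]]] // _; rewrite [two_cochain _ _]/= [X in 12 *: X]/=.
  rewrite trinaryE /= !single_sum_cons /single_sum big_ord0 /=.
  rewrite !linearN subr0 (_ : 2`! = 2%N) // (_ : 1`! = 1%N) // binn expr1 mulr1.
  rewrite scaleN1r mulN1r scaleNr; abel.
have E3 : iter n i (12 *: two_cochain (trinary x)) s =
  - iter n.+2 i (cst (extd (top_part x))) s + iter n.+1 i (one_cochain (fun X => - Lie X x)) s -
  iter n i (two_cochain (fun X Y => 2 *: contract (lie_bracket X Y) x)) s.
  have itD w w' : iter n i (w + w') = iter n i w + iter n i w' by exact: linearD.
  have itN w : iter n i (- w) = - iter n i w by exact: linearN.
  by rewrite -E2 !itD !itN !iterSr.
rewrite /shift sub0r -!scalerN -!scalerDr -E3.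
have itZ k w : iter n i (k *: w) = k *: iter n i w by exact: linearZ.
rewrite itZ funZ iter_two //; move: (pair_sum _ _) => A.
by rewrite !scalerA; congr (_ *: _); ring.
Qed.

Lemma sign_bin2 n : ~~ odd n -> (-1) ^+ 'C(n, 2) = (-1) ^+ n./2 :> R.
Proof.
move=> n_even; rewrite -{1}(odd_double_half n) (negbTE n_even) add0n.
elim: (n./2) => // k IH; rewrite doubleS !binS2 -addnA addnS addnn exprD IH.
by rewrite exprS exprS -[(-1) ^+ k.*2.*2]signr_odd odd_double expr0 mulr1 mulrC.
Qed.

Lemma bracket_op_cst_nary x s n : size s = n.+2 -> ~~ odd n ->
  bracket_op q (cst x) s = nary_from_trinary (trinary x) (fsts s).
Proof.
move=> sn n_even; rewrite (bracket_op_cstSS _ sn) /nary_from_trinary.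
rewrite size_map sn -/(pair_sum _ _); congr (_ *: _).
  rewrite !subSS !subn0 /bser sign_bin2 // [n.+4./2]/= [n.+2`!]factS [n.+1`!]factS.
  rewrite ![(_ * _)%:R]natrM exprS exprS -[(-1) ^+ n]signr_odd (negbTE n_even) expr0.
  rewrite [(-1) ^+ _.+2]exprS [(-1) ^+ _.+1]exprS.
  have n1 : n.+1%:R != 0 :> R by rewrite pnatr_eq0.
  have n2 : n.+2%:R != 0 :> R by rewrite pnatr_eq0.
  move: (factS_neq0 R n) n1 n2; move: (n`!%:R) (n.+1%:R) (n.+2%:R) => u v w u0 v0 w0.
  by field; rewrite u0 v0 w0.
by rewrite /pair_sum size_map sn.
Qed.

Lemma bracket_op_cst_odd x s n : size s = n.+2 -> odd n -> bracket_op q (cst x) s = 0.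
Proof.
move=> sn n_odd; rewrite (bracket_op_cstSS _ sn) /bser bernoulli_odd //=; last by rewrite negbK.
by rewrite mulr0 mul0r mulr0 !mul0r scale0r.
Qed.

Lemma top_low k x : Omega k x -> (k < q)%N -> top_part x = 0.
Proof. by move=> xk kq; rewrite /top_part (lower_Omega _ xk) kq subrr. Qed.

Lemma top_top x : Omega q x -> top_part x = x.
Proof. by move=> xq; rewrite /top_part (lower_Omega _ xq) ltnn subr0. Qed.

Lemma trinary_low k x : Omega k x -> (k < q)%N -> trinary x =2 trinary_form x.
Proof.
by move=> xk kq X Y; rewrite /trinary (top_low xk) // !linear0 addr0.
Qed.

Lemma Lie0l x : Lie (0 : V) x = 0.
Proof. by rewrite Cartan !contract0l linear0 addr0. Qed.

(** By Cartan's formula the terms [d iota_X] of the Courant bracket become Lie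
derivatives and the contraction of [dx]. *)
Lemma trinary_top x X Y : Omega q x ->
  trinary x X Y = trinary_sections (0, x) (X, 0) (Y, 0).
Proof.
move=> xq; rewrite /trinary top_top // /trinary_sections /trinary_form /pairing /courant /=.
rewrite !lie_bracket0l !lie_bracket0r !contract0l !Lie0l !linear0.
rewrite !(add0r, addr0, subr0, sub0r, oppr0, linear0).
have cD Z y z : contract Z (y + z) = contract Z y + contract Z z by exact: linearD.
have cN Z y : contract Z (- y) = - contract Z y by exact: linearN.
have cZ (k : R) Z y : contract Z (k *: y) = k *: contract Z y by exact: linearZ.
have dN y : extd (- y) = - extd y by exact: linearN.
rewrite !(dN, cD, cN, cZ).
have dE Z Z' : contract Z' (extd (contract Z x)) =
    contract Z' (Lie Z x) - contract Z' (contract Z (extd x)).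
  by rewrite [in RHS]Cartan [contract Z' (_ + _)]linearD /= addrC addKr.
rewrite !dE.
rewrite (contractC X Y (extd x)).
move: (contract X (Lie Y x)) (contract Y (Lie X x)) => u v.
move: (contract Y _) (contract _ x) => y z.
by lmodule_field.
Qed.

End BracketFormulas.

(** * The brackets as sums over the position of the form *)

Section BracketEntries.
Context (R : realType) (m : nat) (M : smooth_manifold R m).
Notation V := (vfield M).
Notation F := (dform M).
Local Notation W := (V * F)%type.
Local Notation C := (seq W -> F).
Implicit Types (e : W) (w : C) (s t u : seq W) (x y : F) (X Y : V).
Local Notation cst := (@cst_cochain R W F).
Local Notation iota := (@iota R m M).
Local Notation fsts s := [seq e.1 | e <- s].
Local Notation b := (bser R).
Variables (q : nat) (H : F).
Local Notation bracket := (bracket q H).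

Lemma shuffle_sum_single (Phi : W -> seq W -> F) s :
  shuffle_sum (fun b a => if a is [:: e] then Phi e b else 0) s =
  \sum_(j < size s) (-1) ^+ (size s).-1 *: ((-1) ^+ j *: Phi s`_j (omit j s)).
Proof.
elim: s Phi => [|e s IH] Phi /=; first by rewrite big_ord0.
rewrite big_ord_recl /= scale1r {1}/omit /= drop0 addrC.
congr (_ + _).
  rewrite -(shuffle_sum_nil_r (fun b => (-1) ^+ size b *: Phi e b)).
  by apply: eq_shuffle_sum => c [|? [|? ?]] _ //=; rewrite scaler0.
rewrite (IH (fun e' b' => Phi e' (e :: b'))); apply: eq_bigr => j _.
rewrite /bump /= add1n; case: (size s) j => [[]//|n] j /=.
by rewrite /omit /= !exprS !mulN1r !scaleNr scalerN opprK.
Qed.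

(** Moving the form entry to the front of a list of entries of degree zero costs
the sign [(-1)^j]. *)
Lemma bracket2E s : (bracket s).2 =
  \sum_(j < size s) (-1) ^+ j *: bracket_op q (cst (lower q.+1 (s`_j).2)) (omit j s) +
  (-1) ^+ size s *: twist H s.
Proof.
rewrite /bracket /= form_partE scalerDr; congr (_ + _).
rewrite (@eq_shuffle_sum _ _ _ _ (fun b' a' => if a' is [:: e] then
   - bracket_op q (cst (lower q.+1 e.2)) b' else 0)).
  rewrite (shuffle_sum_single (fun e b' => - bracket_op q (cst (lower q.+1 e.2)) b')) scaler_sumr.
  apply: eq_bigr => j _; case: (size s) j => [[]//|n] j /=.
  have sE : - ((-1) ^+ n.+1 * (-1) ^+ n * (-1) ^+ j) = (-1) ^+ j :> R.
    by rewrite exprS mulN1r !mulNr opprK -exprMn mulrNN mulr1 expr1n mul1r.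
  by rewrite !scalerN 2!scalerA -scaleNr sE.
move=> b' [|e [|? ?]] _ /=; rewrite ?bracket_op0 ?scaler0 //.
by rewrite scaleN1r.
Qed.

Lemma twistE s : (-1) ^+ size s *: twist H s =
  ((-1) ^+ (size s).+1 * twist_ser R (size s) * (-1) ^+ 'C(size s, 2) * (size s)`!%:R) *:
  contracts (fsts s) H.
Proof.
rewrite /twist funN (ser_supportedD (k := size s) _ (@supported_cst R m M _)) ?addn0 //.
rewrite iter_cst // scalerN !scalerA -scaleNr exprS mulN1r; congr (_ *: _); ring.
Qed.

Lemma twist1 e : twist H [:: e] = 0.
Proof.
have := twistE [:: e]; rewrite /= mulr0 !mul0r scale0r => /eqP.
by rewrite scaler_eq0 expr1 oppr_eq0 oner_eq0 => /eqP.
Qed.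

Lemma twist2 e1 e2 : (-1) ^+ 2 *: twist H [:: e1; e2] = contracts [:: e1.1; e2.1] H.
Proof.
rewrite (twistE [:: e1; e2]) [size _]/= [twist_ser _ _]/= bser1 binn.
rewrite (_ : 2`! = 2%N) // expr1 !exprS expr0.
rewrite -[RHS]scale1r; congr (_ *: _); by field.
Qed.

(** The factor [n] is [n! / (n - 1)!], and the sign that of reordering [n]
contractions. *)
Lemma twist_odd s : (3 <= size s)%N -> odd (size s) ->
  (-1) ^+ size s *: twist H s = nary_twist H (fsts s).
Proof.
rewrite twistE /nary_twist size_map; case: (size s) => [|[|[|n]]] // _.
rewrite /= !negbK => n_even; congr (_ *: _); rewrite !subSS subn0 /bser.
have -> : (-1) ^+ 'C(n.+3, 2) = - (-1) ^+ n./2 :> R.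
  rewrite !binS2 !exprD sign_bin2 // [(-1) ^+ n.+2]exprS [(-1) ^+ n.+1]exprS.
  by rewrite -[(-1) ^+ n]signr_odd (negbTE n_even) expr0; ring.
rewrite [n.+3`!]factS [X in _ * X = _]natrM.
rewrite [(-1) ^+ n.+4]exprS [(-1) ^+ n.+3]exprS [(-1) ^+ n.+2]exprS [(-1) ^+ n.+1]exprS.
rewrite -[(-1) ^+ n]signr_odd (negbTE n_even) expr0 [(-1) ^+ (n./2).+1]exprS.
move: (factS_neq0 R n.+2); move: (n.+2`!%:R) (n.+3%:R) => u v u0.
by field; rewrite u0.
Qed.

Lemma twist_even s : (3 <= size s)%N -> ~~ odd (size s) ->
  (-1) ^+ size s *: twist H s = 0.
Proof.
rewrite twistE; case: (size s) => [|[|[|n]]] // _; rewrite /= !negbK => n_odd.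
by rewrite /bser bernoulli_odd ?mulr0 ?mul0r ?mulr0 ?mul0r ?scale0r //= negbK.
Qed.

(** The entries of negative degree are of this kind. *)
Definition pure_form (e : W) : bool := e.1 == 0.

Lemma horizontal_has w s :
  horizontal w -> has pure_form s -> w s = 0.
Proof.
elim: s w => //= e s IH w wh /orP[/eqP e0|hs]; first exact: (wh [::]).
by apply: (IH (slot e w)) => // s' t' e' e'0; exact: (wh (e :: s')).
Qed.

Lemma has_omit s j : (1 < count pure_form s)%N ->
  has pure_form (omit j s).
Proof.
rewrite has_count /omit -{1}(cat_take_drop j s) !count_cat.
case: (ltnP j (size s)) => js; last by rewrite !drop_oversize ?leqW //=; exact: ltnW.
rewrite (drop_nth 0 js) /= addnCA; case: (pure_form _); rewrite ?add0n => //.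
exact: ltnW.
Qed.

Lemma vpart0 s : has pure_form s -> vpart s = 0.
Proof.
case: s => [|e1 [|e2 [|? ?]]] //=; rewrite orbF => /orP[] /eqP ->.
  exact: lie_bracket0l.
exact: lie_bracket0r.
Qed.

(** Only one entry can provide the form, so that another pure form has to be
contracted as a vector field. *)
Lemma bracket_vanish s : (1 < count pure_form s)%N -> bracket s = 0.
Proof.
move=> s2; have hs : has pure_form s by rewrite has_count ltnW.
have E1 : (bracket s).1 = 0 by exact: vpart0.
have E2 : (bracket s).2 = 0.
  rewrite bracket2E (horizontal_has (@horizontal_twist _ _ _ _) hs) scaler0 addr0.
  rewrite big1 // => j _.
  by rewrite (horizontal_has (@horizontal_bracket_op_cst _ _ _ _ _)) ?scaler0 ?has_omit.
by rewrite [bracket s]surjective_pairing E1 E2.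
Qed.

End BracketEntries.

(** * Shuffle permutations *)

Section ShufflePermutations.
Context (R : realType) (W N : lmodType R).
Implicit Types (s t : seq W) (Psi : seq W -> seq W -> N).

Lemma size_permute s (p : 'S_(size s)) : size (permute p) = size s.
Proof. by rewrite size_map size_enum_ord. Qed.

Lemma nth_permute s (p : 'S_(size s)) j (js : (j < size s)%N) :
  (permute p)`_j = s`_(p (Ordinal js)).
Proof.
rewrite /permute (nth_map (Ordinal js)) ?size_enum_ord //.
by congr (s`_(p _)); apply/val_inj; rewrite /= nth_enum_ord.
Qed.

(** A permutation of the longer list is given by the position [k] of its head and
a permutation of the tail. *)
Lemma permute_lift e s (k : 'I_(size s).+1) (p : 'S_(size s)) :
  @permute R W (e :: s) (lift_perm k ord0 p) =
  take k (permute p) ++ e :: drop k (permute p).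
Proof.
have kP : (k <= size (permute p))%N by rewrite size_permute -ltnS.
apply: (@eq_from_nth _ 0) => [|j].
  by rewrite size_permute size_cat size_takel //= size_drop addnS subnKC // size_permute.
rewrite size_permute => js; rewrite (nth_permute _ js) nth_cat size_takel //.
case: (unliftP k (Ordinal js)) => [a|] jE.
  rewrite jE lift_perm_lift /=.
  have -> : j = bump k a by have := congr1 val jE.
  have aE : s`_(p a) = (permute p)`_a.
    by rewrite (nth_permute _ (ltn_ord a)); congr (s`_(p _)); apply/val_inj.
  rewrite aE /bump; case: (leqP k a) => ka /=.
    by rewrite add1n ltnNge leqW //= subSn //= nth_drop subnKC.
  by rewrite add0n ka nth_take.
rewrite jE lift_perm_id /=; have -> : j = k by have := congr1 val jE.
by rewrite ltnn subnn.
Qed.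

(** In a shuffle the smallest index comes first in its block, so that it has
position [0] or [i]. *)
Lemma shuffle_lift n i (k : 'I_n.+1) (p : 'S_n) : (i <= n.+1)%N ->
  shuffle i (lift_perm k ord0 p) =
  if (0 < i)%N && (k == ord0) then shuffle i.-1 p else (k == i :> nat) && shuffle i p.
Proof.
move=> i_le; apply/idP/idP => [/forallP shuf_i|].
  have shuffle_sumE (a c : 'I_n.+1) : (a < c)%N -> (c < i)%N || (i <= a)%N ->
      (lift_perm k ord0 p a < lift_perm k ord0 p c)%N.
    move=> ac bl; have /forallP/(_ c)/implyP := shuf_i a; apply.
    by rewrite ac.
  have shuffle_sumL (a c : 'I_n) : (a < c)%N ->
      (lift k c < i)%N || (i <= lift k a)%N -> (p a < p c)%N.
    move=> ac bl; have := shuffle_sumE (lift k a) (lift k c).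
    rewrite !lift_perm_lift !lift0 ltnS; apply=> //.
    by rewrite /= ltnNge leq_bump2 -ltnNge.
  case: ifPn => [/andP[i_gt0 /eqP k0]|].
    apply/forallP => a; apply/forallP => c; apply/implyP => /andP[ac bl].
    apply: shuffle_sumL => //; rewrite k0 !lift0; by case: i i_gt0 bl {i_le shuf_i shuffle_sumE}.
  move=> nk; have ki : k = i :> nat.
    case: (posnP k) => [k0|k_gt0].
      move: nk; rewrite -(inj_eq val_inj) /= k0 eqxx andbT -leqNgt leqn0 => /eqP ->.
      by [].
    have k1 : (k.-1 < n.+1)%N by rewrite prednK // ltnW.
    have := shuffle_sumE (Ordinal k1) k; rewrite lift_perm_id ltn0 /= ltn_predL k_gt0.
    move=> /(_ isT)/contraFF/(_ (erefl _))/negbT; rewrite negb_or -leqNgt -ltnNge.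
    by rewrite prednK // => /andP[? ?]; apply/eqP; rewrite eqn_leq; apply/andP.
  rewrite ki eqxx /=; apply/forallP => a; apply/forallP => c; apply/implyP => /andP[ac bl].
  apply: shuffle_sumL => //; rewrite /= /bump ki.
  case/orP: bl => [ci|ia]; first by rewrite [(i <= c)%N]leqNgt ci add0n ci.
  by rewrite ia add1n leqW // orbT.
move=> shuf_p; apply/forallP => a; apply/forallP => c; apply/implyP => /andP[ac bl].
have ck : c != k.
  apply/negP => /eqP ck; move: shuf_p; case: ifPn => [/andP[_ /eqP k0]|_ /andP[/eqP ki _]].
    by move: ac; rewrite ck k0 ltn0.
  by move: bl; rewrite ck ki ltnn /= leqNgt -ki -ck ac.
case: (unliftP k c) ck => [c' cE|->]; last by rewrite eqxx.
rewrite {}cE in ac bl *; rewrite lift_perm_lift => _.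
case: (unliftP k a) ac bl => [a' ->|-> _ _]; last by rewrite lift_perm_id.
rewrite lift_perm_lift !lift0 ltnS => ac bl.
have ac' : (a' < c')%N by move: ac; rewrite /= ltnNge leq_bump2 -ltnNge.
move: shuf_p; case: ifPn => [/andP[i_gt0 /eqP k0]|_ /andP[/eqP ki]].
  move=> /forallP/(_ a')/forallP/(_ c')/implyP; apply; rewrite ac' /=.
  by move: bl; rewrite k0 !lift0; case: i i_gt0 {i_le}.
move=> /forallP/(_ a')/forallP/(_ c')/implyP; apply; rewrite ac' /=.
move: bl; rewrite /= /bump ki; case: (leqP i c') => ic; case: (leqP i a') => ia;
  rewrite ?add1n ?add0n ?orbT //.
  by rewrite ltnNge leqW //= leqNgt ia.
Qed.

(** As in the Laplace expansion of a determinant. *)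
Lemma sum_lift_perm n (P : pred 'S_n.+1) (G : 'S_n.+1 -> N) :
  \sum_(p | P p) G p =
  \sum_k \sum_(p | P (lift_perm k ord0 p)) G (lift_perm k ord0 p).
Proof.
rewrite (partition_big (fun p : 'S_n.+1 => (p^-1)%g ord0) xpredT) //=.
apply: eq_bigr => k _; rewrite (reindex (lift_perm k ord0)); last first.
  pose ulsf j (p : 'S_n.+1) l := odflt l (unlift (p j) (p (lift j l))).
  have ulsfK j (p : 'S_n.+1) l : lift (p j) (ulsf j p l) = p (lift j l).
    rewrite /ulsf; have:= neq_lift j l.
    by rewrite -(can_eq (permK p)) => /unlift_some[] ? ? ->.
  have inj_ulsf : injective (ulsf k _).
    move=> p; apply: can_inj (ulsf (p k) p^-1%g) _ => l.
    by rewrite {1}/ulsf ulsfK !permK liftK.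
  exists (fun p => perm (inj_ulsf p)) => [p _ | p].
    by apply/permP=> l; rewrite permE /ulsf lift_perm_lift lift_perm_id liftK.
  rewrite inE => /andP[_ /eqP pk0]; have {}pk0 : p k = ord0 by rewrite -pk0 permKV.
  apply/permP => l; case: (unliftP k l) => [l'|] ->; rewrite ?lift_perm_id //.
  by rewrite lift_perm_lift -pk0 permE ulsfK.
apply: eq_bigl => p; rewrite lift_permV lift_perm_id eqxx andbT.
by [].
Qed.

Definition split_term Psi s i (p : 'S_(size s)) : N :=
  (-1) ^+ p *: Psi (take i (permute p)) (drop i (permute p)).

(** The two terms are those of the recursion of [shuffle_sum]; for [i = 0] both
positions of the head coincide and only the second one counts. *)
Lemma sum_shuffles_lift Psi e s i : (i < (size s).+2)%N ->
  \sum_(p : 'S_(size s).+1 | shuffle i p) @split_term Psi (e :: s) i p =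
  (if (0 < i)%N then \sum_(p | shuffle i.-1 p)
     @split_term (fun a b => Psi (e :: a) b) s i.-1 p else 0) +
  (if (i <= size s)%N then \sum_(p | shuffle i p)
     @split_term (fun a b => (-1) ^+ size a *: Psi a (e :: b)) s i p else 0).
Proof.
move=> i_le.
pose G k (p : 'S_(size s)) := @split_term Psi (e :: s) i (lift_perm k ord0 p).
have termE (k : 'I_(size s).+1) p : G k p = (-1) ^+ k *: ((-1) ^+ p *:
    Psi (take i (take k (permute p) ++ e :: drop k (permute p)))
        (drop i (take k (permute p) ++ e :: drop k (permute p)))).
  rewrite /G /split_term permute_lift odd_lift_perm /= addbF.
  by rewrite signr_addb signr_odd scalerA.
rewrite sum_lift_perm -[LHS]/(\sum_(k < (size s).+1)
  \sum_(p | shuffle i (lift_perm k ord0 p)) G k p).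
have headE p : (0 < i)%N -> G ord0 p = @split_term (fun a b => Psi (e :: a) b) s i.-1 p.
  by move=> i_gt0; rewrite termE scale1r take0 drop0 /=; case: (i) i_gt0.
have insE (k : 'I_(size s).+1) p : k = i :> nat ->
    G k p = @split_term (fun a b => (-1) ^+ size a *: Psi a (e :: b)) s i p.
  move=> ki; rewrite termE ki /split_term.
  have iP : size (take i (permute p)) = i.
    by rewrite size_takel // size_permute -ltnS -ki.
  rewrite take_cat drop_cat iP ltnn subnn take0 drop0 cats0 !scalerA.
  by rewrite mulrC.
under eq_bigr => k _ do under eq_bigl => p do rewrite shuffle_lift //.
case: i i_le @G termE headE insE => [|i] i_le G termE headE insE.
  rewrite add0r big_ord_recl /= [X in _ + X]big1 ?addr0 => [|k _]; last first.
    by rewrite big_pred0 // => p; rewrite /bump.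
  by apply: eq_bigr => p _; rewrite insE.
rewrite big_ord_recl /=; congr (_ + _).
  by apply: eq_bigr => p _; rewrite headE.
case: ifPn => [i_lt|]; last first.
  rewrite -leqNgt => i_ge; rewrite big1 // => k _; rewrite big_pred0 // => p.
  rewrite /= /bump add1n eqSS; case: eqP => // ki.
  by move: (ltn_ord k); rewrite ki ltnNge i_ge.
rewrite (bigD1 (Ordinal i_lt)) //= [X in _ + X]big1 ?addr0 => [|k ki]; last first.
  rewrite big_pred0 // => p; rewrite /= /bump add1n eqSS.
  by move: ki; rewrite -(inj_eq val_inj) /= => /negbTE ->.
apply: eq_big => p; first by rewrite /= /bump add1n eqxx.
by move=> _; apply: insE.
Qed.

Lemma sum_shufflesE Psi s :
  \sum_(i < (size s).+1) \sum_(p : 'S_(size s) | shuffle i p) @split_term Psi s i p =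
  shuffle_sum Psi s.
Proof.
elim: s Psi => [|e s IH] Psi.
  rewrite big_ord_recl big_ord0 addr0 /=.
  have pE (p : 'S_(size (@nil W))) : p = 1%g by apply/permP => -[].
  rewrite (big_pred1 (1%g : 'S_(size (@nil W)))) => [|p]; last first.
    by rewrite /= [p]pE eqxx; apply/forallP => -[].
  rewrite /split_term odd_perm1 expr0 scale1r.
  by rewrite (size0nil (size_permute (1%g : 'S_(size (@nil W))))).
rewrite [size (_ :: _)]/=.
under eq_bigr => i _ do rewrite sum_shuffles_lift //.
rewrite big_split /=; congr (_ + _).
  by rewrite big_ord_recl /= add0r -IH; apply: eq_bigr.
rewrite big_ord_recr /= ltnn addr0 -IH; apply: eq_bigr => i _.
by rewrite -ltnS ltn_ord.
Qed.

End ShufflePermutations.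

(** * Degrees *)

Section Degrees.
Context (R : realType) (m : nat) (M : smooth_manifold R m).
Notation V := (vfield M).
Notation F := (dform M).
Local Notation W := (V * F)%type.
Local Notation C := (seq W -> F).
Implicit Types (e : W) (w : C) (s t : seq W) (u : seq V) (x y : F) (X Y : V).
Local Notation cst := (@cst_cochain R W F).
Local Notation iota := (@iota R m M).
Local Notation i := (@ins R W F iota).

Lemma Omega_lower k x : Omega k x <-> lower k.+1 x = x /\ lower k x = 0.
Proof.
split=> [xk|[x1 x0] u uk].
  by rewrite !(lower_Omega _ xk) ltnSn ltnn.
have := congr1 (fun y : F => y u) x1; have := congr1 (fun y : F => y u) x0.
rewrite !lowerE ltnS [(size u <= k)%N]leq_eqVlt (negbTE uk) /=.
by case: ltnP => // _ _ <-.
Qed.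

Lemma extd_Omega k x : Omega k x -> Omega k.+1 (extd x).
Proof.
move=> /Omega_lower[x1 x0]; apply/Omega_lower.
by rewrite !lower_extd x1 x0 linear0.
Qed.

(** The total number of arguments of the form and of the cochain is a grading,
preserved by contractions and raised by [d]. *)
Definition weight n w := forall s u, (size u + size s)%N != n -> w s u = 0.

Lemma weight_zero n w s : weight n w -> (n < size s)%N -> w s = 0.
Proof.
move=> wn ns; apply: dform_eq => u; apply: wn.
by rewrite gtn_eqF // ltn_addl.
Qed.

Lemma weight_Omega n w s : weight n w -> (size s <= n)%N -> Omega (n - size s) (w s).
Proof.
move=> wn ns u un; apply: wn; apply: contraNneq un => <-.
by rewrite addnK.
Qed.

Lemma weight_lin n (k : R) w w' : weight n w -> weight n w' -> weight n (k *: w + w').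
Proof.
move=> wn wn' s u su; rewrite funD funZ dformD dformZ wn // wn' //.
by rewrite scaler0 addr0.
Qed.

Lemma weightD n w w' : weight n w -> weight n w' -> weight n (w + w').
Proof. by move=> wn wn'; rewrite -[w]scale1r; apply: weight_lin. Qed.

Lemma weightN n w : weight n w -> weight n (- w).
Proof.
move=> wn; rewrite -scaleN1r -[X in weight n X]addr0; by apply: weight_lin.
Qed.

Lemma weight_eps n w : weight n w -> weight n (eps w).
Proof. by move=> wn s u su; rewrite /eps dformZ wn // scaler0. Qed.

Lemma weight_ins n w : weight n w -> weight n (i w).
Proof.
move=> wn s u; elim: s w n wn => [|e s IH] w n wn su //.
change (w s (e.1 :: u) - i (slot e w) s u = 0).
rewrite wn /=; last by rewrite addSn -addnS.
case: n wn su => [|n] wn su.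
  have -> : slot e w = 0.
    by apply/funext => t; apply: dform_eq => v; apply: wn; rewrite /= addnS.
  by rewrite linear0 subr0.
rewrite (IH _ n) ?subr0 //; last by move: su; rewrite /= addnS eqSS.
by move=> t v tv; apply: wn; rewrite /= addnS eqSS.
Qed.

Lemma weight_ser n a w : weight n w -> weight n (ser iota a w).
Proof.
move=> wn; have lin := @weight_lin n; have in_ := @weight_ins n.
move=> s u su.
have [w' wn' ->] := ser_bounded_lengths a lin in_ wn (size s); first exact: wn'.
by [].
Qed.

Lemma weight_low n k w : weight n w -> weight n (low k w).
Proof. by move=> wn s u su; rewrite /low /pw lowerE wn // if_same. Qed.

Lemma weight_d_c n w : weight n w -> weight n.+1 (d_c w).
Proof.
move=> wn; apply: weight_eps => s u su; rewrite /pw.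
case: (leqP (size s) n) => sn; last by rewrite (weight_zero wn) // linear0.
apply: (extd_Omega (weight_Omega wn sn)); apply: contraNneq su => ->.
by rewrite addSn subnK.
Qed.

Lemma weight_Lie_c n w : weight n w -> weight n.+1 (Lie_c w).
Proof.
move=> wn; have -> : Lie_c w = d_c (iota_c w) - iota_c (d_c w) by rewrite d_c_iota_c addrC addKr.
apply: weightD; first by apply/weight_d_c/weight_ins.
by apply/weightN/weight_ins/weight_d_c.
Qed.

Lemma weight_iota_cc n w : weight n w -> weight n.+1 (iota_cc w).
Proof.
move=> wn; have -> : iota_cc w = Lie_c (iota_c w) - iota_c (Lie_c w)
  by rewrite Lie_c_iota_c addrC addKr.
apply: weightD; first by apply/weight_Lie_c/weight_ins.
by apply/weightN/weight_ins/weight_Lie_c.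
Qed.

Lemma weight_bracket_op q n w : weight n w -> weight n.+1 (bracket_op q w).
Proof.
move=> wn; rewrite /bracket_op; apply: weightD; last by apply/weightN/weight_ser/weight_iota_cc.
apply: weightD; last by apply/weight_ser/weight_Lie_c.
apply: weightD; first exact: weight_d_c.
by apply/weightN/weight_ser/weight_d_c/weightD => //; apply/weightN/weight_low.
Qed.

Lemma weight_cst k x : Omega k x -> weight k (cst x).
Proof. by move=> xk [|e s] u //= uk; apply: xk; rewrite addn0 in uk. Qed.

Lemma weight_twist k H : Omega k H -> weight k (@twist R m M H).
Proof. by move=> Hk; apply/weightN/weight_ser/weight_cst. Qed.

End Degrees.

Section Homogeneous.
Context (R : realType) (m : nat) (M : smooth_manifold R m) (q : nat).
Notation V := (vfield M).
Notation F := (dform M).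
Local Notation W := (V * F)%type.
Implicit Types (e : W) (s t : seq W) (u : seq V) (x y : F) (ds : seq int).
Local Notation E := (@Ecomplex R m M q.+2).

(** The shift puts the forms of degree [q + 1] next to the vector fields. *)
Definition form_in (d : int) (x : F) :=
  forall u, (size u)%:Z != d + q.+1%:Z -> x u = 0.

(** A uniform description of the components, including those that vanish. *)
Lemma EcomplexP d e : E d e <->
  [/\ d != 0 -> e.1 = 0, form_in d e.2 & (0 < d)%R -> e.2 = 0].
Proof.
rewrite /Ecomplex; case: eqP => [->|/eqP d0].
  split=> [eq|[_ eq _]].
    by split=> // u; rewrite add0r eqz_nat => uq; exact: eq.
  by move=> u uq; apply: eq; rewrite add0r eqz_nat.
split=> [[->|[k [kq dk e1 ek]]]|[e1 ed dpos]].
- by split.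
- have dkq : d + q.+1%:Z = k%:Z by rewrite dk; lia.
  split=> // [u|dpos]; first by rewrite dkq eqz_nat => uk; exact: ek.
  by move: kq dpos; rewrite dk subSS subSS subn0; lia.
- have [dq|dq] := leP 0 (d + q.+1%:Z); last first.
    left; rewrite [e]surjective_pairing e1 //; congr (_, _).
    apply: dform_eq => u; apply: ed; lia.
  have [d_pos|d_le] := ltP 0 d.
    by left; rewrite [e]surjective_pairing e1 // dpos.
  right; exists (absz (d + q.+1%:Z)); split; [lia|lia|exact: e1|].
  by move=> u uk; apply: ed; apply: contraNneq uk => uE; lia.
Qed.

End Homogeneous.

(** * The Lie algebra up to homotopy *)

Section LieAlgebra.
Context (R : realType) (m : nat) (M : smooth_manifold R m) (q : nat) (H : dform M).
Hypotheses (H_deg : Omega q.+3 H) (H_closed : extd H = 0).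
Notation V := (vfield M).
Notation F := (dform M).
Local Notation W := (V * F)%type.
Implicit Types (e : W) (s t : seq W) (u : seq V) (x y : F) (ds : seq int).
Local Notation cst := (@cst_cochain R W F).
Local Notation E := (@Ecomplex R m M q.+2).
Local Notation form_part := (form_part q.+1 H).
Local Notation bracket := (bracket q.+1 H).

Lemma Ecomplex_graded : graded_space E.
Proof.
split=> [d|d a x y|I x uI Ex].
- by apply/EcomplexP; split=> // u _.
- move=> /EcomplexP[x1 x2 x3] /EcomplexP[y1 y2 y3]; apply/EcomplexP.
  split=> [d0|u ud|d0].
  + by change (a *: x.1 + y.1 = 0); rewrite x1 // y1 // scaler0 addr0.
  + by change (a *: x.2 u + y.2 u = 0); rewrite x2 // y2 // scaler0 addr0.
  + by change (a *: x.2 + y.2 = 0); rewrite x3 // y3 // scaler0 addr0.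
- move=> sum0 d dI.
  have fstE : (\sum_(j <- I) x j).1 = \sum_(j <- I) (x j).1.
    by elim: (I) => [|j J IH]; rewrite ?big_nil // !big_cons /= IH.
  have sndE u : (\sum_(j <- I) x j).2 u = \sum_(j <- I) (x j).2 u.
    by elim: (I) => [|j J IH]; rewrite ?big_nil // !big_cons /= -IH.
  have /EcomplexP[xd1 xd2 xd3] := Ex d.
  rewrite [x d]surjective_pairing; congr (_, _).
    have [d0|d0] := eqVneq d 0; last exact: xd1.
    have := congr1 fst sum0; rewrite fstE (bigD1_seq d) //= big1 ?addr0 // => j jd.
    by have /EcomplexP[xj1 _ _] := Ex j; apply: xj1; rewrite -d0.
  apply: dform_eq => u; have [du|du] := eqVneq (size u)%:Z (d + q.+1%:Z); last exact: xd2.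
  have := congr1 (fun z : W => z.2 u) sum0.
  rewrite sndE (bigD1_seq d) //= big1 ?addr0 // => j jd.
  have /EcomplexP[_ xj2 _] := Ex j; apply: xj2; rewrite du.
  by apply: contraNneq jd => /addIr ->.
Qed.

Lemma homogeneous_cons (B : int -> set W) d ds e s :
  homogeneous B (d :: ds) (e :: s) <-> B d e /\ homogeneous B ds s.
Proof.
split=> [[/= [dss] hs]|[Be [dss hs]]].
  by split; [exact: (hs 0%N)|split=> // j js; exact: (hs j.+1)].
by split=> [/=|[|j]]; [rewrite dss| |exact: hs].
Qed.

Lemma homogeneous_pure ds s : homogeneous E ds s ->
  (count (fun d : int => d != 0%R) ds <= count (@pure_form R m M) s)%N.
Proof.
elim: s ds => [|e s IH] [|d ds] //; try by case.
move=> /homogeneous_cons[/EcomplexP[e1 _ _] /IH le_c] /=.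
rewrite leq_add //; case: eqP => //= /eqP d0.
by rewrite /pure_form e1 ?eqxx.
Qed.

Lemma sum_degrees0 ds : count (fun d : int => d != 0%R) ds = 0%N -> \sum_(d <- ds) d = 0.
Proof.
elim: ds => [|d ds IH] /=; first by rewrite big_nil.
by case: eqP => //= -> /IH; rewrite big_cons add0r.
Qed.

Lemma bracket_lin s t (a : R) (x y : W) :
  bracket (s ++ (a *: x + y) :: t) = a *: bracket (s ++ x :: t) + bracket (s ++ y :: t).
Proof.
have lbD X Y Z : lie_bracket X (a *: Y + Z) = a *: lie_bracket X Y + lie_bracket X Z :> V.
  rewrite lie_bracketDr; congr (_ + _); apply: vfield_eq => f.
  change (X (a *: Y f) - a *: Y (X f) = a *: (X (Y f) - Y (X f))).
  by rewrite vfieldZ scalerBr.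
rewrite [LHS]surjective_pairing [RHS]surjective_pairing; congr (_, _); last first.
  by rewrite /bracket /= !size_cat /= (slot_linear_form_part _ _) scalerDr !scalerA mulrC.
rewrite /bracket /=.
case: s => [|e1 [|e2 s]] /=.
- case: t => [|e2 [|? ?]] /=; rewrite ?scaler0 ?addr0 //.
  by rewrite lie_bracketC lbD opprD -scalerN -!lie_bracketC.
- by case: t => [|? ?] /=; rewrite ?lbD // ?scaler0 ?addr0.
- by case: s => [|? [|? ?]]; rewrite /= ?scaler0 ?addr0.
Qed.

Lemma bracket_swap s t (x y : W) : bracket (s ++ x :: y :: t) = - bracket (s ++ y :: x :: t).
Proof.
rewrite [LHS]surjective_pairing [RHS]surjective_pairing; congr (_, _); last first.
  rewrite /bracket /= !size_cat /= -scalerN.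
  by rewrite (alternate_swaps (@slot_linear_form_part _ _ _ _ _) (@alternate_form_part _ _ _ _ _)).
rewrite /bracket /=; case: s => [|e1 [|e2 s]] /=.
- by case: t => [|? ?] /=; rewrite ?oppr0 // lie_bracketC.
- by case: t => [|? ?]; rewrite oppr0.
- by case: s => [|? [|? ?]]; rewrite /= ?oppr0.
Qed.

Lemma bracket0 t : bracket (0 :: t) = 0.
Proof.
have := bracket_lin [::] t (-1) 0 0.
by rewrite scaler0 addr0 scaleN1r addNr.
Qed.

Lemma bracket_nil : bracket [::] = 0.
Proof.
rewrite [LHS]surjective_pairing; congr (_, _).
by rewrite bracket2E big_ord0 add0r twistE /= mulr0 !mul0r scale0r.
Qed.

Lemma lower_bracket s : lower q.+2 (bracket s).2 = (bracket s).2.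
Proof.
rewrite /bracket /= linearZ /=; congr (_ *: _).
exact: (congr1 (@^~ s) (low_form_part H_deg)).
Qed.

(** At most one entry has nonzero degree, since otherwise the bracket vanishes;
this entry provides the form and determines the degree of the result. *)
Lemma bracket_form_in ds s : homogeneous E ds s -> (0 < size s)%N ->
  form_in q (\sum_(d <- ds) d + 2 - (size s)%:Z) (bracket s).2.
Proof.
move=> hs s_gt0 u su; have [dss hE] := hs; rewrite bracket2E dformD.
have dsum j : (j < size s)%N -> ~~ has (@pure_form R m M) (omit j s) ->
    \sum_(d <- ds) d = ds`_j.
  move=> js nhas; rewrite (big_nth 0) dss big_mkord (bigD1 (Ordinal js)) //=.
  rewrite big1 ?addr0 // => k kj; apply/eqP/negPn/negP => k0.
  have /EcomplexP[/(_ k0) sk _ _] := hE k (ltn_ord k).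
  case/negP: nhas; have kj' : k != j :> nat by [].
  apply/hasP; exists s`_k; last by rewrite /pure_form sk.
  rewrite /omit mem_cat; case: (ltngtP k j) kj' => // kj' _; apply/orP; [left|right].
    by rewrite -(nth_take 0 kj') mem_nth // size_takel // ltnW.
  rewrite -(subnKC kj') -nth_drop mem_nth // size_drop ltn_sub2r //.
  exact: leq_ltn_trans kj' _.
have -> : ((-1) ^+ size s *: twist H s) u = 0.
  have [hp|nhp] := boolP (has (@pure_form R m M) s).
    by rewrite (horizontal_has (@horizontal_twist _ _ _ _)) // scaler0.
  have d0 : \sum_(d <- ds) d = 0.
    apply/sum_degrees0/eqP; rewrite -leqn0 (leq_trans (homogeneous_pure hs)) //.
    by rewrite leqNgt -has_count.
  rewrite dformZ (weight_twist H_deg) ?scaler0 //.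
  by apply: contraNneq su; rewrite d0 => ?; lia.
rewrite addr0; elim/big_rec: _ => [|j x _ x0] //; rewrite dformD x0 addr0 dformZ.
have [hp|nhp] := boolP (has (@pure_form R m M) (omit j s)).
  by rewrite (horizontal_has (@horizontal_bracket_op_cst _ _ _ _ _)) // scaler0.
have /EcomplexP[_ sj _] := hE j (ltn_ord j).
rewrite (dsum j) // in su.
have so : size (omit j s) = (size s).-1.
  by rewrite size_cat size_takel ?size_drop; [have := ltn_ord j; lia|exact: ltnW].
have [dq|dq] := leP 0 (ds`_j + q.+1%:Z); last first.
  have -> : (s`_j).2 = 0 by apply: dform_eq => v; apply: sj; lia.
  by rewrite linear0 bracket_op0 scaler0.
have Ok : Omega (absz (ds`_j + q.+1%:Z)) (lower q.+2 (s`_j).2).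
  move=> v vk; rewrite lowerE sj ?if_same //.
  by apply: contraNneq vk => vE; lia.
rewrite (weight_bracket_op q.+1 (weight_cst Ok)) ?scaler0 // so.
by apply: contraNneq su => uE; lia.
Qed.

(** In positive degree the form would have degree at least [r], but brackets have
lower degree. *)
Lemma bracket_degree_E ds s : homogeneous E ds s -> (0 < size s)%N ->
  E (\sum_(d <- ds) d + 2 - (size s)%:Z) (bracket s).
Proof.
move=> hs s_gt0; apply/EcomplexP; split.
- move=> d0; rewrite /bracket /=.
  case: s hs s_gt0 d0 => [|e1 [|e2 [|? ?]]] //= hs _ d0.
  have [hp|nhp] := boolP (has (@pure_form R m M) [:: e1; e2]).
    exact: (vpart0 hp).
  case/negP: d0; rewrite sum_degrees0 ?add0r ?subrr //.
  apply/eqP; rewrite -leqn0 (leq_trans (homogeneous_pure hs)) //.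
  by rewrite leqNgt -has_count.
- exact: bracket_form_in.
- move=> d_pos; rewrite -lower_bracket; apply: dform_eq => u; rewrite lowerE.
  case: ltnP => // ur; apply: (bracket_form_in hs) => //.
  by move: d_pos ur; set d := _ - _; move: d => d; lia.
Qed.

Lemma Ecomplex_pure d e : E d e -> d != 0 -> pure_form e.
Proof. by move=> /EcomplexP[e1 _ _] d0; rewrite /pure_form e1. Qed.

(** If both entries have nonzero degree then both sides vanish, otherwise there is
no Koszul sign. *)
Lemma bracket_skew_E ds s dt t d f (x y : W) :
  homogeneous E ds s -> homogeneous E dt t -> E d x -> E f y ->
  bracket (s ++ x :: y :: t) =
  - ((-1) ^+ absz (d * f) *: bracket (s ++ y :: x :: t)).
Proof.
move=> _ _ Ex Ey; have [d0|d0] := eqVneq d 0.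
  by rewrite d0 mul0r scale1r bracket_swap.
have [f0|f0] := eqVneq f 0; first by rewrite f0 mulr0 scale1r bracket_swap.
have px := Ecomplex_pure Ex d0; have py := Ecomplex_pure Ey f0.
have cE (a b : W) : pure_form a -> pure_form b ->
    (1 < count (@pure_form R m M) (s ++ a :: b :: t))%N.
  by move=> pa pb; rewrite count_cat /= pa pb; lia.
by rewrite !bracket_vanish ?cE // scaler0 oppr0.
Qed.

Lemma shuffle_sum_fst (Psi : seq W -> seq W -> W) s :
  (shuffle_sum Psi s).1 = shuffle_sum (fun a b => (Psi a b).1) s.
Proof.
elim: s Psi => //= e s IH Psi; rewrite !IH; congr (_ + _).
Qed.

Lemma shuffle_sum_snd (Psi : seq W -> seq W -> W) s :
  (shuffle_sum Psi s).2 = shuffle_sum (fun a b => (Psi a b).2) s.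
Proof.
by elim: s Psi => //= e s IH Psi; rewrite !IH.
Qed.

Lemma jacobi_shuffle_sum s :
  shuffle_sum (fun a b => (-1) ^+ (size a * size b) *: bracket (bracket a :: b)) s = 0.
Proof.
rewrite [LHS]surjective_pairing shuffle_sum_fst shuffle_sum_snd.
by rewrite (jacobi_vfield q.+1 H s) (jacobi_form H_deg H_closed s).
Qed.

Lemma pure_pair s j k : (j < k)%N -> (k < size s)%N -> @pure_form R m M s`_j ->
  @pure_form R m M s`_k -> (1 < count (@pure_form R m M) s)%N.
Proof.
move=> jk ks pj pk; rewrite -(cat_take_drop k s) count_cat (drop_nth 0 ks) /= pk.
rewrite addnA addn1 ltnS addn_gt0 -has_count.
apply/orP; left; apply/hasP; exists s`_j => //.
by rewrite -(nth_take 0 jk) mem_nth // size_takel // ltnW.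
Qed.

Lemma koszul_trivial ds s (sigma : 'S_(size s)) : homogeneous E ds s ->
  (count (@pure_form R m M) s <= 1)%N -> koszul_sign R sigma ds = 1.
Proof.
move=> [_ hE] c1; rewrite /koszul_sign big1 // => -[a b] /= /andP[ab _].
have [d0|d0] := eqVneq (ds`_(sigma a)) 0; first by rewrite d0 mul0r.
have [f0|f0] := eqVneq (ds`_(sigma b)) 0; first by rewrite f0 mulr0.
have pa := Ecomplex_pure (hE _ (ltn_ord (sigma a))) d0.
have pb := Ecomplex_pure (hE _ (ltn_ord (sigma b))) f0.
have : sigma a != sigma b by rewrite (inj_eq perm_inj) -(inj_eq val_inj) ltn_eqF.
rewrite -(inj_eq val_inj) /= neq_ltn => /orP[] lt_s.
  by have := pure_pair lt_s (ltn_ord _) pa pb; rewrite ltnNge c1.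
by have := pure_pair lt_s (ltn_ord _) pb pa; rewrite ltnNge c1.
Qed.

Lemma perm_permute s (sigma : 'S_(size s)) : perm_eq (permute sigma) s.
Proof.
pose g (k : 'I_(size s)) := s`_k.
have sE : s = map g (enum 'I_(size s)).
  by rewrite -[LHS](mkseq_nth 0) /mkseq -val_enum_ord -map_comp.
have pE : permute sigma = map g (map sigma (enum 'I_(size s))).
  by rewrite -map_comp.
rewrite pE [X in perm_eq _ X]sE; apply: perm_map; apply: uniq_perm.
- by rewrite (map_inj_uniq (@perm_inj _ sigma)) enum_uniq.
- exact: enum_uniq.
move=> k; rewrite mem_enum; apply/mapP; exists ((sigma^-1)%g k).
  by rewrite mem_enum.
by rewrite permKV.
Qed.

(** If each of the two brackets sees only one pure form, then the inner bracket is
itself a pure form. *)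
Lemma nested_vanish s t : (1 < count (@pure_form R m M) (s ++ t))%N ->
  bracket (bracket s :: t) = 0.
Proof.
rewrite count_cat; case c1E : (count _ s) => [|[|c]] c_gt.
- by apply: bracket_vanish; rewrite /= (leq_trans c_gt) // leq_addl.
- apply: bracket_vanish; rewrite /= {1}/pure_form.
  have -> : (bracket s).1 = 0 by apply: vpart0; rewrite has_count c1E.
  by rewrite eqxx.
- by rewrite (@bracket_vanish _ _ _ _ _ s) ?c1E // bracket0.
Qed.

(** If two entries have nonzero degree then every term vanishes; otherwise all
Koszul signs are trivial and the sum is the one of [jacobi_shuffle_sum]. *)
Lemma bracket_jacobi_E ds s : homogeneous E ds s -> (0 < size s)%N ->
  \sum_(1 <= i < (size s).+1)
    \sum_(sigma : 'S_(size s) | shuffle i sigma)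
      (let j := ((size s).+1 - i)%N in
       (chi R sigma ds * (-1) ^+ (i * (j - 1))) *:
         bracket (bracket (take i (permute sigma)) :: drop i (permute sigma))) = 0.
Proof.
move=> hs s_gt0; have [c1|c2] := leqP (count (@pure_form R m M) s) 1; last first.
  rewrite big1 // => j _; rewrite big1 // => sigma _.
  have -> : bracket (bracket (take j (permute sigma)) :: drop j (permute sigma)) = 0.
    by apply: nested_vanish; rewrite cat_take_drop (seq.permP (perm_permute sigma)).
  by rewrite /= scaler0.
rewrite -[RHS](jacobi_shuffle_sum s) -sum_shufflesE -(big_mkord xpredT
  (fun i => \sum_(p : 'S_(size s) | shuffle i p) split_term _ i p)).
(* the splitting with empty first block contributes nothing *)
rewrite [RHS]big_ltn //= [X in _ = X + _]big1 ?add0r => [|p _]; last first.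
  by rewrite /split_term take0 bracket_nil bracket0 !scaler0.
rewrite big_nat_cond [RHS]big_nat_cond; apply: eq_bigr => j /andP[/andP[j_gt0 js] _].
rewrite ltnS in js; apply: eq_bigr => sigma _; rewrite /split_term /=.
rewrite /chi (koszul_trivial _ hs c1) mulr1 scalerA.
by rewrite size_takel ?size_drop size_permute // subSn // subn1.
Qed.

Theorem bracket_Lie_algebra : Lie_algebra q.+2 E bracket.
Proof.
split; first exact: Ecomplex_graded.
  split.
  - by move=> *; exact: bracket_lin.
  - exact: bracket_degree_E.
  - exact: bracket_skew_E.
  - exact: bracket_jacobi_E.
move=> d e Ede nd; have /EcomplexP[e1 e2 e3] := Ede.
have d0 : d != 0 by apply: contraNneq nd => ->; lia.
rewrite [e]surjective_pairing e1 //; congr (_, _).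
have [d_pos|d_le] := ltP 0 d; first exact: e3.
apply: dform_eq => u; apply: e2; apply: contraNneq nd => ?; lia.
Qed.

End LieAlgebra.

(** * The prescribed values of the brackets *)

Section BracketValues.
Context (R : realType) (m : nat) (M : smooth_manifold R m) (q : nat) (H : dform M).
Notation V := (vfield M).
Notation F := (dform M).
Local Notation W := (V * F)%type.
Implicit Types (e : W) (s t : seq W) (x y : F) (X Y : V).
Local Notation cst := (@cst_cochain R W F).
Local Notation bracket := (bracket q.+1 H).
Local Notation twist := (@twist R m M H).
Local Notation top_part := (top_part q.+1).
Local Notation bracket_op := (bracket_op q.+1).

Lemma lower_id k x : Omega k x -> (k <= q.+1)%N -> lower q.+2 x = x.
Proof. by move=> xk kq; rewrite (lower_Omega _ xk) ltnS kq. Qed.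

Lemma bracket_unary e : bracket [:: e] = (0, extd (lower q.+1 (lower q.+2 e.2))).
Proof.
rewrite [LHS]surjective_pairing; congr (_, _).
by rewrite bracket2E big_ord_recl big_ord0 twist1 scaler0 !addr0 scale1r /omit bracket_op_cst0.
Qed.

Lemma bracket_sections2 e1 e2 : Omega q.+1 e1.2 -> Omega q.+1 e2.2 ->
  bracket [:: e1; e2] = courant e1 e2 + (0, contracts [:: e1.1; e2.1] H).
Proof.
move=> x1 x2; rewrite [LHS]surjective_pairing [RHS]surjective_pairing; congr (_, _).
  by change (lie_bracket e1.1 e2.1 = lie_bracket e1.1 e2.1 + 0); rewrite addr0.
rewrite bracket2E twist2; move: (contracts _ _) => h.
rewrite !big_ord_recl big_ord0 addr0 /omit /=.
rewrite (lower_id x1) // (lower_id x2) // !bracket_op_cst1 (top_top x1) (top_top x2).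
change (1 *: - (2^-1 *: (Lie e2.1 e1.2 + contract e2.1 (extd e1.2))) +
  (-1) ^+ 1 *: - (2^-1 *: (Lie e1.1 e2.2 + contract e1.1 (extd e2.2))) + h =
  (Lie e1.1 e2.2 - Lie e2.1 e1.2
   - 2^-1 *: extd (contract e1.1 e2.2 - contract e2.1 e1.2)) + h).
congr (_ + _).
have dE X x : extd (contract X x) = Lie X x - contract X (extd x).
  by rewrite Cartan addrC addKr.
have dB x y : extd (x - y) = extd x - extd y by exact: linearB.
rewrite dB !dE.
move: (Lie _ _) (Lie _ _) (contract _ _) (contract _ _) => a b c d.
by lmodule_field.
Qed.

Lemma bracket_section_form e k x : (k <= q)%N -> Omega k x ->
  bracket [:: e; (0, x)] = (0, 2^-1 *: Lie e.1 x).
Proof.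
move=> kq xk; rewrite [LHS]surjective_pairing; congr (_, _).
  exact: lie_bracket0r.
have hp : has (@pure_form R m M) [:: e; (0, x)] by rewrite /= /pure_form eqxx orbT.
rewrite bracket2E (horizontal_has (@horizontal_twist _ _ _ _) hp) scaler0 addr0.
rewrite !big_ord_recl big_ord0 addr0 /omit /=.
rewrite (horizontal_bracket_op_cst _ _ [::]) // scaler0 add0r bracket_op_cst1.
rewrite (lower_id xk) ?leqW // (top_low xk) ?ltnS // !linear0 addr0.
by rewrite expr1 scaleN1r opprK.
Qed.

Lemma bernoulli2 : bernoulli R 2 = 6^-1.
Proof.
have B0 : bernoulli R 0 = 1.
  by have := bernoulliE R 0; rewrite big_ord_recl big_ord0 addr0 bin0 mul1r.
have B1 : bernoulli R 1 = - 2^-1.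
  have := bernoulliE R 1; rewrite !big_ord_recl big_ord0 /= /bump /= B0 bin0 bin1.
  by move=> E; lra.
have := bernoulliE R 2; rewrite !big_ord_recl big_ord0 /= /bump /= B0 B1.
rewrite (_ : 'C(3, 0) = 1%N) // (_ : 'C(3, 1) = 3%N) // (_ : 'C(3, 2) = 3%N) //.
by move=> E; lra.
Qed.

Lemma nary_pair T X Y : nary_from_trinary T [:: X; Y] = T X Y :> F.
Proof.
rewrite /nary_from_trinary -/(pair_sum _ _).
have -> : pair_sum T [:: X; Y] = T X Y.
  by rewrite pair_sum_cons single_sum_cons pair_sum_cons /single_sum /pair_sum
    !big_ord0 /= subr0 !addr0.
rewrite [size _]/= bernoulli2 -[RHS]scale1r; congr (_ *: _).
by rewrite !subSS !subn0 [_./2]/= sqrrN expr1n; field.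
Qed.

Lemma bracket_trinary e0 e1 e2 :
  Omega q.+1 e0.2 -> Omega q.+1 e1.2 -> Omega q.+1 e2.2 ->
  bracket [:: e0; e1; e2] =
  (0, trinary_sections e0 e1 e2 + nary_twist H [:: e0.1; e1.1; e2.1]).
Proof.
move=> x0 x1 x2; rewrite [LHS]surjective_pairing; congr (_, _).
rewrite bracket2E twist_odd //; congr (_ + _).
rewrite !big_ord_recl big_ord0 /omit /=.
rewrite (lower_id x0) // (lower_id x1) // (lower_id x2) //.
rewrite !(bracket_op_cst_nary _ _ (n := 0)) // !nary_pair /trinary.
rewrite (top_top x0) (top_top x1) (top_top x2) addr0.
have -> : (-1) ^+ bump 0 (bump 0 0) = 1 :> R by rewrite sqrrN expr1n.
have -> : (-1) ^+ bump 0 0 = -1 :> R by rewrite expr1.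
rewrite expr0 !scale1r scaleN1r.
rewrite /trinary_sections /trinary_form /pairing /courant [(_, _).1]/= [(_, _).2]/=.
have cN Z y : contract Z (- y) = - contract Z y by exact: linearN.
have cD Z y z : contract Z (y + z) = contract Z y + contract Z z by exact: linearD.
have cZ (k : R) Z y : contract Z (k *: y) = k *: contract Z y by exact: linearZ.
have cB Z y z : contract Z (y - z) = contract Z y - contract Z z by exact: linearB.
have dB x y : extd (x - y) = extd x - extd y by exact: linearB.
have dE X x : extd (contract X x) = Lie X x - contract X (extd x).
  by rewrite Cartan addrC addKr.
have brN x : contract (lie_bracket e2.1 e0.1) x = - contract (lie_bracket e0.1 e2.1) x.
  exact: (iota_ebrC e2 e0).
rewrite !dB !dE !(cB, cD, cN, cZ) brN.
rewrite (contractC e1.1 e2.1 (extd e0.2)) (contractC e0.1 e2.1 (extd e1.2)).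
rewrite (contractC e0.1 e1.1 (extd e2.2)).
by lmodule_field.
Qed.

Lemma bracket_form_trinary k x e1 e2 : (k <= q)%N -> Omega k x ->
  bracket [:: (0, x); e1; e2] = (0, trinary_form x e1.1 e2.1).
Proof.
move=> kq xk; rewrite [LHS]surjective_pairing; congr (_, _).
have hp : has (@pure_form R m M) [:: (0, x); e1; e2] by rewrite /= /pure_form eqxx.
rewrite bracket2E (horizontal_has (@horizontal_twist _ _ _ _) hp) scaler0 addr0.
rewrite big_ord_recl big1 ?addr0 => [|j _]; last first.
  by rewrite (horizontal_bracket_op_cst _ _ [::]) // scaler0.
rewrite scale1r /omit /= ?drop0 (bracket_op_cst_nary _ _ (n := 0)) // nary_pair.
by rewrite (lower_id xk) ?leqW // (trinary_low xk) // ltnS.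
Qed.

Lemma eq_nary (T T' : V -> V -> F) Xs : (forall X Y, T X Y = T' X Y) ->
  nary_from_trinary T Xs = nary_from_trinary T' Xs.
Proof.
move=> TT'; rewrite /nary_from_trinary; congr (_ *: _).
by apply: eq_bigr => j _; apply: eq_bigr => k _; rewrite TT'.
Qed.

Lemma vpart_large s : (3 <= size s)%N -> vpart s = 0.
Proof. by case: s => [|? [|? [|? ?]]]. Qed.

Lemma size_omit s j : (j < size s)%N -> size (omit j s) = (size s).-1.
Proof. by move=> js; rewrite size_cat size_takel ?size_drop; [lia|exact: ltnW]. Qed.

Lemma bracket_sections s : (forall e, e \in s -> Omega q.+1 e.2) ->
  (3 <= size s)%N -> odd (size s) ->
  bracket s = (0, nary_sections s + nary_twist H [seq e.1 | e <- s]).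
Proof.
move=> sO s3 s_odd; rewrite [LHS]surjective_pairing; congr (_, _).
  exact: vpart_large.
rewrite bracket2E twist_odd //; congr (_ + _).
rewrite /nary_sections; apply: eq_bigr => j _; congr (_ *: _).
have sj : Omega q.+1 (s`_j).2 by apply: sO; exact: mem_nth.
have [n sn] : exists n, size s = n.+3 by exists (size s - 3)%N; lia.
rewrite (bracket_op_cst_nary _ _ (n := n)); last first.
- by move: s_odd; rewrite sn /= !negbK.
- by rewrite size_omit // sn.
by apply: eq_nary => X Y; rewrite (lower_id sj) // trinary_top.
Qed.

Lemma bracket_form k x s : (k <= q)%N -> Omega k x -> (2 <= size s)%N ->
  ~~ odd (size s) -> bracket ((0, x) :: s) = (0, nary_form x [seq e.1 | e <- s]).
Proof.
move=> kq xk s2 s_even; rewrite [LHS]surjective_pairing; congr (_, _).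
  by apply: vpart_large.
have hp : has (@pure_form R m M) ((0, x) :: s) by rewrite /= /pure_form eqxx.
rewrite bracket2E (horizontal_has (@horizontal_twist _ _ _ _) hp) scaler0 addr0.
rewrite big_ord_recl big1 ?addr0 => [|j _]; last first.
  by rewrite (horizontal_bracket_op_cst _ _ [::]) // scaler0.
have [n sn] : exists n, size s = n.+2 by exists (size s - 2)%N; lia.
rewrite scale1r /omit /= ?drop0 (bracket_op_cst_nary _ _ sn);
  last by move: s_even; rewrite sn /= negbK.
by apply: eq_nary => X Y; rewrite (lower_id xk) ?leqW // (trinary_low xk) // ltnS.
Qed.

Lemma bracket_even s : (4 <= size s)%N -> ~~ odd (size s) -> bracket s = 0.
Proof.
move=> s4 s_even; rewrite [LHS]surjective_pairing; congr (_, _).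
  by apply: vpart_large; exact: ltnW.
rewrite bracket2E twist_even //; last exact: ltnW.
rewrite addr0 big1 // => j _.
have [n sn] : exists n, size s = n.+3 by exists (size s - 3)%N; lia.
rewrite (bracket_op_cst_odd _ _ (n := n)) ?scaler0 ?size_omit ?sn //.
by move: s_even; rewrite sn /= !negbK.
Qed.

End BracketValues.

Theorem proposition8p4 (R : realType) (m : nat) (M : smooth_manifold R m)
    (r : nat) (r_ge2 : (2 <= r)%N) (H : dform M) (H_deg : Omega r.+1 H)
    (H_closed : extd H = 0) :
  exists l : seq (vfield M * dform M) -> vfield M * dform M,
  let E := @Ecomplex R m M r in
  Lie_algebra r E l
  (* unary *)
  /\ (forall e, E 0 e -> l [:: e] = 0)
  /\ (forall k xi, (k <= r - 2)%N -> Omega k xi -> l [:: (0, xi)] = (0, extd xi))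
  (* binary *)
  /\ (forall e1 e2, E 0 e1 -> E 0 e2 ->
      l [:: e1; e2] = courant e1 e2 + (0, contracts [:: e1.1; e2.1] H))
  /\ (forall e k xi, E 0 e -> (k <= r - 2)%N -> Omega k xi ->
      l [:: e; (0, xi)] = (0, 2^-1 *: Lie e.1 xi))
  (* trinary *)
  /\ (forall e0 e1 e2, E 0 e0 -> E 0 e1 -> E 0 e2 ->
      l [:: e0; e1; e2] =
      (0, trinary_sections e0 e1 e2 + nary_twist H [:: e0.1; e1.1; e2.1]))
  /\ (forall k xi e1 e2, (k <= r - 2)%N -> Omega k xi -> E 0 e1 -> E 0 e2 ->
      l [:: (0, xi); e1; e2] = (0, trinary_form xi e1.1 e2.1))
  (* n-ary, n >= 3 odd *)
  /\ (forall es : seq (vfield M * dform M), (forall e, e \in es -> E 0 e) ->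
      (3 <= size es)%N -> odd (size es) ->
      l es = (0, nary_sections es + nary_twist H [seq e.1 | e <- es]))
  /\ (forall k xi (es : seq (vfield M * dform M)), (k <= r - 2)%N -> Omega k xi ->
      (forall e, e \in es -> E 0 e) ->
      (3 <= (size es).+1)%N -> odd (size es).+1 ->
      l ((0, xi) :: es) = (0, nary_form xi [seq e.1 | e <- es]))
  (* all other brackets vanish *)
  /\ (forall ds s, homogeneous E ds s -> (4 <= size s)%N -> ~~ odd (size s) ->
      l s = 0)
  /\ (forall ds s, homogeneous E ds s -> (2 <= count (fun i => (i < 0)%R) ds)%N ->
      l s = 0).
Proof.
case: r r_ge2 H_deg => [|[|q]] // _ H_deg.
exists (bracket q.+1 H) => E.
have E0 e : E 0 e -> Omega q.+1 e.2 by [].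
rewrite !subSS subn0; split; first exact: bracket_Lie_algebra.
split=> [e /E0 ee|].
  by rewrite bracket_unary (lower_id ee) // (lower_Omega _ ee) ltnn linear0.
split=> [k xi kq xk|].
  by rewrite bracket_unary (lower_id xk) ?leqW // (lower_Omega _ xk) ltnS kq.
split=> [e1 e2 /E0 x1 /E0 x2|]; first exact: bracket_sections2.
split=> [e k xi _ kq xk|]; first exact: bracket_section_form xk.
split=> [e0 e1 e2 /E0 x0 /E0 x1 /E0 x2|]; first exact: bracket_trinary.
split=> [k xi e1 e2 kq xk _ _|]; first exact: bracket_form_trinary xk.
split=> [es esE|]; first by apply: bracket_sections => e /esE.
split=> [k xi es kq xk _ es2 es_odd|]; first exact: bracket_form xk _ es_odd.
split=> [ds s _|ds s hs neg2]; first exact: bracket_even.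
apply: bracket_vanish; apply: leq_trans neg2 _.
apply: leq_trans (homogeneous_pure hs); apply: sub_count => d.
by rewrite lt_neqAle => /andP[].
Qed.
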